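(* Consider problem $(\mathbf{PS})$ under the standing assumptions (1)–(8) listed in the context. Define $$M_X := (\|x_0\| + T M_B)e^{T M_A}, \quad M_P := 2 \alpha T |C| (|C| M_X + M_{\Omega'}) e^{T M_A},$$ $$C_X := (G_A M_X + G_B) e^{M_A T},\quad C_E := \tfrac{1}{2} C_X T (M_P G_A + \alpha |C|^2 C_X T).$$ Suppose $$\alpha > \dfrac{ 1 }{2 \lambda_{\min}(C^\top C)}, \qquad \beta > \dfrac{1}{2}M_P(H_A M_X + H_B) + \max\left\{C_E, \dfrac{1}{2} M_P^2 G_A^2 \right\}.$$ Let $(u^*(\cdot), \{x^*(\cdot, \omega)\}_{\omega \in \Omega})$ be an admissible pair obtained as a subsequential limit of the Method of Successive Approximations (described in the context) started from a continuous control $u^{(0)}:[0,T]\to U$; that is, along some subsequence $u^{(k_j)}\to u^*$, $x^{(k_j)}\to x^*$, $p^{(k_j)}\to p^*$ uniformly on $[0,T]\times\Omega$, where $x^*$ and $p^*$ are the state and adjoint variables corresponding to $u^*$, and the maximum condition $H(x^*(t,\cdot), p^*(t,\cdot), u^*(t), t) = \max_{u \in U} H(x^*(t,\cdot), p^*(t,\cdot), u, t)$ holds for a.e. $t\in[0,T]$. Then $(u^*(\cdot), \{x^*(\cdot, \omega)\}_{\omega \in \Omega})$ is optimal for $(\mathbf{PS})$.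
   Context: Problem $(\mathbf{PS})$. Let $T,\alpha,\beta>0$. $\mathbb{E}_\omega$ denotes integration over $\Omega$ with respect to the probability measure $\mu$. Controls are measurable functions $u:[0,T]\to U\subseteq\mathbb{R}^m$ (independent of $\omega$). The state variable $x$ corresponding to $u$ solves, for each $\omega$, $$\dot{x}(t, \omega) = A(t, \omega; u(t))\, x(t, \omega) + B(t, \omega; u(t)),\quad t \in [0, T], \qquad x(0, \omega) = x_0(\omega)\in\mathbb{R}^n,$$ and the adjoint variable $p$ corresponding to $u$ (and $x$) solves $$\dot{p}(t, \omega) = - A(t, \omega; u(t))^\top p(t, \omega) + 2 \alpha C^\top (Cx(t, \omega) - \mathcal{F}(\omega)(t)),\quad t\in[0,T],\qquad p(T,\omega)=0.$$ A pair $(u(\cdot),\{x(\cdot,\omega)\}_{\omega\in\Omega})$ is admissible if $u$ is a control and for each $\omega\in\Omega$, $x(\cdot,\omega)$ is the unique solution of the state equation. The cost is $J(u(\cdot)) = \int_0^T \mathbb{E}_{\omega} [ \alpha |C x(t, \omega) - \mathcal{F}(\omega)(t)|^2 + \beta |u(t)|^2 ] \, \mathrm{d}t$; an admissible pair $(u^*,\{x^*(\cdot,\omega)\}_\omega)$ is optimal for $(\mathbf{PS})$ if $J(u^* )\le J(u)$ for every admissible pair $(u,\{x(\cdot,\omega)\}_\omega)$. The Hamiltonian is $$H(x(t, \cdot), p(t, \cdot), u, t) := \mathbb{E}_{\omega} \left[ p(t, \omega) \cdot \left( A(t, \omega; u) x(t, \omega) + B(t, \omega; u) \right) - \alpha |C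 x(t, \omega) - \mathcal{F}(\omega)(t)|^2 - \beta |u|^2 \right].$$ Method of Successive Approximations. Input: a continuous control $u^{(0)}:[0,T]\to U$. For $k=0,1,2,\dots$: let $x^{(k)}$ be the state variable corresponding to $u^{(k)}$; let $p^{(k)}$ be the adjoint variable corresponding to $u^{(k)}$ and $x^{(k)}$; and choose $u^{(k+1)}$ with values in $U$ such that for all $t\in[0,T]$, $$H(x^{(k)}(t,\cdot), p^{(k)}(t,\cdot), u^{(k+1)}(t), t) = \max_{u \in U} H(x^{(k)}(t,\cdot), p^{(k)}(t,\cdot), u, t).$$ Norms: $|\cdot|$ is the Euclidean norm of vectors and the spectral norm of matrices; $\|\cdot\|$ is the supremum norm of a function, with $\|x_0\|=\sup_{\omega\in\Omega}|x_0(\omega)|$; $\|\cdot\|_{\mathrm{op}}$ is the operator norm; $\lambda_{\min}$ is the smallest eigenvalue. For derivatives in $u$: $D_uA(t,\omega;u)[v]=\sum_i v_i\,\partial A/\partial u_i$, $D_u^2A(t,\omega;u)[v,w]=\sum_{i,j}v_iw_j\,\partial^2A/\partial u_i\partial u_j$, $\|D_uA\|_{\mathrm{op}}=\sup_{|v|=1}|D_uA[v]|$, $\|D_u^2A\|_{\mathrm{op}}=\sup_{|v|=|w|=1}|D_u^2A[v,w]|$, and likewise for $B$. Standing assumptions: (1) $\Omega$ is a compact and convex subset of $\tilde\Omega$, a bounded open subset of $C([0,T];\mathbb{R}^d)$ with the supremum norm; $\Sigma$ is the Borel $\sigma$-algebra on $\Omega$; $\mu$ is an arbitrary fixed probability measure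 on $(\Omega,\Sigma)$. (2) $\Omega'$ is a compact subset of $C([0,T];\mathbb{R}^{d'})$ with the supremum norm; in particular there is $M_{\Omega'}>0$ with $\|\omega'\|\le M_{\Omega'}$ for all $\omega'\in\Omega'$. (3) $\mathcal{F}:\tilde\Omega\to\Omega'$ and $x_0:\tilde\Omega\to\mathbb{R}^n$ are continuously Fréchet differentiable. (4) $U$ is a nonempty, convex and compact subset of $\mathbb{R}^m$. (5) $A:[0,T]\times\tilde\Omega\times U\to\mathbb{R}^{n\times n}$ and $B:[0,T]\times\tilde\Omega\times U\to\mathbb{R}^n$ are jointly continuous, and there are $M_A,M_B>0$ with $|A(t,\omega;u)|\le M_A$, $|B(t,\omega;u)|\le M_B$ everywhere. (6) $A$ and $B$ are twice continuously differentiable in $u$, and $G_A:=\sup\|D_uA\|_{\mathrm{op}}$, $G_B:=\sup\|D_uB\|_{\mathrm{op}}$, $H_A:=\sup\|D_u^2A\|_{\mathrm{op}}$, $H_B:=\sup\|D_u^2B\|_{\mathrm{op}}$ (suprema over $[0,T]\times\tilde\Omega\times U$) are finite. Moreover there are moduli of continuity $\theta_A,\theta_B$ such that for all $t,s\in[0,T]$, $\sup_{(\omega,u)\in\tilde\Omega\times U}\|D_uA(t,\omega;u)-D_uA(s,\omega;u)\|_{\mathrm{op}}\le\theta_A(|t-s|)$ and $\sup_{(\omega,u)\in\tilde\Omega\times U}\|D_uB(t,\omega;u)-D_uB(s,\omega;u)\|_{\mathrm{op}}\le\theta_B(|t-s|)$. (7) $A$ and $B$ are Fréchet differentiable in $\omega$,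 with $\partial_\omega A$, $\partial_\omega B$ continuous and $\sup_{[0,T]\times\tilde\Omega\times U}\|\partial_\omega A\|_{\mathrm{op}}<\infty$, $\sup_{[0,T]\times\tilde\Omega\times U}\|\partial_\omega B\|_{\mathrm{op}}<\infty$. (8) $C\in\mathbb{R}^{d'\times n}$ is a constant matrix of full column rank, $d'\ge n$. *)

(* Defs.v *)
From HB Require Import structures.
From mathcomp Require Import all_boot all_order all_algebra.
From mathcomp Require Import all_classical all_reals all_analysis.
From mathcomp Require Import ring.

Set Implicit Arguments.
Unset Strict Implicit.
Unset Printing Implicit Defensive.

Import Order.TTheory GRing.Theory Num.Theory.
Import numFieldNormedType.Exports.

Local Open Scope classical_set_scope.
Local Open Scope ring_scope.

(* The library norm `|v| on 'cV[R]_n and 'M[R]_n is the max norm; it induces the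
   same topology as the norms below, and is only used through that topology. *)
Section Euclidean.
Context {R : realType}.

Definition dotv n (v w : 'cV[R]_n) : R := \sum_i v i 0 * w i 0.

Definition enorm n (v : 'cV[R]_n) : R := Num.sqrt (dotv v v).

Lemma dotvv_ge0 n (v : 'cV[R]_n) : 0 <= dotv v v.
Proof. by apply: sumr_ge0 => i _; rewrite -expr2 sqr_ge0. Qed.

Lemma enorm_ge0 n (v : 'cV[R]_n) : 0 <= enorm v.
Proof. exact: sqrtr_ge0. Qed.

Lemma enorm_sqr n (v : 'cV[R]_n) : enorm v ^+ 2 = dotv v v.
Proof. by rewrite sqr_sqrtr// dotvv_ge0. Qed.

Lemma dotvC n (v w : 'cV[R]_n) : dotv v w = dotv w v.
Proof. by apply: eq_bigr => i _; rewrite mulrC. Qed.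

Lemma dotvDl n (u v w : 'cV[R]_n) : dotv (u + v) w = dotv u w + dotv v w.
Proof.
by rewrite /dotv -big_split/=; apply: eq_bigr => i _; rewrite mxE mulrDl.
Qed.

Lemma dotvZl n a (u w : 'cV[R]_n) : dotv (a *: u) w = a * dotv u w.
Proof.
by rewrite /dotv mulr_sumr; apply: eq_bigr => i _; rewrite mxE mulrA.
Qed.

Lemma dotvDr n (u v w : 'cV[R]_n) : dotv w (u + v) = dotv w u + dotv w v.
Proof. by rewrite dotvC dotvDl !(dotvC _ w). Qed.

Lemma dotvZr n a (u w : 'cV[R]_n) : dotv w (a *: u) = a * dotv w u.
Proof. by rewrite dotvC dotvZl dotvC. Qed.

Lemma dotvv_eq0 n (v : 'cV[R]_n) : dotv v v = 0 -> v = 0.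
Proof.
move=> /eqP; rewrite psumr_eq0; last by move=> i _; rewrite -expr2 sqr_ge0.
move=> /allP v0; apply/matrixP => i j; rewrite (ord1 j) mxE.
have /v0 := mem_index_enum i.
by rewrite /= -expr2 sqrf_eq0 => /eqP.
Qed.

Lemma enorm_eq0 n (v : 'cV[R]_n) : enorm v = 0 -> v = 0.
Proof.
by move=> v0; apply: dotvv_eq0; rewrite -enorm_sqr v0 expr0n.
Qed.

Lemma enorm0 n : enorm (0 : 'cV[R]_n) = 0.
Proof.
by rewrite /enorm /dotv big1 ?sqrtr0// => i _; rewrite mxE mul0r.
Qed.

Lemma enormZ n a (v : 'cV[R]_n) : enorm (a *: v) = `|a| * enorm v.
Proof.
by rewrite /enorm dotvZl dotvZr mulrA -expr2 sqrtrM ?sqr_ge0// sqrtr_sqr.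
Qed.

Lemma dotv_le n (v w : 'cV[R]_n) : dotv v w <= enorm v * enorm w.
Proof.
have [w0|w0] := eqVneq (enorm w) 0.
  by rewrite (enorm_eq0 w0) enorm0 mulr0 /dotv big1// => i _; rewrite mxE mulr0.
have W : 0 < dotv w w by rewrite -enorm_sqr exprn_gt0// lt_neqAle eq_sym w0 enorm_ge0.
have := dotvv_ge0 (dotv w w *: v + (- dotv v w) *: w).
rewrite !(dotvDl, dotvDr, dotvZl, dotvZr) (dotvC w v).
set a := dotv v v; set b := dotv v w; set c := dotv w w => h.
have {}h : 0 <= c * (a * c - b ^+ 2).
  by apply: le_trans h _; rewrite le_eqVlt; apply/orP; left; apply/eqP; ring.
rewrite pmulr_rge0// subr_ge0 in h.
apply: le_trans (ler_norm _) _.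
rewrite -(@ler_pXn2r _ 2)// ?nnegrE ?mulr_ge0 ?enorm_ge0//.
by rewrite real_normK ?num_real// exprMn !enorm_sqr.
Qed.

Lemma ler_enormD n (v w : 'cV[R]_n) : enorm (v + w) <= enorm v + enorm w.
Proof.
rewrite -(@ler_pXn2r _ 2)// ?nnegrE ?addr_ge0 ?enorm_ge0//.
rewrite sqrrD !enorm_sqr dotvDl !dotvDr (dotvC w v) -addrA [leRHS]addrAC -addrA.
rewrite lerD2l [leLHS]addrA -mulr2n [leRHS]addrC lerD2r lerMn2r dotv_le//.
Qed.

Lemma enorm_le n (v : 'cV[R]_n) : enorm v <= Num.sqrt n%:R * `|v|.
Proof.
rewrite -(@ler_pXn2r _ 2)// ?nnegrE ?mulr_ge0 ?sqrtr_ge0 ?enorm_ge0//.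
rewrite enorm_sqr exprMn sqr_sqrtr// mulr_natl.
have -> : `|v| ^+ 2 *+ n = \sum_(i < n) `|v| ^+ 2 by rewrite sumr_const card_ord.
apply: ler_sum => i _; rewrite -expr2 -[leLHS]real_normK ?num_real//.
rewrite ler_pXn2r// ?nnegrE//.
by rewrite [leRHS]/Num.Def.normr/= mx_normrE; apply: (le_bigmax _ (fun ij : _ * _ => `|v ij.1 ij.2|) (i, 0)).
Qed.

End Euclidean.

(* C([0, T]; R^n): an element is represented by a function on R that vanishes
   outside [0, T], so that Leibniz equality is equality on [0, T]. *)
Section continuous_paths.
Context {R : realType} (T : R) (n : nat).

Definition is_path : {pred R -> 'cV[R]_n} :=
  mem [set f : R -> 'cV[R]_n |
    {within `[0, T], continuous f} /\ forall t, t \notin `[0, T] -> f t = 0].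

Record cpath := CPath { cpath_fun :> R -> 'cV[R]_n ; _ : cpath_fun \in is_path }.

HB.instance Definition _ := [isSub for cpath_fun].
HB.instance Definition _ := [Choice of cpath by <:].

Fact is_path_submod_closed : submod_closed is_path.
Proof.
split.
  by rewrite inE; split => // x; exact: cst_continuous.
move=> a f g; rewrite !inE => -[cf f0] [cg g0]; split.
  move=> x; apply: cvgD; last exact: cg.
  by apply: cvgZr; exact: cf.
move=> t tT; have -> : (a *: f + g) t = a *: f t + g t by [].
by rewrite f0// g0// scaler0 addr0.
Qed.

HB.instance Definition _ := GRing.isSubmodClosed.Build _ _ is_path
  is_path_submod_closed.
HB.instance Definition _ := [SubChoice_isSubLmodule of cpath by <:].

Definition supnorm (f : cpath) : R := sup [set enorm (f t) | t in `[0, T]].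

Lemma cpath_bounded (f : cpath) : has_ubound [set enorm (f t) | t in `[0, T]].
Proof.
case: f => f fP /=; have /set_mem[cf _] := fP.
have /compact_bounded[M [_ /(_ (M + 1))]] :=
  continuous_compact cf (@segment_compact R 0 T).
rewrite ltrDl => /(_ ltr01) fM.
exists (Num.sqrt n%:R * (M + 1)) => _ [t tT <-]/=.
apply: le_trans (enorm_le _) _; apply: ler_wpM2l; first exact: sqrtr_ge0.
by apply: fM; exists t.
Qed.

Lemma supnorm_ub (f : cpath) t : enorm (f t) <= supnorm f.
Proof.
have [tT|tT] := boolP (t \in `[0, T]).
  by apply: ub_le_sup; [exact: cpath_bounded|exists t].
have -> : f t = 0 by case: f => f /= /set_mem[_]; exact.
rewrite enorm0 /supnorm.
set S := (X in sup X); have [->|/set0P[_ [s sT _]]] := eqVneq S set0.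
  by rewrite sup0.
apply: le_trans (enorm_ge0 (f s)) _.
by apply: ub_le_sup; [exact: cpath_bounded|exists s].
Qed.

Lemma supnorm_le (f : cpath) M : 0 <= M ->
  (forall t, enorm (f t) <= M) -> supnorm f <= M.
Proof.
move=> M0 fM; rewrite /supnorm.
set S := (X in sup X); have [->|/set0P ne] := eqVneq S set0.
  by rewrite sup0.
by apply: ge_sup => // _ [t _ <-].
Qed.

Lemma supnorm_ge0 (f : cpath) : 0 <= supnorm f.
Proof. exact: le_trans (enorm_ge0 (f 0)) (supnorm_ub f 0). Qed.

Lemma ler_supnormD (f g : cpath) : supnorm (f + g) <= supnorm f + supnorm g.
Proof.
apply: supnorm_le => [|t]; first by rewrite addr_ge0 ?supnorm_ge0.
by apply: le_trans (ler_enormD _ _) _; rewrite lerD ?supnorm_ub.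
Qed.

Lemma supnormZ a (f : cpath) : supnorm (a *: f) = `|a| * supnorm f.
Proof.
have le b (g : cpath) : supnorm (b *: g) <= `|b| * supnorm g.
  apply: supnorm_le => [|t]; first by rewrite mulr_ge0 ?supnorm_ge0.
  by rewrite [(b *: g) t]/(b *: g t) enormZ ler_wpM2l ?supnorm_ub.
apply/eqP; rewrite eq_le le/=.
have [->|a0] := eqVneq a 0; first by rewrite normr0 mul0r supnorm_ge0.
rewrite -{1}(scalerK a0 f) -ler_pdivlMl ?normr_gt0// -normfV.
exact: le.
Qed.

Lemma supnorm_eq0 (f : cpath) : supnorm f = 0 -> f = 0.
Proof.
move=> f0; apply/val_inj/funext => t; apply: enorm_eq0.
by apply/eqP; rewrite eq_le enorm_ge0 -f0 supnorm_ub.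
Qed.

HB.instance Definition _ := Lmodule_isNormed.Build R cpath
  ler_supnormD supnormZ supnorm_eq0.

End continuous_paths.

Section norms_and_derivatives.
Context {R : realType}.

Definition opnorm (V : Type) (W : Type) (NV : V -> R) (NW : W -> R)
  (L : V -> W) : R := sup [set NW (L v) | v in [set v | NV v = 1]].

Definition opnorm2 (V : Type) (W : Type) (NV : V -> R) (NW : W -> R)
    (L : V -> V -> W) : R :=
  sup [set NW (L v.1 v.2) | v in [set v | NV v.1 = 1 /\ NV v.2 = 1]].

Definition spec_norm p q (M : 'M[R]_(p, q)) : R :=
  opnorm (@enorm R q) (@enorm R p) (mulmx M).

Definition lambda_min n (M : 'M[R]_n) : R := inf [set a | eigenvalue M a].

Definition partial m (W : normedModType R) (f : 'cV[R]_m -> W) (i : 'I_m) :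
  'cV[R]_m -> W := 'D_(delta_mx i 0) f.

Definition Du m (W : normedModType R) (f : 'cV[R]_m -> W) (u v : 'cV[R]_m) : W :=
  \sum_i v i 0 *: partial f i u.

Definition D2u m (W : normedModType R) (f : 'cV[R]_m -> W)
    (u v w : 'cV[R]_m) : W :=
  \sum_i \sum_j (v i 0 * w j 0) *: partial (partial f j) i u.

(* A function on a closed set U is C^2 when it is the restriction to U of a
   function that is C^2 on an open neighbourhood of U; f stands for the
   extension. *)
Definition C2_around m (W : normedModType R) (U : set 'cV[R]_m)
    (f : 'cV[R]_m -> W) : Prop :=
  exists V : set 'cV[R]_m, [/\ open V, U `<=` V &
    forall u, V u ->
      [/\ {for u, continuous f},
          forall i, derivable f u (delta_mx i 0) /\
            {for u, continuous (partial f i)} &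
          forall i j, derivable (partial f j) u (delta_mx i 0) /\
            {for u, continuous (partial (partial f j) i)}]].

Definition C1_frechet (V W : normedModType R) (NW : W -> R) (D : set V)
    (f : V -> W) : Prop :=
  (forall w, D w -> differentiable f w) /\
  forall w, D w -> forall e : R, 0 < e ->
    \forall w' \near within D (nbhs w),
      opnorm Num.norm NW (fun h => 'd f w' h - 'd f w h) < e.

Definition modulus_of_continuity (theta : R -> R) : Prop :=
  [/\ theta 0 = 0, forall r : R, 0 <= r -> 0 <= theta r &
      theta r @[r --> 0^'+] --> 0].

Definition abs_continuous n (a b : R) (f : R -> 'cV[R]_n) : Prop :=
  forall e : R, 0 < e -> exists2 dl : R, 0 < dl &
    forall N (s r : 'I_N -> R),
      (forall i, [/\ a <= s i, s i <= r i & r i <= b]) ->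
      trivIset setT (fun i => `]s i, r i[%classic) ->
      \sum_i (r i - s i) < dl ->
      \sum_i enorm (f (r i) - f (s i)) < e.

(* Solutions of y' = g(t, y) on [0, T] are understood in the sense of
   Caratheodory, as the right-hand side is only measurable in t. *)
Definition solves_ode n (T : R) (g : R -> 'cV[R]_n -> 'cV[R]_n)
    (y : R -> 'cV[R]_n) : Prop :=
  abs_continuous 0 T y /\
  {ae lebesgue_measure, forall t : R, t \in `]0, T[ -> is_derive t 1 y (g t (y t))}.

(* Measurability with respect to the Lebesgue (that is, completed Borel)
   sigma-algebra on R, which is also the one used in cost. *)
Definition lebesgue_measurable_fun (D : set R) (f : R -> R) : Prop :=
  measurable_fun (D : set (caratheodory_type ((wlength idfun)^*)%mu)) f.

Definition is_max_on (V : Type) (U : set V) (f : V -> R) (v : V) : Prop :=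
  U v /\ forall w, U w -> f w <= f v.

End norms_and_derivatives.

(* The measure mu is a Borel probability measure on C([0, T]; R^d) carried by
   Omega (see standing_assumptions), that is, a Borel probability measure on
   Omega. Of A, B, FF, x0 only the values on [0, T] x Omegat x U, resp. Omegat,
   matter, apart from the extensions in C2_around. *)
Record problem (R : realType) (m n d d' : nat) := Problem {
  ps_T : R;
  ps_alpha : R;
  ps_beta : R;
  ps_Omegat : set (cpath ps_T d);
  ps_Omega : set (cpath ps_T d);
  ps_Omega' : set (cpath ps_T d');
  ps_mu : probability (g_sigma_algebraType (@open (cpath ps_T d))) R;
  ps_FF : cpath ps_T d -> cpath ps_T d';
  ps_x0 : cpath ps_T d -> 'cV[R]_n;
  ps_U : set 'cV[R]_m;
  ps_A : R -> cpath ps_T d -> 'cV[R]_m -> 'M[R]_n;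
  ps_B : R -> cpath ps_T d -> 'cV[R]_m -> 'cV[R]_n;
  ps_C : 'M[R]_(d', n);
  ps_M_A : R;
  ps_M_B : R;
  ps_M_Omega' : R }.

Arguments ps_Omegat {R m n d d'} p : rename.
Arguments ps_Omega {R m n d d'} p : rename.
Arguments ps_Omega' {R m n d d'} p : rename.
Arguments ps_mu {R m n d d'} p : rename.
Arguments ps_FF {R m n d d'} p : rename.
Arguments ps_x0 {R m n d d'} p : rename.
Arguments ps_A {R m n d d'} p : rename.
Arguments ps_B {R m n d d'} p : rename.
Arguments ps_U {R m n d d'} p : rename.

Section problem_theory.
Context {R : realType} {m n d d' : nat} (P : problem R m n d d').

Notation T := (ps_T P).
Notation alpha := (ps_alpha P).
Notation beta := (ps_beta P).
Notation Omegat := (ps_Omegat P).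
Notation Omega := (ps_Omega P).
Notation Omega' := (ps_Omega' P).
Notation mu := (ps_mu P).
Notation FF := (ps_FF P).
Notation x0 := (ps_x0 P).
Notation U := (ps_U P).
Notation A := (ps_A P).
Notation B := (ps_B P).
Notation C := (ps_C P).
Notation M_A := (ps_M_A P).
Notation M_B := (ps_M_B P).
Notation M_Omega' := (ps_M_Omega' P).
Notation path := (cpath T d).

Definition dom : set (R * path * 'cV[R]_m) := `[0, T] `*` Omegat `*` U.

Definition DuA_norms : set R :=
  [set opnorm (@enorm R m) (@spec_norm R n n) (Du (A z.1.1 z.1.2) z.2) | z in dom].
Definition DuB_norms : set R :=
  [set opnorm (@enorm R m) (@enorm R n) (Du (B z.1.1 z.1.2) z.2) | z in dom].
Definition D2uA_norms : set R :=
  [set opnorm2 (@enorm R m) (@spec_norm R n n) (D2u (A z.1.1 z.1.2) z.2) | z in dom].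
Definition D2uB_norms : set R :=
  [set opnorm2 (@enorm R m) (@enorm R n) (D2u (B z.1.1 z.1.2) z.2) | z in dom].

Definition G_A : R := sup DuA_norms.
Definition G_B : R := sup DuB_norms.
Definition H_A : R := sup D2uA_norms.
Definition H_B : R := sup D2uB_norms.

Definition dA (z : R * path * 'cV[R]_m) : path -> 'M[R]_n :=
  'd (fun w => A z.1.1 w z.2) (z.1.2).
Definition dB (z : R * path * 'cV[R]_m) : path -> 'cV[R]_n :=
  'd (fun w => B z.1.1 w z.2) (z.1.2).

Record standing_assumptions : Prop := StandingAssumptions {
  T_gt0 : 0 < T;
  alpha_gt0 : 0 < alpha;
  beta_gt0 : 0 < beta;

  Omegat_open : open Omegat;
  Omegat_bounded : bounded_set Omegat;
  Omega_sub : Omega `<=` Omegat;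
  Omega_compact : compact Omega;
  Omega_convex : convex_set Omega;
  mu_Omega : mu Omega = 1%E;

  Omega'_compact : compact Omega';
  M_Omega'_gt0 : 0 < M_Omega';
  M_Omega'_bound : forall w', Omega' w' -> `|w'| <= M_Omega';

  FF_range : forall w, Omegat w -> Omega' (FF w);
  FF_C1 : C1_frechet Num.norm Omegat FF;
  x0_C1 : C1_frechet (@enorm R n) Omegat x0;

  U_neq0 : U !=set0;
  U_convex : convex_set U;
  U_compact : compact U;

  A_continuous : {within dom, continuous (fun z => A z.1.1 z.1.2 z.2)};
  B_continuous : {within dom, continuous (fun z => B z.1.1 z.1.2 z.2)};
  M_A_gt0 : 0 < M_A;
  M_B_gt0 : 0 < M_B;
  M_A_bound : forall z, dom z -> spec_norm (A z.1.1 z.1.2 z.2) <= M_A;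
  M_B_bound : forall z, dom z -> enorm (B z.1.1 z.1.2 z.2) <= M_B;

  A_C2 : forall (t : R) w, t \in `[0, T] -> Omegat w -> C2_around U (A t w);
  B_C2 : forall (t : R) w, t \in `[0, T] -> Omegat w -> C2_around U (B t w);
  G_A_finite : has_ubound DuA_norms;
  G_B_finite : has_ubound DuB_norms;
  H_A_finite : has_ubound D2uA_norms;
  H_B_finite : has_ubound D2uB_norms;
  DuA_modulus : exists2 theta_A, modulus_of_continuity theta_A &
    forall t s : R, t \in `[0, T] -> s \in `[0, T] ->
    forall w u, Omegat w -> U u ->
      opnorm (@enorm R m) (@spec_norm R n n)
        (fun v => Du (A t w) u v - Du (A s w) u v) <= theta_A `|t - s|;
  DuB_modulus : exists2 theta_B, modulus_of_continuity theta_B &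
    forall t s : R, t \in `[0, T] -> s \in `[0, T] ->
    forall w u, Omegat w -> U u ->
      opnorm (@enorm R m) (@enorm R n)
        (fun v => Du (B t w) u v - Du (B s w) u v) <= theta_B `|t - s|;

  A_differentiable : forall t w u, dom (t, w, u) ->
    differentiable (fun w => A t w u) w;
  B_differentiable : forall t w u, dom (t, w, u) ->
    differentiable (fun w => B t w u) w;
  dA_continuous : forall z, dom z -> forall e : R, 0 < e ->
    \forall z' \near within dom (nbhs z),
      opnorm Num.norm (@spec_norm R n n) (fun h => dA z' h - dA z h) < e;
  dB_continuous : forall z, dom z -> forall e : R, 0 < e ->
    \forall z' \near within dom (nbhs z),
      opnorm Num.norm (@enorm R n) (fun h => dB z' h - dB z h) < e;
  dA_bounded :
    has_ubound [set opnorm Num.norm (@spec_norm R n n) (dA z) | z in dom];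
  dB_bounded :
    has_ubound [set opnorm Num.norm (@enorm R n) (dB z) | z in dom];

  C_full_column_rank : \rank C = n;
  n_le_d' : (n <= d')%N }.

Definition is_control (u : R -> 'cV[R]_m) : Prop :=
  (forall t : R, t \in `[0, T] -> U (u t)) /\
  forall i, lebesgue_measurable_fun `[0, T] (fun t => u t i 0).

Definition is_state (u : R -> 'cV[R]_m) (x : R -> path -> 'cV[R]_n) : Prop :=
  forall w, Omega w ->
    solves_ode T (fun t y => A t w (u t) *m y + B t w (u t)) (x ^~ w) /\
    x 0 w = x0 w.

Definition is_adjoint (u : R -> 'cV[R]_m) (x p : R -> path -> 'cV[R]_n) : Prop :=
  forall w, Omega w ->
    solves_ode T (fun t q => - ((A t w (u t))^T *m q) +
      (2 * alpha) *: (C^T *m (C *m x t w - FF w t))) (p ^~ w) /\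
    p T w = 0.

Definition admissible (u : R -> 'cV[R]_m) (x : R -> path -> 'cV[R]_n) : Prop :=
  is_control u /\ is_state u x.

(* Extended-real valued: the integrand is nonnegative. *)
Definition cost (u : R -> 'cV[R]_m) (x : R -> path -> 'cV[R]_n) : \bar R :=
  (\int[completed_lebesgue_measure]_(t in `[0%R, T])
    \int[mu]_(w in Omega)
      (alpha * enorm (C *m x t w - FF w t) ^+ 2 + beta * enorm (u t) ^+ 2)%:E)%E.

Definition optimal (u : R -> 'cV[R]_m) (x : R -> path -> 'cV[R]_n) : Prop :=
  admissible u x /\
  forall u' x', admissible u' x' -> (cost u x <= cost u' x')%E.

Definition hamiltonian (x p : path -> 'cV[R]_n) (u : 'cV[R]_m) (t : R) : R :=
  \int[mu]_(w in Omega)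
    (dotv (p w) (A t w u *m x w + B t w u)
     - alpha * enorm (C *m x w - FF w t) ^+ 2 - beta * enorm u ^+ 2).

Definition maximizes_hamiltonian (x p : R -> path -> 'cV[R]_n)
    (u : R -> 'cV[R]_m) (t : R) : Prop :=
  is_max_on U (fun v => hamiltonian (x t) (p t) v t) (u t).

Definition successive_approximations (u : nat -> R -> 'cV[R]_m)
    (x p : nat -> R -> path -> 'cV[R]_n) : Prop :=
  [/\ {within `[0, T], continuous (u 0%N)},
      forall t : R, t \in `[0, T] -> U (u 0%N t),
      forall k, is_state (u k) (x k),
      forall k, is_adjoint (u k) (x k) (p k) &
      forall k (t : R), t \in `[0, T] ->
        maximizes_hamiltonian (x k) (p k) (u k.+1) t].

Definition M_X : R :=
  (sup [set enorm (x0 w) | w in Omega] + T * M_B) * expR (T * M_A).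
Definition M_P : R :=
  2 * alpha * T * spec_norm C * (spec_norm C * M_X + M_Omega') * expR (T * M_A).
Definition C_X : R := (G_A * M_X + G_B) * expR (M_A * T).
Definition C_E : R :=
  2^-1 * C_X * T * (M_P * G_A + alpha * spec_norm C ^+ 2 * C_X * T).

End problem_theory.

Arguments dom {R m n d d'} P.
Arguments dA {R m n d d'} P z.
Arguments dB {R m n d d'} P z.
Arguments is_control {R m n d d'} P u.
Arguments is_state {R m n d d'} P u x.
Arguments is_adjoint {R m n d d'} P u x p.
Arguments admissible {R m n d d'} P u x.
Arguments cost {R m n d d'} P u x.
Arguments optimal {R m n d d'} P u x.
Arguments hamiltonian {R m n d d'} P x p u t.
Arguments maximizes_hamiltonian {R m n d d'} P x p u t.
Arguments successive_approximations {R m n d d'} P u x p.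

(* Main.v *)
(* Weak duality. Let (u, x) be any admissible pair, write dx = x - xs and
   y_w = ps(w) . dx(w). Then y_w vanishes at 0 and T, and differentiating it
   turns the difference of the running costs into
     y_w' + [h_w(us) - h_w(u)] + alpha |C dx|^2 - ps . (A(u) - A(us)) dx,
   where h_w is the integrand of the Hamiltonian along (xs, ps). The last two
   terms are at least - M_P^2 G_A^2 |u - us|^2 / 2, because
   alpha |C dx|^2 >= |dx|^2 / 2. The expectation of h_w is strongly concave on
   the convex set U and maximal at us, so the expectation of the bracket is at
   least (beta - M_P (H_A M_X + H_B) / 2) |u - us|^2, which compensates the loss.

   The derivatives exist only for almost every t, depending on w. To integrate
   over w first, the expectation is replaced by a finite weighted sum over
   points w_k, up to an error uniform in t: data and solutions depend
   continuously on w, uniformly in t, by Gronwall's inequality. *)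
From HB Require Import structures.
Require Import Defs.
From mathcomp Require Import all_boot all_order all_algebra.
From mathcomp Require Import all_classical all_reals all_analysis.
From mathcomp Require Import measurable_realfun ring lra.

Import Order.TTheory GRing.Theory Num.Theory.
Import numFieldNormedType.Exports.

Set Implicit Arguments.
Unset Strict Implicit.
Unset Printing Implicit Defensive.

Local Open Scope classical_set_scope.
Local Open Scope ring_scope.

(** * Absolute continuity and monotonicity *)

(** The loss of [M_P^2 G_A^2 |u - us|^2 / 2] is Young's inequality: the bilinear term is at most
    [M_P G_A |u - us| |dx|], hence at most half the sum of the squares of [M_P G_A |u - us|] and
    [|dx|], and the lower bound on alpha is what lets [alpha |C dx|^2] absorb the second square. In
    the gain, beta comes from [- beta |u|^2], while the second derivative of [p . (A x + B)] in [u],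
    at most [M_P (H_A M_X + H_B)], costs half of itself along a segment.

    The equations are only measurable in time, so every differential inequality holds almost
    everywhere and has to be integrated from the regularity of the functions. Two devices do this.
    An absolutely continuous function with nonnegative derivative almost everywhere is
    nondecreasing; this gives Gronwall's inequality. The weighted sum of the pairings [y_w] is even
    Lipschitz, because the coefficients are bounded, and its increment is bounded by an integral
    through difference quotients and dominated convergence. There the cost enters only as its
    expectation, a function of time alone, so all measurability questions concern a single
    variable. *)

Lemma real_induction (R : realType) (a b : R) (E : set R) : a <= b -> E a ->
  (forall t, a <= t <= b -> exists2 e : R, 0 < e &
     forall s r, E s -> a <= s -> s <= t -> t <= r -> r <= b ->
       t - s < e -> r - t < e -> E r) ->
  E b.
Proof.
move=> ab Ea step.
pose S := [set t | E t /\ a <= t <= b].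
have Sa : S a by split=> //; rewrite lexx.
have Sub : ubound S b by move=> t [_ /andP[]].
have hS : has_sup S by split; [exists a|exists b].
(* The supremum need not lie in [E]. The step hypothesis therefore starts at a point [s] of [E]
   slightly to the left of [t] and reaches [t] itself as well as points beyond it. *)
set t := sup S.
have at' : a <= t by exact: (ub_le_sup hS.2).
have tb : t <= b by apply: ge_sup => //; exists a.
have [|e e0 He] := step t; first by rewrite at' tb.
have [s [Es /andP[as_ sb]] ts] := sup_adherent e0 hS.
have st : s <= t.
  by apply: (ub_le_sup hS.2); split=> //; rewrite as_ sb.
have key r : t <= r -> r <= b -> r - t < e -> E r.
  by move=> tr rb rt; apply: (He s) => //; move: ts; rewrite -/t; lra.
have [tb'|] := ltP t b; last first.
  by move=> bt; apply: key => //; rewrite (_ : b - t = 0) //; apply/eqP;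
    rewrite subr_eq0 eq_le bt tb.
pose r := Num.min b (t + e / 2).
have tr : t < r by rewrite lt_min tb' ltrDl divr_gt0.
have rb : r <= b by rewrite ge_min lexx.
have Sr : S r.
  split; last by rewrite rb (le_trans at')// ltW.
  apply: key => //; first exact: ltW.
  rewrite ltrBlDl; apply: (@le_lt_trans _ _ (t + e / 2));
    first by rewrite ge_min lexx orbT.
  by rewrite ltrD2l; lra.
by have := ub_le_sup hS.2 Sr; rewrite leNgt tr.
Qed.

(** The condition of [abs_continuous] for an arbitrary increment [D s r], so that it passes from a
    vector-valued solution to scalar functions of it. *)
Definition small_increments (R : realType) (a b : R) (D : R -> R -> R) : Prop :=
  forall e : R, 0 < e -> exists2 dl : R, 0 < dl &
    forall N (s r : 'I_N -> R),
      (forall i, [/\ a <= s i, s i <= r i & r i <= b]) ->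
      trivIset setT (fun i => `]s i, r i[%classic) ->
      \sum_i (r i - s i) < dl ->
      \sum_i D (s i) (r i) < e.

(** Absolute continuity of a Lipschitz expression in [t] and [y t] follows from that of [y]; the
    summand [r - s] carries the explicit dependence on time. *)
Lemma small_increments_le (R : realType) (a b K : R) (D D' : R -> R -> R) :
  0 < K ->
  (forall s r, a <= s -> s <= r -> r <= b -> D s r <= K * (D' s r + (r - s))) ->
  small_increments a b D' -> small_increments a b D.
Proof.
move=> K0 DD' D'ac e e0.
have [|dl dl0 Hdl] := D'ac (e / (2 * K)); first by rewrite divr_gt0// mulr_gt0.
exists (Num.min dl (e / (2 * K))); first by rewrite lt_min dl0 divr_gt0// mulr_gt0.
move=> N s r sr triv; rewrite lt_min => /andP[h1 h2].
have h3 := Hdl N s r sr triv h1.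
have hle : \sum_i D (s i) (r i) <= K * (\sum_i D' (s i) (r i) + \sum_i (r i - s i)).
  rewrite -big_split/= mulr_sumr; apply: ler_sum => i _.
  by have [? ? ?] := sr i; exact: DD'.
apply: (le_lt_trans hle).
rewrite -ltr_pdivlMl// mulrC.
have -> : e / K = e / (2 * K) + e / (2 * K) by field; rewrite gt_eqF.
exact: ltrD.
Qed.

Lemma small_increments_continuous (R : realType) (a b : R) (D : R -> R -> R) (e : R) :
  small_increments a b D -> 0 < e ->
  exists2 dl : R, 0 < dl & forall s r, a <= s -> s <= r -> r <= b -> r - s < dl ->
    D s r < e.
Proof.
move=> Dac e0; have [dl dl0 H] := Dac e e0.
exists dl => // s r as_ sr rb rsd.
have := H 1%N (fun=> s) (fun=> r); rewrite !big_ord1; apply => // i j _ _ _.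
by rewrite (ord1 i) (ord1 j).
Qed.

(* Chains of links [s, r], each either inside an open set U of small measure
   containing the exceptional points or with increment at least - eta (r - s),
   exist from a to b by real induction; absolute continuity controls the links
   inside U. *)
Lemma ac_nondecreasing (R : realType) (a b : R) (f : R -> R) : a <= b ->
  small_increments a b (fun s r => `|f r - f s|) ->
  {ae lebesgue_measure, forall t : R, t \in `]a, b[ ->
     exists2 l : R, 0 <= l & is_derive t 1 f l} ->
  f a <= f b.
Proof.
move=> ab fac [N [mN N0 badN]].
rewrite -subr_ge0; apply/ler_addgt0Pr => e e0; rewrite -lerBlDr sub0r.
(* One half of [e] pays for slopes down to [- eta] over the length [b - a], the other half for the
   links inside [U]. The summand 1 keeps the denominator positive when [a = b]. *)
pose eta := e / 2 / (b - a + 1).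
have ba1 : 0 < b - a + 1 by rewrite ltr_wpDl// subr_ge0.
have eta0 : 0 < eta by rewrite divr_gt0// divr_gt0.
have [|dl dl0 Hdl] := fac (e / 2); first by rewrite divr_gt0.
(* The derivative is only known on the open interval, so the endpoints join the exceptional set. *)
pose N' := N `|` [set a; b].
have mN' : measurable N' by apply: measurableU => //; apply: measurableU;
  exact: measurable_set1.
have N'0 : lebesgue_measure N' = 0%E.
  apply/eqP; rewrite -measure_le0 (le_trans (measureU2 _ _ _))//.
    by apply: measurableU; exact: measurable_set1.
  rewrite [X in (X + _)%E]N0 add0e (le_trans (measureU2 _ _ _))//.
  by rewrite [X in (X + _)%E]lebesgue_measure_set1 [X in (_ +
    X)%E]lebesgue_measure_set1 adde0.
have [|U [Uo N'U Udl]] := lebesgue_regularity_outer mN' _ dl0;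
  first by rewrite [X in (X < _)%E]N'0 ltry.
have mU : measurable U by exact: measurable_realfun.open_measurable.
have {}Udl : (lebesgue_measure U < dl%:E)%E.
  rewrite (_ : U = (U `\` N') `|` N'); last by rewrite setDKU.
  apply: le_lt_trans Udl; apply: le_trans (measureU2 _ _ _) _ => //;
    first exact: measurableD.
  by rewrite [X in (_ + X)%E]N'0 adde0.
pose E := [set t | exists n (s r : nat -> R),
  [/\ forall i, (i < n)%N -> [/\ a <= s i, s i <= r i, r i <= t & `]s i, r i[ `<=` U],
   forall i j, (i < j)%N -> (j < n)%N -> r i <= s j &
   - eta * (t - a) - \sum_(i < n) `|f (r i) - f (s i)| <= f t - f a]].
have Ea : E a.
  exists 0%N, (fun=> 0), (fun=> 0); split => //.
  by rewrite big_ord0 !subrr mulr0 subr0.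
have link s r : E s -> a <= s -> s <= r -> - eta * (r - s) <= f r - f s -> E r.
  move=> [n [s' [r' [h1 h2 h3]]]] as_ sr h; exists n, s', r'; split => //.
    by move=> i /h1[? ? ? ?]; split => //; exact: le_trans sr.
  by move: h3 h; set Q := \sum_(_ < _) _; lra.
have linkU s r : E s -> a <= s -> s <= r -> `]s, r[ `<=` U -> E r.
  move=> [n [s' [r' [h1 h2 h3]]]] as_ sr h.
  exists n.+1, (fun i => if i == n then s else s' i), (fun i =>
    if i == n then r else r' i).
  split.
  - move=> i; rewrite ltnS leq_eqVlt; case: eqP => [_ _|_ /= /h1[? ? ? ?]].
      by split => //; exact: lexx.
    by split => //; exact: le_trans sr.
  - move=> i j ij; rewrite ltnS => jn.
    rewrite (ltn_eqF (leq_trans ij jn)).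
    case: eqP => [jn'|/eqP jn']; first by have [] := h1 i (leq_trans ij jn).
    by apply: h2 => //; rewrite ltn_neqAle jn' jn.
  - rewrite big_ord_recr/= eqxx.
    under eq_bigr => i _ do rewrite (ltn_eqF (ltn_ord i)).
    move: h3; set Q := \sum_(_ < _) _ => h3.
    have := ler_norm (- (f r - f s)); rewrite normrN.
    have : 0 <= eta * (r - s) by rewrite mulr_ge0 ?subr_ge0// ltW.
    lra.
have [n [s [r [h1 h2 h3]]]] : E b.
  apply: (@real_induction _ a b) => // t /andP[at_ tb].
  have [Ut|nUt] := pselect (U t).
    have /nbhs_ballP[d /= d0 dU] := open_nbhs_nbhs (conj Uo Ut).
    exists d => // s r Es as_ st tr rb sd rd.
    apply: (linkU s) => //; first exact: le_trans tr.
    move=> z /=; rewrite in_itv/= => /andP[sz zr]; apply: dU.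
    by rewrite /ball/= ltr_norml; apply/andP; split; lra.
  have tab : t \in `]a, b[.
    rewrite in_itv/= !lt_neqAle at_ tb !andbT; apply/andP; split; apply/eqP => tE;
      apply: nUt; apply: N'U; right; [left|right]; by rewrite /= tE.
  have [l l0 dl'] : exists2 l : R, 0 <= l & is_derive t 1 f l.
    apply: contrapT => h; apply: nUt; apply: N'U; left; apply: badN => /=.
    by move=> /(_ tab).
  have : (fun h => h^-1 *: ((f \o shift t) (h *: 1) - f t)) @ 0^' --> l.
    by have [] := dl' => dt <-; exact: dt.
  move=> /cvgrPdist_lt/(_ eta eta0)/nbhs_ballP[d /= d0 dH].
  have key h : h != 0 -> `|h| < d -> - eta <= h^-1 * (f (t + h) - f t).
    move=> h0 hd; have := dH h; rewrite /ball/= sub0r normrN => /(_ hd h0).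
    rewrite /= [h *: 1]mulr1 (addrC h) => /ltW; rewrite ler_norml => /andP[_];
      rewrite -[_ *: _]/(_ * _).
    by set q := h^-1 * _; lra.
  exists d => // s r' Es as_ st tr rb sd rd.
  have Et : E t.
    apply: (link s) => //.
    have [->|ts] := eqVneq s t; first by rewrite !subrr mulr0.
    have := key (s - t); rewrite subr_eq0 ts => /(_ isT).
    have st' : s < t by rewrite lt_neqAle ts.
    rewrite ltr0_norm ?subr_lt0// opprB => /(_ sd).
    rewrite (addrC t) subrK mulrC ler_ndivlMr ?subr_lt0//.
    by lra.
  apply: (link t) => //.
  have [->|ts] := eqVneq r' t; first by rewrite !subrr mulr0.
  have := key (r' - t); rewrite subr_eq0 ts => /(_ isT).
  have tr' : t < r' by rewrite lt_neqAle eq_sym ts.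
  rewrite gtr0_norm ?subr_gt0// => /(_ rd).
  by rewrite (addrC t) subrK mulrC ler_pdivlMr ?subr_gt0.
have triv : trivIset setT (fun i : 'I_n => `]s i, r i[%classic).
  apply/trivIsetP => i j _ _; wlog ij : i j / (i < j)%N.
    move=> H ij; case: (ltngtP i j) => [/H|/H|/val_inj ijE].
    - exact.
    - by rewrite setIC; apply; rewrite eq_sym.
    - by rewrite ijE eqxx in ij.
  move=> _; rewrite -subset0 => z [] /=; rewrite !in_itv/= => /andP[_ zr] /andP[sz _].
  by have := h2 i j ij (ltn_ord j); lra.
have lens : \sum_(i < n) (r i - s i) < dl.
  rewrite -lte_fin (le_lt_trans _ Udl)// -sumEFin.
  rewrite (eq_bigr (fun i : 'I_n => lebesgue_measure `]s i, r i[%classic)); last first.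
    move=> i _; rewrite lebesgue_measure_itv/= lte_fin.
    by have [_ + _ _] := h1 i (ltn_ord i); rewrite le_eqVlt => /orP[/eqP ->|->];
      rewrite ?ltxx ?subrr.
  rewrite -measure_semi_additive_ord//; last exact: bigsetU_measurable.
  apply: le_measure; rewrite ?inE//; first exact: bigsetU_measurable.
  by rewrite -bigcup_seq => z [i _]; have [_ _ _] := h1 i (ltn_ord i); apply.
have := Hdl n (fun i => s i) (fun i => r i).
have h1' i : [/\ a <= s (i : 'I_n), s i <= r i & r i <= b] by have [] := h1 i (ltn_ord i).
move=> /(_ h1' triv lens) => h4.
have h5 : eta * (b - a) <= e / 2.
  rewrite /eta -mulrA ler_piMr//; first by rewrite divr_ge0// ltW.
  by rewrite mulrC ler_pdivrMr// mul1r lerDl.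
move: h3 h4; set Q := \sum_(_ < _) _; lra.
Qed.

(** * Gronwall estimates *)

Section dotv_enorm.
Context {R : realType}.

Lemma enormN n (v : 'cV[R]_n) : enorm (- v) = enorm v.
Proof. by rewrite -scaleN1r enormZ normrN1 mul1r. Qed.

Lemma dotvBr n (u v w : 'cV[R]_n) : dotv w (u - v) = dotv w u - dotv w v.
Proof. by rewrite dotvDr -scaleN1r dotvZr mulN1r. Qed.

Lemma dotvBl n (u v w : 'cV[R]_n) : dotv (u - v) w = dotv u w - dotv v w.
Proof. by rewrite dotvC dotvBr !(dotvC w). Qed.

Lemma enorm_sqrD n (a b : 'cV[R]_n) :
  enorm (a + b) ^+ 2 = enorm a ^+ 2 + 2 * dotv b a + enorm b ^+ 2.
Proof. by rewrite !enorm_sqr !(dotvDl, dotvDr) (dotvC a b); ring. Qed.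

Lemma enorm_sqr_segment n (a b : 'cV[R]_n) (s : R) :
  enorm (a + s *: b) ^+ 2 =
  (1 - s) * enorm a ^+ 2 + s * enorm (a + b) ^+ 2 - s * (1 - s) * enorm b ^+ 2.
Proof.
by rewrite !enorm_sqrD dotvZl enormZ exprMn real_normK ?num_real//; ring.
Qed.

Lemma enorm_dist n (v w : 'cV[R]_n) : `|enorm v - enorm w| <= enorm (v - w).
Proof.
have h x y : enorm x <= enorm (x - y) + enorm (y : 'cV[R]_n).
  by apply: le_trans (ler_enormD _ _); rewrite subrK.
have h1 := h v w.
have h2 : enorm w <= enorm (v - w) + enorm v by rewrite -(enormN (v - w)) opprB.
by rewrite ler_norml; apply/andP; split; lra.
Qed.

Lemma dotv_norm_le n (v w : 'cV[R]_n) : `|dotv v w| <= enorm v * enorm w.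
Proof.
rewrite ler_norml dotv_le andbT lerNl -mulN1r -dotvZl.
by apply: le_trans (dotv_le _ _) _; rewrite scaleN1r enormN.
Qed.

Lemma le_enorm_sqrt n (v : 'cV[R]_n) (e : R) : 0 <= e ->
  enorm v <= Num.sqrt (dotv v v + e).
Proof. by move=> e0; rewrite ler_wsqrtr// lerDl. Qed.

Lemma sqrt_le_enorm n (v : 'cV[R]_n) (e : R) : 0 <= e ->
  Num.sqrt (dotv v v + e ^+ 2) <= enorm v + e.
Proof.
move=> e0; have v0 := enorm_ge0 v.
rewrite -(@ler_pXn2r _ 2)// ?nnegrE ?sqrtr_ge0 ?addr_ge0// sqr_sqrtr; last first.
  by rewrite addr_ge0 ?dotvv_ge0 ?sqr_ge0.
by rewrite -enorm_sqr; nra.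
Qed.

Lemma sqrt_dist n (v w : 'cV[R]_n) (e : R) : 0 <= e ->
  `|Num.sqrt (dotv v v + e) - Num.sqrt (dotv w w + e)| <= enorm (v - w).
Proof.
move=> e0; wlog H : v w / Num.sqrt (dotv w w + e) <= Num.sqrt (dotv v v + e).
  move=> H; have [h|/ltW h] := leP (Num.sqrt (dotv w w + e)) (Num.sqrt (dotv v v + e)).
    exact: H.
  by rewrite distrC -enormN opprB; exact: H.
rewrite ger0_norm ?subr_ge0// lerBlDr.
have vw : enorm v <= enorm (v - w) + enorm w.
  by apply: le_trans (ler_enormD _ _); rewrite subrK.
have hw := le_enorm_sqrt w e0.
have [v0 w0 d0] : [/\ 0 <= enorm v, 0 <= enorm w & 0 <= enorm (v - w)].
  by split; exact: enorm_ge0.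
rewrite -(@ler_pXn2r _ 2)// ?nnegrE ?sqrtr_ge0 ?addr_ge0 ?sqrtr_ge0//.
rewrite sqrrD !sqr_sqrtr ?addr_ge0 ?dotvv_ge0//.
set q := Num.sqrt _ in hw *.
rewrite -!enorm_sqr.
have h1 : enorm (v - w) * enorm w <= enorm (v - w) * q by exact: ler_wpM2l.
have h2 : enorm v ^+ 2 <= (enorm (v - w) + enorm w) ^+ 2.
  by rewrite ler_pXn2r// nnegrE ?addr_ge0.
by move: h2; rewrite sqrrD !mulr2n; lra.
Qed.

Lemma is_derive_coord (V : normedModType R) m n (y : V -> 'M[R]_(m, n)) (t v : V) l i j :
  is_derive t v y l -> is_derive t v (fun s => y s i j) (l i j).
Proof.
move=> [dy <-]; split; first by move/derivable_mxP : dy; exact.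
by rewrite derive_mx// mxE.
Qed.

Lemma is_derive_dotv n (y z : R -> 'cV[R]_n) (t : R) l k :
  is_derive t 1 y l -> is_derive t 1 z k ->
  is_derive t 1 (fun s => dotv (y s) (z s)) (dotv (y t) k + dotv l (z t)).
Proof.
move=> dy dz; rewrite /dotv -big_split/=.
have -> : (fun s => \sum_i y s i 0 * z s i 0) = \sum_i ((fun s => y s i 0) * (fun s =>
  z s i 0)).
  by apply/funext => s; rewrite fct_sumE.
apply: is_derive_sum => i.
apply: is_derive_eq; first by apply: is_deriveM; apply: is_derive_coord.
by rewrite /GRing.scale/= [l i 0 * _]mulrC.
Qed.

End dotv_enorm.

Lemma small_increments_sub (R : realType) (a b a' b' : R) D :
  a <= a' -> b' <= b -> small_increments a b D -> small_increments a' b' D.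
Proof.
move=> aa bb H e /H[dl dl0 Hd]; exists dl => // N s r sr; apply: Hd => i.
by have [? ? ?] := sr i; split => //; [exact: le_trans aa _|exact: le_trans bb].
Qed.

(** Real induction: over a step shorter than the modulus for tolerance 1, the bound grows by at most
    1. *)
Lemma abs_continuous_bounded (R : realType) n (a b : R) (y : R -> 'cV[R]_n) : a <= b ->
  abs_continuous a b y -> exists2 K, 0 < K & forall t, a <= t <= b -> enorm (y t) <= K.
Proof.
move=> ab Hy; have [dl dl0 H] := @small_increments_continuous _ a b (fun s r =>
  enorm (y r - y s)) _ Hy ltr01.
suff : [set t | a <= t -> exists2 K, 0 < K & forall s, a <= s <= t -> enorm (y s) <= K] b.
  by apply.
apply: (@real_induction _ a b) => //=.
  move=> _; exists (enorm (y a) + 1); first by rewrite ltr_wpDl// enorm_ge0.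
  by move=> s; rewrite -eq_le => /eqP <-; rewrite lerDl.
move=> t /andP[at_ tb]; exists (dl / 2); first by rewrite divr_gt0.
move=> s r Es as_ st tr rb h1 h2 ar; have [K K0 HK] := Es as_.
exists (K + 1); first by rewrite ltr_wpDr.
move=> z /andP[az zr]; have [zs|sz] := leP z s;
  first by rewrite (le_trans (HK _ _)) ?az// lerDl.
have hs := HK s; rewrite as_ lexx in hs; have {}hs := hs isT.
have := H s z as_ (ltW sz) (le_trans zr rb).
have -> : z - s < dl by lra.
move=> /(_ isT)/ltW h; have := enorm_dist (y z) (y s).
by move=> /(le_trans (ler_norm _)); lra.
Qed.

Lemma expR_decay_dist (R : realType) (A s r : R) : 0 <= A -> 0 <= s -> s <= r ->
  `|expR (- A * r) - expR (- A * s)| <= A * (r - s).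
Proof.
move=> A0 s0 sr; rewrite distrC ger0_norm; last first.
  by rewrite subr_ge0 ler_expR !mulNr lerN2 ler_wpM2l.
have h := expR_ge1Dx (- A * (r - s)).
have e1 : expR (- A * s) <= 1 by rewrite -expR0 ler_expR mulNr oppr_le0 mulr_ge0.
have -> : expR (- A * r) = expR (- A * s) * expR (- A * (r - s)).
  by rewrite -expRD -mulrDr addrC subrK.
have e0 := expR_ge0 (- A * s).
rewrite -[X in X - _]mulr1 -mulrBr.
apply: (@le_trans _ _ (expR (- A * s) * (A * (r - s)))).
  by apply: ler_wpM2l => //; lra.
by rewrite ler_piMl// mulr_ge0// subr_ge0.
Qed.

Lemma ae_subitv (R : realType) (a b a' b' : R) (Q : R -> Prop) :
  a <= a' -> b' <= b ->
  {ae lebesgue_measure, forall t : R, t \in `]a, b[ -> Q t} ->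
  {ae lebesgue_measure, forall t : R, t \in `]a', b'[ -> Q t}.
Proof.
move=> aa bb; apply: filterS; first exact: (ae_filter_ringOfSetsType lebesgue_measure).
move=> t H; rewrite in_itv/= => /andP[h1 h2].
by apply: H; rewrite in_itv/= (le_lt_trans aa h1) (lt_le_trans h2 bb).
Qed.

(* sqrt (|y|^2 + e) is differentiable where |y| need not be, and still
   1-Lipschitz in y. The sign sg gives the forward and the backward estimate. *)
Lemma gronwall_monotone (R : realType) n (a b A B sg t0 e : R) (y : R -> 'cV[R]_n) :
  a <= b -> 0 <= A -> 0 <= B -> 0 < e -> sg = 1 \/ sg = -1 ->
  (forall t, a <= t <= b -> 0 <= sg * (t - t0)) ->
  abs_continuous a b y ->
  {ae lebesgue_measure, forall t : R, t \in `]a, b[ ->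
     exists2 l, is_derive t 1 y l & enorm l <= A * enorm (y t) + B} ->
  forall f : R -> R,
  f = (fun t => - sg * (expR (- A * (sg * (t - t0))) * Num.sqrt (dotv (y t) (y t) + e))
    + B * t) ->
  f a <= f b.
Proof.
move=> ab A0 B0 e0 sgE sgt yac dy f fE.
have sg1 : `|sg| = 1 by case: sgE => ->; rewrite ?normrN normr1.
have sgsg : sg * sg = 1 by case: sgE => ->; ring.
have Npos t : 0 < dotv (y t) (y t) + e by rewrite ltr_wpDl ?dotvv_ge0.
apply: ac_nondecreasing => //.
  have [K K0 HK] := abs_continuous_bounded ab yac.
  (* The exponential factor is at most 1 and [A]-Lipschitz in time; the root is 1-Lipschitz in [y]
     and at most [K + Num.sqrt e]. *)
  pose L := A * (K + Num.sqrt e) + 1 + B.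
  have L0 : 0 < L.
    have : 0 <= A * (K + Num.sqrt e) by rewrite mulr_ge0// addr_ge0 ?sqrtr_ge0// ltW.
    by rewrite /L; lra.
  apply: (@small_increments_le _ _ _ L _ (fun s r => enorm (y r - y s))) =>
    // s r as_ sr rb.
  set Ns := Num.sqrt (dotv (y s) (y s) + e); set Nr := Num.sqrt (dotv (y r) (y r) + e).
  set Es := expR (- A * (sg * (s - t0))); set Er := expR (- A * (sg * (r - t0))).
  have -> : f r - f s = - sg * (Er * (Nr - Ns) + (Er - Es) * Ns) + B * (r - s).
    by rewrite fE -/Ns -/Nr -/Es -/Er; ring.
  have Er1 : `|Er| <= 1.
    rewrite ger0_norm ?expR_ge0// -expR0 ler_expR mulNr oppr_le0 mulr_ge0// sgt//.
    by rewrite rb (le_trans as_ sr).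
  have hN : `|Nr - Ns| <= enorm (y r - y s) by rewrite sqrt_dist// ltW.
  have hE : `|Er - Es| <= A * (r - s).
    case: sgE => sgE; rewrite /Er /Es sgE.
      have -> : r - s = 1 * (r - t0) - 1 * (s - t0) by ring.
      apply: expR_decay_dist => //; last by lra.
      by rewrite -sgE sgt// as_ (le_trans sr rb).
    rewrite distrC.
    have -> : r - s = -1 * (s - t0) - -1 * (r - t0) by ring.
    apply: expR_decay_dist => //; last by lra.
    by rewrite -sgE sgt// rb (le_trans as_ sr).
  have hNs : `|Ns| <= K + Num.sqrt e.
    rewrite ger0_norm ?sqrtr_ge0//.
    have := sqrt_le_enorm (y s) (sqrtr_ge0 e); rewrite sqr_sqrtr ?(ltW e0)// => h.
    by apply: le_trans h _; rewrite lerD2r HK// as_ (le_trans sr rb).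
  apply: le_trans (ler_normD _ _) _.
  rewrite !normrM normrN sg1 mul1r (ger0_norm B0) [`|r - s|]ger0_norm ?subr_ge0//.
  apply: le_trans (lerD (ler_normD _ _) (lexx _)) _; rewrite !normrM.
  have h1 : `|Er| * `|Nr - Ns| <= 1 * enorm (y r - y s) by exact: ler_pM.
  have h2 : `|Er - Es| * `|Ns| <= A * (r - s) * (K + Num.sqrt e) by exact: ler_pM.
  have h3 : 0 <= (A * (K + Num.sqrt e) + B) * enorm (y r - y s).
    by rewrite mulr_ge0 ?enorm_ge0 ?addr_ge0 ?mulr_ge0 ?addr_ge0 ?sqrtr_ge0// ltW.
  by rewrite /L; nra.
move: dy; apply: filterS; first exact: (ae_filter_ringOfSetsType lebesgue_measure).
move=> t H tab; have [l dl hl] := H tab.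
have dN : is_derive t 1 (fun s => Num.sqrt (dotv (y s) (y s) + e))
    (dotv (y t) l / Num.sqrt (dotv (y t) (y t) + e)).
  have d1 := is_derive_dotv dl dl.
  apply: is_derive_eq.
    apply: (@is_derive1_comp _ Num.sqrt (fun s => dotv (y s) (y s) + e)).
    exact: is_derive1_sqrt.
  rewrite addr0 [dotv l _]dotvC invfM -mulr2n -mulr_natr.
  by field; rewrite gt_eqF ?sqrtr_gt0.
have dE : is_derive t 1 (fun s => expR (- A * (sg * (s - t0))))
    (expR (- A * (sg * (t - t0))) * (- A * sg)).
  have dg : is_derive t 1 (fun s : R => - A * (sg * (s - t0))) (- A * sg).
    have -> : (fun s : R => - A * (sg * (s - t0))) = (- A * sg) *: (fun s : R => s - t0).
      by apply/funext => s; rewrite /GRing.scale/= mulrA.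
    by apply: is_derive_eq; rewrite /GRing.scale/= subr0 mulr1.
  exact: (is_derive1_comp (is_derive_expR _) dg).
have dB : is_derive t 1 (fun s : R => B * s) B.
  by apply: is_derive_eq; rewrite /GRing.scale/= mulr1.
rewrite fE; eexists; last first.
  exact: (is_deriveD (is_deriveZ _ (is_deriveM dE dN)) dB).
rewrite /GRing.scale/=; set E := expR _; set N := Num.sqrt _.
have N0 : 0 < N by rewrite sqrtr_gt0.
have E0 : 0 <= E by exact: expR_ge0.
have E1 : E <= 1.
  rewrite /E -expR0 ler_expR mulNr oppr_le0 mulr_ge0// sgt//.
  by move: tab; rewrite in_itv/= => /andP[/ltW -> /ltW ->].
have yN : enorm (y t) <= N by rewrite le_enorm_sqrt// ltW.
have h1 : `|dotv (y t) l / N| <= A * N + B.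
  rewrite normrM normfV (gtr0_norm N0) ler_pdivrMr//.
  apply: le_trans (dotv_norm_le _ _) _; rewrite mulrC; apply: ler_pM;
    rewrite ?enorm_ge0//.
  by apply: le_trans hl _; rewrite lerD2r ler_wpM2l.
have h2 : `|sg * (dotv (y t) l / N)| <= A * N + B by rewrite normrM sg1 mul1r.
set q := dotv (y t) l / N in h1 h2 *.
(* The exponential factor contributes [A * N], which outweighs [sg * q] up to [B]; since [E <= 1],
   the derivative of [B * t] pays for that remainder. *)
have -> : - sg * (E * q + N * (E * (- A * sg))) + B =
  E * (A * N * (sg * sg) - sg * q) + B.
  ring.
rewrite sgsg mulr1.
have h3 : - (A * N + B) <= - (sg * q) by rewrite lerN2; apply: le_trans (ler_norm _) _.
have h4 : - (E * B) <= E * (A * N - sg * q) by rewrite -mulrN; apply: ler_wpM2l => //;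
  lra.
have h5 : E * B <= B by rewrite ler_piMl.
lra.
Qed.

(** [gronwall_monotone] is used with [sg = 1] centred at [s] and with [sg = -1] centred at [t], and
    the regularisation then tends to 0. The backward estimate serves the adjoint equation, whose
    condition is imposed at the final time. *)
Lemma gronwall (R : realType) n (a b A B : R) (y : R -> 'cV[R]_n) :
  0 <= A -> 0 <= B -> abs_continuous a b y ->
  {ae lebesgue_measure, forall t : R, t \in `]a, b[ ->
     exists2 l, is_derive t 1 y l & enorm l <= A * enorm (y t) + B} ->
  forall s t, a <= s -> s <= t -> t <= b ->
  enorm (y t) <= expR (A * (t - s)) * (enorm (y s) + B * (t - s)) /\
  enorm (y s) <= expR (A * (t - s)) * (enorm (y t) + B * (t - s)).
Proof.
move=> A0 B0 yac dy s t as_ st tb.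
have yac' : abs_continuous s t y by exact: (@small_increments_sub _ _ _ _ _ (fun s r =>
  enorm (y r - y s)) as_ tb yac).
have dy' := ae_subitv as_ tb dy.
have E0 : 0 < expR (A * (t - s)) by exact: expR_gt0.
have EV : expR (- A * (t - s)) = (expR (A * (t - s)))^-1 by rewrite mulNr expRN.
have key x z : (forall e, 0 < e -> expR (- A * (t - s)) * Num.sqrt (dotv x x + e ^+ 2)
     <= Num.sqrt (dotv (z : 'cV[R]_n) z + e ^+ 2) + B * (t - s)) ->
   enorm (x : 'cV[R]_n) <= expR (A * (t - s)) * (enorm z + B * (t - s)).
  move=> H; rewrite -ler_pdivrMl// -EV; apply/ler_addgt0Pr => e e0.
  have h1 := sqrt_le_enorm z (ltW e0).
  have h2 := le_enorm_sqrt x (sqr_ge0 e).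
  have h3 := H e e0.
  have h4 := ler_wpM2l (expR_ge0 (- A * (t - s))) h2.
  lra.
split; apply: key => e e0; have e20 : 0 < e ^+ 2 by rewrite exprn_gt0.
  have := @gronwall_monotone _ _ s t A B 1 s (e ^+ 2) y st A0 B0 e20 (or_introl erefl)
    _ yac' dy' _ erefl.
  rewrite !mul1r subrr mulr0 expR0 mul1r => H.
  have : forall z, s <= z <= t -> 0 <= 1 * (z - s) by move=> z /andP[sz _];
    rewrite mul1r subr_ge0.
  by move/H; lra.
have := @gronwall_monotone _ _ s t A B (-1) t (e ^+ 2) y st A0 B0 e20 (or_intror erefl)
  _ yac' dy' _ erefl.
rewrite subrr mulr0 mulr0 expR0 opprK !mul1r mulN1r opprB => H.
have : forall z, s <= z <= t -> 0 <= -1 * (z - t) by move=> z /andP[_ sz];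
  rewrite mulN1r opprB subr_ge0.
by move/H; lra.
Qed.

(** * Operator norms and the Gram matrix *)

Section opnorms.
Context {R : realType}.

(** The supremum of an unbounded set carries no information, hence the a priori bound [K]; it also
    settles [enorm v = 0], where [v] cannot be normalised. *)
Lemma le_opnorm m (W : Type) (NW : W -> R) (L : 'cV[R]_m -> W) (K : R) :
  (forall a v, NW (L (a *: v)) = `|a| * NW (L v)) ->
  (forall v, NW (L v) <= K * enorm v) ->
  forall v, NW (L v) <= opnorm (@enorm R m) NW L * enorm v.
Proof.
move=> Lh LK v; have [v0|v0] := eqVneq (enorm v) 0.
  have := LK v; rewrite v0 !mulr0 //.
have vp : 0 < enorm v by rewrite lt_neqAle eq_sym v0 enorm_ge0.
have -> : NW (L v) = NW (L ((enorm v)^-1 *: v)) * enorm v.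
  by rewrite Lh gtr0_norm ?invr_gt0// mulrAC mulVf// mul1r.
apply: ler_wpM2r; first exact: ltW.
apply: ub_le_sup; last first.
  by exists ((enorm v)^-1 *: v) => //=; rewrite enormZ gtr0_norm ?invr_gt0// mulVf.
by exists K => _ [w /= w1 <-]; have := LK w; rewrite w1 mulr1.
Qed.

(** In dimension zero the unit sphere is empty and the supremum is 0, hence the condition
    [0 <= K]. *)
Lemma opnorm_le m (W : Type) (NW : W -> R) (L : 'cV[R]_m -> W) (K : R) : 0 <= K ->
  (forall v, NW (L v) <= K * enorm v) -> opnorm (@enorm R m) NW L <= K.
Proof.
move=> K0 LK; rewrite /opnorm; set S := (X in sup X).
have [->|/set0P ne] := eqVneq S set0; first by rewrite sup0.
by apply: ge_sup => // _ [w /= w1 <-]; have := LK w; rewrite w1 mulr1.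
Qed.

Lemma opnorm_ge0 m (W : Type) (NW : W -> R) (L : 'cV[R]_m -> W) (K : R) :
  (forall w, 0 <= NW w) ->
  (forall v, NW (L v) <= K * enorm v) -> 0 <= opnorm (@enorm R m) NW L.
Proof.
move=> NW0 LK; rewrite /opnorm; set S := (X in sup X).
have [->|/set0P [_ [w w1 _]]] := eqVneq S set0; first by rewrite sup0.
apply: le_trans (NW0 (L w)) _; apply: ub_le_sup; last by exists w.
by exists K => _ [z /= z1 <-]; have := LK z; rewrite z1 mulr1.
Qed.

(** The witness is the Frobenius norm, by Cauchy-Schwarz on each row. *)
Lemma mulmx_enorm_bounded p q (M : 'M[R]_(p, q)) :
  exists2 K, 0 <= K & forall v : 'cV[R]_q, enorm (M *m v) <= K * enorm v.
Proof.
pose k i := enorm (row i M)^T.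
exists (Num.sqrt (\sum_i k i ^+ 2)) => [|v]; first exact: sqrtr_ge0.
have k0 i : 0 <= k i by exact: enorm_ge0.
rewrite -(@ler_pXn2r _ 2)// ?nnegrE ?mulr_ge0 ?sqrtr_ge0 ?enorm_ge0//.
rewrite exprMn [X in _ <= X * _]sqr_sqrtr; last by apply: sumr_ge0 => i _;
  rewrite sqr_ge0.
rewrite (enorm_sqr (M *m v)) {1}/dotv mulr_suml; apply: ler_sum => i _.
have -> : (M *m v) i 0 = dotv (row i M)^T v.
  by rewrite mxE /dotv; apply: eq_bigr => j _; rewrite !mxE.
rewrite -expr2 -exprMn -[leLHS]real_normK ?num_real//.
by rewrite ler_pXn2r// ?nnegrE ?mulr_ge0 ?enorm_ge0// dotv_norm_le.
Qed.

Lemma le_spec_norm p q (M : 'M[R]_(p, q)) (v : 'cV[R]_q) :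
  enorm (M *m v) <= spec_norm M * enorm v.
Proof.
have [K _ HK] := mulmx_enorm_bounded M; apply: le_opnorm HK v => a v.
by rewrite -scalemxAr enormZ.
Qed.

Lemma spec_norm_ge0 p q (M : 'M[R]_(p, q)) : 0 <= spec_norm M.
Proof.
have [K _ HK] := mulmx_enorm_bounded M; apply: opnorm_ge0 HK => w.
exact: enorm_ge0.
Qed.

Lemma spec_norm_le p q (M : 'M[R]_(p, q)) (K : R) : 0 <= K ->
  (forall v, enorm (M *m v) <= K * enorm v) -> spec_norm M <= K.
Proof. exact: opnorm_le. Qed.

Lemma spec_normD p q (M N : 'M[R]_(p, q)) : spec_norm (M + N) <=
  spec_norm M + spec_norm N.
Proof.
apply: spec_norm_le => [|v]; first by rewrite addr_ge0 ?spec_norm_ge0.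
by rewrite mulmxDl mulrDl; apply: le_trans (ler_enormD _ _) _; rewrite lerD ?le_spec_norm.
Qed.

Lemma spec_normZ p q a (M : 'M[R]_(p, q)) : spec_norm (a *: M) = `|a| * spec_norm M.
Proof.
have le b (N : 'M[R]_(p, q)) : spec_norm (b *: N) <= `|b| * spec_norm N.
  apply: spec_norm_le => [|v]; first by rewrite mulr_ge0 ?spec_norm_ge0.
  by rewrite -scalemxAl enormZ -mulrA ler_wpM2l ?le_spec_norm.
apply/eqP; rewrite eq_le le/=.
have [->|a0] := eqVneq a 0; first by rewrite normr0 mul0r spec_norm_ge0.
rewrite -{1}(scalerK a0 M) -ler_pdivlMl ?normr_gt0// -normfV.
exact: le.
Qed.

Lemma dotv_mulmx p q (M : 'M[R]_(p, q)) (v : 'cV[R]_p) (w : 'cV[R]_q) :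
  dotv v (M *m w) = dotv (M^T *m v) w.
Proof.
have E k (x y : 'cV[R]_k) : dotv x y = (x^T *m y) 0 0.
  by rewrite mxE; apply: eq_bigr => i _; rewrite mxE.
by rewrite !E trmx_mul trmxK mulmxA.
Qed.

(** The square of [|M^T v|] is [v . (M (M^T v))], at most [|v| |M| |M^T v|]; divide by [|M^T v|]. *)
Lemma spec_norm_tr p q (M : 'M[R]_(p, q)) : spec_norm M^T <= spec_norm M.
Proof.
apply: spec_norm_le => [|v]; first exact: spec_norm_ge0.
have [->|v0] := eqVneq (enorm (M^T *m v)) 0.
  by rewrite mulr_ge0 ?spec_norm_ge0 ?enorm_ge0.
have vp : 0 < enorm (M^T *m v) by rewrite lt_neqAle eq_sym v0 enorm_ge0.
rewrite -(ler_pM2r vp) -expr2 enorm_sqr -dotv_mulmx.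
apply: le_trans (dotv_le _ _) _.
by rewrite mulrC mulrAC ler_wpM2r ?enorm_ge0// le_spec_norm.
Qed.

Lemma coord_le_enorm n (v : 'cV[R]_n) i : `|v i 0| <= enorm v.
Proof.
rewrite -(@ler_pXn2r _ 2)// ?nnegrE ?enorm_ge0// real_normK ?num_real// enorm_sqr.
rewrite /dotv (bigD1 i)//= -expr2 lerDl.
by apply: sumr_ge0 => j _; rewrite -expr2 sqr_ge0.
Qed.

Lemma coord_le_spec_norm p q (M : 'M[R]_(p, q)) j k : `|M j k| <= spec_norm M.
Proof.
have := le_spec_norm M (delta_mx k 0).
have -> : enorm (delta_mx k 0 : 'cV[R]_q) = 1.
  rewrite /enorm /dotv (bigD1 k)//= big1 => [|i ik];
    rewrite !mxE ?eqxx ?mulr1 ?addr0 ?sqrtr1//.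
  by rewrite (negbTE ik) mul0r.
rewrite mulr1; apply: le_trans; rewrite -colE; have := coord_le_enorm (col k M) j.
by rewrite mxE.
Qed.

End opnorms.

Section rayleigh.
Context {R : realType}.

(* Expand the form of M at (spec_norm M + 1) v - M v. *)
Lemma psd_mulmx_le n (M : 'M[R]_n) (v : 'cV[R]_n) : M^T = M ->
  (forall w, 0 <= dotv w (M *m w)) ->
  enorm (M *m v) ^+ 2 <= (spec_norm M + 1) * dotv v (M *m v).
Proof.
move=> MT psd; set w := M *m v; pose s := spec_norm M + 1.
have s0 : 0 < s by rewrite ltr_wpDl ?spec_norm_ge0.
have h := psd (s *: v + (-1) *: w).
have h1 : dotv w (M *m w) <= s * enorm w ^+ 2.
  apply: le_trans (dotv_le _ _) _; rewrite mulrC expr2 mulrA ler_wpM2r ?enorm_ge0//.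
  by apply: le_trans (le_spec_norm _ _) _; rewrite ler_wpM2r ?enorm_ge0// lerDl.
have h2 : dotv v (M *m w) = enorm w ^+ 2 by rewrite (dotv_mulmx M v w) MT (enorm_sqr w).
move: h; rewrite mulmxDr -!scalemxAr -/w.
rewrite !(dotvDl, dotvDr, dotvZl, dotvZr) h2 -(enorm_sqr w) => h.
have : 0 <= s * (s * dotv v w - enorm w ^+ 2) by move: h h1; nra.
by rewrite pmulr_rge0// subr_ge0.
Qed.

(** The inverse gives [|v| <= k |M v|], and [psd_mulmx_le] bounds [|M v|^2] by [s] times the form;
    together they give the constant. The summands 1 in [s] and [k] only make them positive. *)
Lemma psd_unitmx_lower_bound n (M : 'M[R]_n) : M^T = M ->
  (forall w, 0 <= dotv w (M *m w)) -> M \in unitmx ->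
  exists2 c, 0 < c & forall v, c * enorm v ^+ 2 <= dotv v (M *m v).
Proof.
move=> MT psd Mu; pose s := spec_norm M + 1; pose k := spec_norm (invmx M) + 1.
have s0 : 0 < s by rewrite ltr_wpDl ?spec_norm_ge0.
have k0 : 0 < k by rewrite ltr_wpDl ?spec_norm_ge0.
exists (s^-1 * (k ^+ 2)^-1) => [|v]; first by rewrite mulr_gt0 ?invr_gt0 ?exprn_gt0.
rewrite -mulrA ler_pdivrMl// ler_pdivrMl ?exprn_gt0//.
apply: (@le_trans _ _ (k ^+ 2 * enorm (M *m v) ^+ 2)); last first.
  by apply: ler_wpM2l; [exact: sqr_ge0|exact: psd_mulmx_le].
rewrite -exprMn ler_pXn2r// ?nnegrE ?mulr_ge0 ?enorm_ge0 ?(ltW k0)//.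
rewrite -{1}(mulKmx Mu v); apply: le_trans (le_spec_norm _ _) _.
by rewrite ler_wpM2r ?enorm_ge0// lerDl.
Qed.

(* The largest a with a |v|^2 <= |C v|^2 is an eigenvalue of C^T C: otherwise
   C^T C - a I is invertible and positive, and a can be increased. *)
Lemma lambda_min_gram d' n (C : 'M[R]_(d', n)) : \rank C = n -> (0 < n)%N ->
  0 < lambda_min (C^T *m C) /\
  forall v, lambda_min (C^T *m C) * enorm v ^+ 2 <= enorm (C *m v) ^+ 2.
Proof.
move=> rC n0; set S := C^T *m C.
have ST : S^T = S by rewrite /S trmx_mul trmxK.
have SE v : dotv v (S *m v) = enorm (C *m v) ^+ 2.
  by rewrite enorm_sqr -mulmxA dotv_mulmx trmxK.
pose Mx (a : R) := S - a%:M.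
have MT a : (Mx a)^T = Mx a by rewrite /Mx linearB/= ST tr_scalar_mx.
have ME a v : dotv v (Mx a *m v) = enorm (C *m v) ^+ 2 - a * enorm v ^+ 2.
  rewrite mulmxBl -scaleN1r dotvDr dotvZr SE mulN1r mul_scalar_mx dotvZr.
  by rewrite -enorm_sqr.
pose E := [set a | forall v, a * enorm v ^+ 2 <= enorm (C *m v) ^+ 2].
(* Any nonzero vector bounds [E] from above by its Rayleigh quotient; it exists because [0 < n]. *)
pose e1 : 'cV[R]_n := const_mx 1.
have e10 : 0 < enorm e1 ^+ 2.
  rewrite enorm_sqr /dotv (eq_bigr (fun=> 1)); last by move=> i _; rewrite !mxE mulr1.
  by rewrite sumr_const card_ord ltr0n.
have E0 : E 0 by move=> v; rewrite mul0r sqr_ge0.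
have hE : has_sup E.
  split; first by exists 0.
  exists (enorm (C *m e1) ^+ 2 / enorm e1 ^+ 2) => a /(_ e1).
  by rewrite ler_pdivlMr.
pose l := sup E.
have El : E l.
  move=> v; have [v0|v0] := eqVneq (enorm v) 0;
    first by rewrite v0 expr0n/= mulr0 sqr_ge0.
  have vp : 0 < enorm v ^+ 2 by rewrite exprn_gt0// lt_neqAle eq_sym v0 enorm_ge0.
  rewrite -ler_pdivlMr//; apply: ge_sup => [|a /(_ v)]; first by exists 0.
  by rewrite ler_pdivlMr.
have notunit : Mx l \notin unitmx.
  apply/negP => /(psd_unitmx_lower_bound (MT l)) [|c c0 Hc].
    by move=> w; rewrite ME subr_ge0 El.
  have : E (l + c) by move=> v; have := Hc v; rewrite ME mulrDl; lra.
  by move=> /(ub_le_sup hE.2); rewrite leNgt ltrDl c0.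
have eigl : eigenvalue S l.
  by rewrite /eigenvalue /eigenspace kermx_eq0 row_free_unit.
have eigl_ge a : eigenvalue S a -> l <= a.
  move=> /eigenvalueP[v vS v0]; have := El v^T.
  rewrite -SE -ST -trmx_mul vS linearZ/= dotvZr -enorm_sqr ler_pM2r//.
  rewrite exprn_gt0// lt_neqAle enorm_ge0 andbT eq_sym; apply/eqP => /enorm_eq0 v0'.
  by move: v0; rewrite -(trmxK v) v0' trmx0 eqxx.
have lE : lambda_min S = l.
  apply/eqP; rewrite eq_le; apply/andP; split.
    by apply: ge_inf => //; exists l => a; exact: eigl_ge.
  by apply: lb_le_inf; [exists l|move=> a; exact: eigl_ge].
have Cinj (v : 'cV[R]_n) : C *m v = 0 -> v = 0.
  move=> Cv; have rf : row_free C^T by rewrite /row_free mxrank_tr rC.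
  apply: trmx_inj; rewrite trmx0; apply: (row_free_inj rf).
  by rewrite mul0mx -trmx_mul Cv trmx0.
have Su : S \in unitmx.
  rewrite -row_free_unit -kermx_eq0; apply/eqP/row_matrixP => i; rewrite row0.
  have : row i (kermx S) *m S = 0 by rewrite -row_mul mulmx_ker row0.
  move=> /(congr1 trmx); rewrite trmx_mul ST trmx0 => h.
  apply: trmx_inj; rewrite trmx0; apply: Cinj; apply: enorm_eq0.
  by apply/eqP; rewrite -sqrf_eq0 -SE h dotvC /dotv big1// => j _; rewrite mxE mul0r.
have [|c c0 Hc] := psd_unitmx_lower_bound ST _ Su; first by move=> w; rewrite SE sqr_ge0.
rewrite lE; split; last exact: El.
apply: (lt_le_trans c0); apply: (ub_le_sup hE.2) => v.
by rewrite -SE.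
Qed.

End rayleigh.

(** * Second-order expansion along segments *)

Section directional.
Context {R : realType}.

Lemma is_derive_line (V W : normedModType R) (f : V -> W) (w v : V) (s : R) l :
  is_derive (w + s *: v) v f l -> is_derive s 1 (fun s => f (w + s *: v)) l.
Proof.
have E : (fun h : R => h^-1 *: (((fun s => f (w + s *: v)) \o shift s) (h *: 1) - f (w
  + s *: v)))
   = (fun h => h^-1 *: ((f \o shift (w + s *: v)) (h *: v) - f (w + s *: v))).
  apply/funext => h /=; congr (_ *: (f _ - _)).
  by rewrite [h%:A]mulr1 scalerDl addrCA.
move=> [df dE]; split; first by rewrite /derivable E.
by rewrite -dE /derive E.
Qed.

(** Both orders of the endpoints occur: the coordinate increments [h * d k 0] in
    [is_derive_partials] have any sign. *)
Lemma mvt_segment_sym (f df : R -> R) (a b : R) :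
  (forall t, Num.min a b <= t <= Num.max a b -> is_derive t 1 f (df t)) ->
  exists2 c, Num.min a b <= c <= Num.max a b & f b - f a = df c * (b - a).
Proof.
move=> H; wlog ab : a b H / a <= b.
  move=> W; have /orP[ab|ab] := le_total a b; first exact: W.
  have [|c hc E] := W b a _ ab; first by rewrite minC maxC.
  by exists c; [rewrite minC maxC|rewrite -[LHS]opprB E -mulrN opprB].
rewrite (min_idPl ab) (max_idPr ab) in H *.
have cf : {within `[a, b], continuous f}.
  by apply: derivable_within_continuous => t; rewrite in_itv/= => /H[].
have H' t : t \in `]a, b[ -> is_derive t 1 f (df t).
  by rewrite in_itv/= => /andP[/ltW h1 /ltW h2]; apply: H; rewrite h1.
by have [c cab E] := MVT_segment ab H' cf; exists c; rewrite // -in_itv.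
Qed.

(** The displacement [h *: d] is made one coordinate at a time, with the mean value theorem on each
    edge; continuity of the partial derivatives at [u] then moves the intermediate points to [u]. *)
Lemma is_derive_partials m (f : 'cV[R]_m -> R) (df : 'I_m -> 'cV[R]_m -> R)
    (V : set 'cV[R]_m) (u d : 'cV[R]_m) : open V -> V u ->
  (forall v i, V v -> is_derive v (delta_mx i 0) f (df i v)) ->
  (forall i, {for u, continuous (df i)}) ->
  is_derive u d f (\sum_i d i 0 * df i u).
Proof.
move=> Vo Vu Hd Hc; set l := \sum_i _.
suff H : (fun h => h^-1 *: ((f \o shift u) (h *: d) - f u)) @ 0^' --> l.
  by split; [apply/cvg_ex; exists l|apply/cvg_lim].
apply/cvgrPdist_le => /= e e0.
pose e' := e / (\sum_i `|d i 0| + 1).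
have sd0 : 0 < \sum_i `|d i 0| + 1 by rewrite ltr_wpDl// sumr_ge0.
have e'0 : 0 < e' by rewrite divr_gt0.
have near1 : \forall v \near u, V v /\ forall i, `|df i u - df i v| <= e'.
  have near2 : \forall v \near u, forall i, `|df i u - df i v| <= e'.
    have near1 i : \forall v \near u, `|df i u - df i v| <= e'.
      by have /cvgrPdist_le/(_ _ e'0) := Hc i.
    exact: (@filter_forall _ _ (fun i v => `|df i u - df i v| <= e') (nbhs u) _ near1).
  by apply: filterI near2; exact: open_nbhs_nbhs.
have /nbhs_ballP[r /= r0 Hr] := near1.
have d1 : 0 < `|d| + 1 by rewrite ltr_wpDl.
near=> h.
have h0 : h != 0 by near: h; exact: nbhs_dnbhs_neq.
have hr : `|h| * (`|d| + 1) < r.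
  rewrite -ltr_pdivlMr//; near: h; apply: dnbhs0_lt; exact: divr_gt0.
(* The corners of the staircase from [u] to [u + h *: d]: in [w k] the first [k] coordinates have
   been displaced. *)
pose w k : 'cV[R]_m := \col_j (if (j < k)%N then u j 0 + h * d j 0 else u j 0).
have dcoord j : `|d j 0| <= `|d|.
  by rewrite [leRHS]/Num.Def.normr/= mx_normrE;
    apply: (le_bigmax _ (fun ij : _ * _ => `|d ij.1 ij.2|) (j, 0)).
have inball (v : 'cV[R]_m) : (forall j, `|u j 0 - v j 0| <= `|h| * `|d|) -> ball u r v.
  move=> H; rewrite -ball_normE/=; apply: le_lt_trans hr.
  rewrite [leLHS]/Num.Def.normr/= mx_normrE; apply: bigmax_le => [|[i j] _ /=].
    by rewrite mulr_ge0// ltW.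
  rewrite (ord1 j) !mxE; apply: le_trans (H i) _.
  by rewrite ler_wpM2l// lerDl.
have step (k : 'I_m) : `|f (w k.+1) - f (w k) - h * (d k 0 * df k u)| <=
  `|h| * `|d k 0| * e'.
  have wk : w k.+1 = w k + (h * d k 0) *: delta_mx k 0.
    apply/matrixP => i j; rewrite (ord1 j) !mxE eqxx andbT ltnS leq_eqVlt -val_eqE.
    have [->|ik] := eqVneq i k; first by rewrite eqxx ltnn/= mulr1.
    by rewrite (negbTE (ik : val i != val k)) mulr0 addr0.
  have wb (s : R) : Num.min 0 (h * d k 0) <= s <= Num.max 0 (h * d k 0) ->
      ball u r (w k + s *: delta_mx k 0).
    move=> hs; apply: inball => j; rewrite !mxE eqxx andbT.
    have hs' : `|s| <= `|h| * `|d k 0|.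
      rewrite -normrM; have h4 := ler_norm (h * d k 0).
      have h5 := ler_norm (- (h * d k 0)); rewrite normrN in h5.
      rewrite ler_norml; move: hs; case: (leP 0 (h * d k 0)) => h1 /andP[h2 h3];
        apply/andP; split; lra.
    have hd : `|h| * `|d k 0| <= `|h| * `|d| by rewrite ler_wpM2l.
    have hj : `|h| * `|d j 0| <= `|h| * `|d| by rewrite ler_wpM2l.
    have [jk|jk] := eqVneq j k.
      rewrite jk ltnn mulr1 opprD addNKr normrN.
      exact: le_trans hd.
    rewrite mulr0 addr0; case: ifP => _; last by rewrite subrr normr0 mulr_ge0.
    by rewrite opprD addNKr normrN normrM.
  have [t ht|c hc E] := @mvt_segment_sym (fun s => f (w k + s *: delta_mx k 0))
      (fun s => df k (w k + s *: delta_mx k 0)) 0 (h * d k 0).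
    by apply: is_derive_line; apply: Hd; have [] := Hr _ (wb t ht).
  have {}E : f (w k.+1) - f (w k) = df k (w k + c *: delta_mx k 0) * (h * d k 0).
    by rewrite wk -[f (w k)](congr1 f (addr0 (w k))) -(scale0r (delta_mx k 0)) E subr0.
  rewrite E mulrC mulrA -mulrBr normrM normrM ler_wpM2l//.
  by rewrite distrC; have [_] := Hr _ (wb c hc); exact.
have wm : w m = u + h *: d.
  by apply/matrixP => i j; rewrite (ord1 j) !mxE ltn_ord.
have w0 : w 0%N = u by apply/matrixP => i j; rewrite (ord1 j) !mxE.
have tele : f (u + h *: d) - f u - h * l = \sum_(k < m) (f (w k.+1) - f (w k) - h * (d
  k 0 * df k u)).
  rewrite sumrB -mulr_sumr -/l; congr (_ - _).
  rewrite -wm -[in LHS]w0 -(telescope_sumr (fun k => f (w k)) (leq0n m)).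
  by rewrite big_mkord.
have tot : `|f (u + h *: d) - f u - h * l| <= `|h| * e.
  rewrite tele; apply: le_trans (ler_norm_sum _ _ _) _.
  apply: (@le_trans _ _ (\sum_(k < m) `|h| * `|d k 0| * e')); first exact: ler_sum.
  rewrite -mulr_suml -mulr_sumr -mulrA ler_wpM2l// /e' mulrCA ler_piMr ?(ltW e0)//.
  by rewrite ler_pdivrMr// mul1r lerDl.
have -> : l - h^-1 *: ((f \o shift u) (h *: d) - f u) =
  - h^-1 * (f (u + h *: d) - f u - h * l).
  rewrite /= (addrC (h *: d)) /GRing.scale/=; set q := f _ - f u.
  by field.
by rewrite normrM normrN normfV ler_pdivrMl ?normr_gt0.
Unshelve. all: by end_near. Qed.
End directional.

Section second_order.
Context {R : realType}.

(** Subtracting [g] from [kappa / 2 * z ^+ 2] gives a function [G] with nonnegative second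
    derivative. Its chord inequality at [s] follows from mean values on both sides of [s] and a
    third one, for [G1], between the two intermediate points. *)
Lemma concave_lower_bound (g g1 g2 : R -> R) (kappa : R) :
  (forall s : R, 0 <= s <= 1 -> is_derive s 1 g (g1 s)) ->
  (forall s : R, 0 <= s <= 1 -> is_derive s 1 g1 (g2 s)) ->
  (forall s : R, 0 <= s <= 1 -> g2 s <= kappa) ->
  forall s : R, 0 <= s <= 1 ->
  (1 - s) * g 0 + s * g 1 - kappa / 2 * (s * (1 - s)) <= g s.
Proof.
move=> dg dg1 g2k s /andP[s0 s1].
pose G (z : R) := kappa / 2 * z ^+ 2 - g z; pose G1 (z : R) := kappa * z - g1 z.
have dG (z : R) : 0 <= z <= 1 -> is_derive z 1 G (G1 z).
  move=> /dg h; have dq : is_derive z 1 (fun z : R => kappa / 2 * z ^+ 2) (kappa * z).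
    have -> : (fun z : R => kappa / 2 * z ^+ 2) = (kappa / 2) *: (id ^+ 2 : R -> R).
      by apply/funext => w; rewrite [in RHS]/GRing.scale/=.
    by apply: is_derive_eq; rewrite /GRing.scale/= expr1 -mulr_natr; field.
  exact: is_deriveB.
have dG1 (z : R) : 0 <= z <= 1 -> is_derive z 1 G1 (kappa - g2 z).
  move=> /dg1 h; have dq : is_derive z 1 (fun z : R => kappa * z) kappa.
    by apply: is_derive_eq; rewrite /GRing.scale/= mulr1.
  exact: is_deriveB.
have [|c1] := @mvt_segment_sym _ G G1 0 s.
  rewrite (min_idPl s0) (max_idPr s0) => t /andP[? ?]; apply: dG; apply/andP; split; lra.
rewrite (min_idPl s0) (max_idPr s0) => /andP[c10 c1s] E1.
have [|c2] := @mvt_segment_sym _ G G1 s 1.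
  rewrite (min_idPl s1) (max_idPr s1) => t /andP[? ?]; apply: dG; apply/andP; split; lra.
rewrite (min_idPl s1) (max_idPr s1) => /andP[c2s c21] E2.
have c12 : c1 <= c2 by exact: le_trans c2s.
have [|c3] := @mvt_segment_sym _ G1 (fun z => kappa - g2 z) c1 c2.
  rewrite (min_idPl c12) (max_idPr c12) => t /andP[? ?]; apply: dG1; apply/andP; split;
    lra.
rewrite (min_idPl c12) (max_idPr c12) => /andP[h1 h2] E3.
have h3 : 0 <= G1 c2 - G1 c1.
  rewrite E3 mulr_ge0 ?subr_ge0// g2k//; apply/andP; split; lra.
have h4 : 0 <= s * (1 - s) * (G1 c2 - G1 c1) by rewrite !mulr_ge0// subr_ge0.
have h5 : s * (1 - s) * (G1 c2 - G1 c1) = s * (G 1 - G s) - (1 - s) * (G s - G 0).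
  by rewrite E1 E2; ring.
rewrite h5 in h4; rewrite -subr_ge0.
suff -> : g s - ((1 - s) * g 0 + s * g 1 - kappa / 2 * (s * (1 - s))) =
  s * (G 1 - G s) - (1 - s) * (G s - G 0) by [].
by rewrite /G; field.
Qed.

Lemma is_derive_linear (V W : normedModType R) (L : W -> R) (f : V -> W) (u v : V) l :
  linear_for *%R L -> continuous L ->
  is_derive u v f l -> is_derive u v (fun x => L (f x)) (L l).
Proof.
move=> Llin Lc [df <-].
have H : (fun h : R => h^-1 *: (((fun x => L (f x)) \o shift u) (h *: v) - L (f u)) :
  R) @ 0^' --> L ('D_v f u).
  have -> : (fun h : R => h^-1 *: (((fun x => L (f x)) \o shift u) (h *: v) - L (f u))
    : R) =
     L \o (fun h : R => h^-1 *: ((f \o shift u) (h *: v) - f u)).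
    apply/funext => h /=.
    have L0 : L 0 = 0.
      by have := Llin (-1) 0 0; rewrite scaler0 addr0 mulN1r addNr.
    have LZ a x : L (a *: x) = a * L x by rewrite -[a *: x]addr0 Llin L0 addr0.
    have LB a b : L (a - b) = L a - L b by rewrite addrC -scaleN1r Llin mulN1r addrC.
    by rewrite LZ LB.
  by apply: continuous_cvg; [exact: Lc|exact: df].
by split; [apply/cvg_ex; eexists; exact: H|apply/cvg_lim].
Qed.

Lemma continuous_bigsum (V : topologicalType) (I : finType) (F : I -> V -> R) :
  (forall i, continuous (F i)) -> continuous (fun v => \sum_i F i v).
Proof.
move=> cF; have -> : (fun v => \sum_i F i v) = \sum_i F i by apply/funext => v;
  rewrite fct_sumE.
elim/big_ind : _ => [|f g cf cg|//]; first exact: cst_continuous.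
by move=> v; apply: continuousD; [exact: cf|exact: cg].
Qed.

Lemma continuous_dotv_mulmx p n (q : 'cV[R]_p) (y : 'cV[R]_n) :
  continuous (fun M : 'M[R]_(p, n) => dotv q (M *m y)).
Proof.
rewrite /dotv; apply: continuous_bigsum => i M; apply: continuousM;
  first exact: cst_continuous.
have -> : (fun M : 'M[R]_(p, n) => (M *m y) i 0) = (fun M => \sum_j M i j * y j 0).
  by apply/funext => N; rewrite mxE.
move: M; apply: continuous_bigsum => j M; apply: continuousM; last exact: cst_continuous.
exact: coord_continuous.
Qed.

Lemma continuous_dotv n (q : 'cV[R]_n) : continuous (fun b : 'cV[R]_n => dotv q b).
Proof.
rewrite /dotv; apply: continuous_bigsum => i M; apply: continuousM;
  first exact: cst_continuous.
exact: coord_continuous.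
Qed.

Lemma is_derive_affine (V : normedModType R) p n (q : 'cV[R]_p) (y : 'cV[R]_n)
    (f : V -> 'M[R]_(p, n)) (b : V -> 'cV[R]_p) (u v : V) l k :
  is_derive u v f l -> is_derive u v b k ->
  is_derive u v (fun x => dotv q (f x *m y + b x)) (dotv q (l *m y + k)).
Proof.
move=> df db.
have -> : (fun x => dotv q (f x *m y + b x)) = (fun x =>
  dotv q (f x *m y)) \+ (fun x => dotv q (b x)).
  by apply/funext => x; rewrite /= dotvDr.
rewrite dotvDr; apply: is_deriveD.
  apply: (is_derive_linear (L := fun M : 'M[R]_(p, n) => dotv q (M *m y))) df.
    by move=> a M N; rewrite mulmxDl dotvDr -scalemxAl dotvZr.
  exact: continuous_dotv_mulmx.
apply: (is_derive_linear (L := fun b : 'cV[R]_p => dotv q b)) db.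
  by move=> a M N; rewrite dotvDr dotvZr.
exact: continuous_dotv.
Qed.

Lemma continuous_affine (V : topologicalType) p n (q : 'cV[R]_p) (y : 'cV[R]_n)
    (f : V -> 'M[R]_(p, n)) (b : V -> 'cV[R]_p) (u : V) :
  {for u, continuous f} -> {for u, continuous b} ->
  {for u, continuous (fun x => dotv q (f x *m y + b x))}.
Proof.
move=> cf cb.
have -> : (fun x => dotv q (f x *m y + b x)) = (fun x =>
  dotv q (f x *m y)) \+ (fun x => dotv q (b x)).
  by apply/funext => x; rewrite /= dotvDr.
apply: continuousD.
  apply: (@continuous_comp _ _ _ f (fun M => dotv q (M *m y)) u cf).
  exact: continuous_dotv_mulmx.
apply: (@continuous_comp _ _ _ b (fun x => dotv q x) u cb).
exact: continuous_dotv.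
Qed.

Lemma dotv_sumr n (I : finType) (q : 'cV[R]_n) (F : I -> 'cV[R]_n) :
  dotv q (\sum_i F i) = \sum_i dotv q (F i).
Proof.
apply: (big_morph (dotv q) (fun a b => dotvDr a b q)).
by rewrite /dotv big1// => i _; rewrite mxE mulr0.
Qed.

Section segment.
Variables (m p n : nat) (U : set 'cV[R]_m) (A : 'cV[R]_m ->
  'M[R]_(p, n)) (B : 'cV[R]_m -> 'cV[R]_p).
Variables (q : 'cV[R]_p) (y : 'cV[R]_n).
Hypotheses (Uconv : convex_set U) (A2 : C2_around U A) (B2 : C2_around U B).

Let phi v := dotv q (A v *m y + B v).

Lemma convex_segment (u0 u1 : 'cV[R]_m) (s : R) : U u0 -> U u1 -> 0 <= s <= 1 ->
  U (u0 + s *: (u1 - u0)).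
Proof.
move=> Uu0 Uu1 /andP[s0 s1].
have := @Uconv u1 u0 (Itv01 s0 s1); rewrite !inE => /(_ Uu1 Uu0) /=.
rewrite [X in U X](_ : _ = u0 + s *: (u1 - u0)) //.
rewrite /conv/=; apply/matrixP => i j; rewrite !mxE /unstable.onem; ring.
Qed.

(** [C2_around] provides partial derivatives near [U], so both derivatives along the segment come
    from [is_derive_partials], once [Du] and [D2u] are paired with [q] and written as combinations
    of partial derivatives. *)
Lemma C2_segment_derive (u0 u1 : 'cV[R]_m) (s : R) : U u0 -> U u1 -> 0 <= s <= 1 ->
  let v := u0 + s *: (u1 - u0) in let d := u1 - u0 in
  is_derive s 1 (fun s => phi (u0 + s *: d)) (dotv q (Du A v d *m y + Du B v d)) /\
  is_derive s 1 (fun s => dotv q (Du A (u0 + s *: d) d *m y + Du B (u0 + s *: d) d))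
     (dotv q (D2u A v d d *m y + D2u B v d d)).
Proof.
move=> Uu0 Uu1 s01 v d; have Uv : U v by exact: convex_segment.
have [VA [VAo UVA HA]] := A2; have [VB [VBo UVB HB]] := B2.
pose V := VA `&` VB.
have Vo : open V by exact: openI.
have Vv : V v by split; [exact: UVA|exact: UVB].
have d1 : is_derive v d phi (dotv q (Du A v d *m y + Du B v d)).
  have -> : dotv q (Du A v d *m y + Du B v d) =
      \sum_i d i 0 * dotv q (partial A i v *m y + partial B i v).
    rewrite /Du mulmx_suml -big_split/= dotv_sumr; apply: eq_bigr => i _.
    by rewrite -scalemxAl -scalerDr dotvZr.
  apply: (@is_derive_partials _ _ _ (fun i w => dotv q (partial A i w *m y + partial B
    i w)) V) => //.
    move=> w i [VAw VBw]; apply: is_derive_affine.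
      by have [_ /(_ i)[h _] _] := HA w VAw; exact: derivableP.
    by have [_ /(_ i)[h _] _] := HB w VBw; exact: derivableP.
  move=> i; have [_ /(_ i)[_ h1] _] := HA v Vv.1; have [_ /(_ i)[_ h2] _] := HB v Vv.2.
  exact: continuous_affine.
split; first exact: is_derive_line.
apply: (@is_derive_line _ _ _ (fun w => dotv q (Du A w d *m y + Du B w d))).
have -> : dotv q (D2u A v d d *m y + D2u B v d d) =
    \sum_i d i 0 * (\sum_j d j 0 * dotv q (partial (partial A j) i v *m y + partial
      (partial B j) i v)).
  rewrite /D2u mulmx_suml -big_split/= dotv_sumr; apply: eq_bigr => i _.
  rewrite mulmx_suml -big_split/= dotv_sumr mulr_sumr; apply: eq_bigr => j _.
  by rewrite -scalemxAl -scalerDr dotvZr mulrA.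
apply: (@is_derive_partials _ _ _ (fun i w => \sum_j d j 0 *
    dotv q (partial (partial A j) i w *m y + partial (partial B j) i w)) V) => //.
  move=> w i [VAw VBw].
  have -> : (fun w => dotv q (Du A w d *m y + Du B w d)) =
      \sum_j d j 0 *: (fun w => dotv q (partial A j w *m y + partial B j w)).
    apply/funext => z; rewrite fct_sumE /Du mulmx_suml -big_split/= dotv_sumr.
    by apply: eq_bigr => j _; rewrite -scalemxAl -scalerDr dotvZr.
  apply: is_derive_sum => j; apply: is_deriveZ; apply: is_derive_affine.
    by have [_ _ /(_ i j)[h _]] := HA w VAw; exact: derivableP.
  by have [_ _ /(_ i j)[h _]] := HB w VBw; exact: derivableP.
move=> i.
have cj (j : 'I_m) : {for v, continuous (fun w => d j 0 *
    dotv q (partial (partial A j) i w *m y + partial (partial B j) i w))}.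
  have [_ _ /(_ i j)[_ h1]] := HA v Vv.1; have [_ _ /(_ i j)[_ h2]] := HB v Vv.2.
  by apply: continuousM; [exact: cst_continuous|exact: continuous_affine].
have -> : (fun w => \sum_j d j 0 *
    dotv q (partial (partial A j) i w *m y + partial (partial B j) i w)) =
   \sum_j (fun w => d j 0 *
    dotv q (partial (partial A j) i w *m y + partial (partial B j) i w)).
  by apply/funext => w; rewrite fct_sumE.
elim/big_ind : _ => [|f g cf cg|//]; first exact: cst_continuous.
by apply: continuousD; [exact: cf|exact: cg].
Qed.

Lemma C2_segment_lower_bound (u0 u1 : 'cV[R]_m) (kappa : R) : U u0 -> U u1 ->
  (forall v, U v -> dotv q (D2u A v (u1 - u0) (u1 - u0) *m y + D2u B v (u1 - u0) (u1 -
    u0)) <= kappa) ->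
  forall s : R, 0 <= s <= 1 ->
  (1 - s) * phi u0 + s * phi u1 - kappa / 2 * (s * (1 - s)) <= phi (u0 + s *: (u1 - u0)).
Proof.
move=> Uu0 Uu1 Hk s s01.
have := @concave_lower_bound (fun s => phi (u0 + s *: (u1 - u0)))
  (fun s => dotv q (Du A (u0 + s *: (u1 - u0)) (u1 - u0) *m y + Du B (u0 + s *: (u1 -
    u0)) (u1 - u0)))
  (fun s => let v := u0 + s *: (u1 - u0) in
     dotv q (D2u A v (u1 - u0) (u1 - u0) *m y + D2u B v (u1 - u0) (u1 - u0))) kappa.
rewrite scale0r addr0 scale1r [u0 + _]addrC subrK; apply => // t t01.
- by have [] := C2_segment_derive Uu0 Uu1 t01.
- by have [] := C2_segment_derive Uu0 Uu1 t01.
- by apply: Hk; exact: convex_segment.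
Qed.

Lemma C2_segment_increment (u0 u1 : 'cV[R]_m) (kappa : R) : U u0 -> U u1 ->
  (forall v, U v -> dotv q (Du A v (u1 - u0) *m y + Du B v (u1 - u0)) <= kappa) ->
  phi u1 - phi u0 <= kappa.
Proof.
move=> Uu0 Uu1 Hk.
have [t|c] := @mvt_segment_sym _ (fun s => phi (u0 + s *: (u1 - u0)))
  (fun s => dotv q (Du A (u0 + s *: (u1 - u0)) (u1 - u0) *m y + Du B (u0 + s *: (u1 -
    u0)) (u1 - u0))) 0 1.
  rewrite (min_idPl ler01) (max_idPr ler01) => t01.
  by have [] := C2_segment_derive Uu0 Uu1 t01.
rewrite (min_idPl ler01) (max_idPr ler01) => c01.
rewrite scale1r [u0 + (u1 - u0)]addrC subrK scale0r addr0 subr0 mulr1 => ->.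
by apply: Hk; exact: convex_segment.
Qed.

End segment.
End second_order.

(** * Operator norms of derivatives, measured by a seminorm other than the library norm *)

Section derivative_bounds.
Context {R : realType}.

Lemma C2_around_cst m (W : normedModType R) (U : set 'cV[R]_m) (c : W) :
  C2_around U (cst c).
Proof.
have p0 (k : W) i : partial (cst k : 'cV[R]_m -> W) i = cst 0.
  by apply/funext => v; rewrite /partial derive_cst.
exists setT; split => //; first exact: openT.
move=> u _; split; first exact: cst_continuous.
  by move=> i; rewrite p0; split; [exact: derivable_cst|exact: cst_continuous].
by move=> i j; rewrite !p0; split; [exact: derivable_cst|exact: cst_continuous].
Qed.

Section seminorm.
Variables (m : nat) (W : normedModType R) (NW : W -> R).
Hypotheses (NWD : forall x y, NW (x + y) <= NW x + NW y)
  (NWZ : forall a x, NW (a *: x) = `|a| * NW x) (NW0 : forall x, 0 <= NW x).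

Lemma seminorm_sum (I : finType) (F : I -> W) : NW (\sum_i F i) <= \sum_i NW (F i).
Proof.
elim/big_ind2 : _ => [|x1 x2 y1 y2 h1 h2|//].
  by rewrite -(scale0r 0) NWZ normr0 mul0r.
by apply: le_trans (NWD _ _) _; rewrite lerD.
Qed.

Lemma Du_bounded (f : 'cV[R]_m -> W) u v :
  NW (Du f u v) <= (\sum_i NW (partial f i u)) * enorm v.
Proof.
apply: le_trans (seminorm_sum _) _; rewrite mulr_suml; apply: ler_sum => i _.
by rewrite NWZ mulrC ler_wpM2l// coord_le_enorm.
Qed.

Lemma le_opnorm_Du (f : 'cV[R]_m -> W) u v :
  NW (Du f u v) <= opnorm (@enorm R m) NW (Du f u) * enorm v.
Proof.
apply: le_opnorm (@Du_bounded f u) v => a v.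
by rewrite -NWZ; congr NW; rewrite /Du scaler_sumr; apply: eq_bigr => i _;
  rewrite mxE scalerA.
Qed.

Lemma opnorm_Du_ge0 (f : 'cV[R]_m -> W) u : 0 <= opnorm (@enorm R m) NW (Du f u).
Proof. exact: opnorm_ge0 NW0 (@Du_bounded f u). Qed.

Lemma D2u_bounded (f : 'cV[R]_m -> W) u v w :
  NW (D2u f u v w) <= (\sum_i \sum_j NW (partial (partial f j) i u)) * (enorm v * enorm
    w).
Proof.
apply: le_trans (seminorm_sum _) _; rewrite mulr_suml; apply: ler_sum => i _.
apply: le_trans (seminorm_sum _) _; rewrite mulr_suml; apply: ler_sum => j _.
by rewrite NWZ mulrC ler_wpM2l// normrM ler_pM ?coord_le_enorm.
Qed.

Lemma le_opnorm2_D2u (f : 'cV[R]_m -> W) u v :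
  NW (D2u f u v v) <= opnorm2 (@enorm R m) NW (D2u f u) * enorm v ^+ 2.
Proof.
have [v0|v0] := eqVneq (enorm v) 0.
  by apply: le_trans (D2u_bounded _ _ _ _) _; rewrite v0 mulr0 mulr0 expr0n/= mulr0.
have vp : 0 < enorm v by rewrite lt_neqAle eq_sym v0 enorm_ge0.
pose w := (enorm v)^-1 *: v.
have w1 : enorm w = 1 by rewrite enormZ gtr0_norm ?invr_gt0// mulVf.
have -> : NW (D2u f u v v) = NW (D2u f u w w) * enorm v ^+ 2.
  rewrite mulrC -[X in X * _]ger0_norm ?sqr_ge0// -NWZ; congr NW.
  rewrite /D2u scaler_sumr; apply: eq_bigr => i _.
  rewrite scaler_sumr; apply: eq_bigr => j _; rewrite scalerA; congr (_ *: _).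
  by rewrite !mxE; field.
apply: ler_wpM2r; first exact: sqr_ge0.
apply: ub_le_sup; last by exists (w, w).
exists (\sum_i \sum_j NW (partial (partial f j) i u)) => _ [[a b] /= [a1 b1] <-].
by have := D2u_bounded f u a b; rewrite a1 b1 !mulr1.
Qed.

End seminorm.
End derivative_bounds.

(** * Derivative bounds for the coefficients of the control problem *)

Section problem_bounds.
Context {R : realType} {m n d d' : nat} (P : problem R m n d d') (HP :
  standing_assumptions P).
Local Notation T := (ps_T P).
Local Notation A := (ps_A P).
Local Notation B := (ps_B P).
Local Notation U := (ps_U P).

Lemma DuA_le t w u v : t \in `[0, T] -> ps_Omegat P w -> U u ->
  spec_norm (Du (A t w) u v) <= G_A P * enorm v.
Proof.
move=> tT Ow Uu; apply: le_trans (le_opnorm_Du (@spec_normD R n n) (@spec_normZ R n n)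
  (@spec_norm_ge0 R n n) _ _ _) _.
apply: ler_wpM2r; first exact: enorm_ge0.
by apply: (ub_le_sup (G_A_finite HP)); exists (t, w, u).
Qed.

Lemma D2uA_le t w u v : t \in `[0, T] -> ps_Omegat P w -> U u ->
  spec_norm (D2u (A t w) u v v) <= H_A P * enorm v ^+ 2.
Proof.
move=> tT Ow Uu; apply: le_trans (le_opnorm2_D2u (@spec_normD R n n) (@spec_normZ R n
  n) (@spec_norm_ge0 R n n) _ _ _) _.
apply: ler_wpM2r; first exact: sqr_ge0.
by apply: (ub_le_sup (H_A_finite HP)); exists (t, w, u).
Qed.

Lemma D2uB_le t w u v : t \in `[0, T] -> ps_Omegat P w -> U u ->
  enorm (D2u (B t w) u v v) <= H_B P * enorm v ^+ 2.
Proof.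
move=> tT Ow Uu; apply: le_trans (le_opnorm2_D2u (@ler_enormD R n) (@enormZ R n)
  (@enorm_ge0 R n) _ _ _) _.
apply: ler_wpM2r; first exact: sqr_ge0.
by apply: (ub_le_sup (H_B_finite HP)); exists (t, w, u).
Qed.

Lemma Omega_neq0 : ps_Omega P !=set0.
Proof.
apply/set0P/negP => /eqP O0; have := mu_Omega HP.
by rewrite O0 measure0 => /eqP; rewrite eq_sym onee_eq0.
Qed.

Lemma G_A_ge0 : 0 <= G_A P.
Proof.
have [w Ow] := Omega_neq0; have [u Uu] := U_neq0 HP.
apply: le_trans (opnorm_Du_ge0 (@spec_normD R n n) (@spec_normZ R n n) (@spec_norm_ge0
  R n n) (A 0 w) u) _.
apply: (ub_le_sup (G_A_finite HP)); exists (0, w, u) => //; split=> //; split=> //=.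
  by rewrite in_itv/= lexx ltW// (T_gt0 HP).
exact: (Omega_sub HP).
Qed.

(** The mean value theorem needs a scalar function, so the matrix is tested against a vector [p];
    this is [C2_segment_increment] with the constant 0 for [B]. The two choices [q] and [- q] of [p]
    give the absolute value. *)
Lemma A_lipschitz t w u0 u1 (q y : 'cV[R]_n) : t \in `[0, T] -> ps_Omegat P w ->
  U u0 -> U u1 ->
  `|dotv q ((A t w u1 - A t w u0) *m y)| <= enorm q * (G_A P * enorm (u1 - u0)) * enorm y.
Proof.
move=> tT Ow Uu0 Uu1.
have key (p : 'cV[R]_n) : dotv p ((A t w u1 - A t w u0) *m y) <=
  enorm p * (G_A P * enorm (u1 - u0)) * enorm y.
  have := @C2_segment_increment _ _ _ _ U (A t w) (cst 0) p y (U_convex HP)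
    (A_C2 HP tT Ow) (C2_around_cst _ _) u0 u1 (enorm p * (G_A P * enorm (u1 - u0)) *
      enorm y) Uu0 Uu1.
  rewrite /cst !addr0 mulmxBl dotvBr; apply => v Uv.
  have -> : Du (fun=> 0) v (u1 - u0) = 0 :> 'cV[R]_n.
    by rewrite /Du big1// => i _; rewrite /partial derive_cst scaler0.
  rewrite addr0; apply: le_trans (dotv_le _ _) _; rewrite -mulrA ler_wpM2l ?enorm_ge0//.
  apply: le_trans (le_spec_norm _ _) _; rewrite ler_wpM2r ?enorm_ge0//.
  exact: DuA_le.
rewrite ler_norml key andbT lerNl -mulN1r -dotvZl.
by apply: le_trans (key _) _; rewrite scaleN1r enormN.
Qed.

Lemma hamiltonian_segment t w u0 u1 (q y : 'cV[R]_n) : t \in `[0, T] ->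
  ps_Omegat P w -> U u0 -> U u1 ->
  forall s : R, 0 <= s <= 1 ->
  (1 - s) * dotv q (A t w u0 *m y + B t w u0) + s * dotv q (A t w u1 *m y + B t w u1)
    - enorm q * (H_A P * enorm y + H_B P) * enorm (u1 - u0) ^+ 2 / 2 * (s * (1 - s))
  <= dotv q (A t w (u0 + s *: (u1 - u0)) *m y + B t w (u0 + s *: (u1 - u0))).
Proof.
move=> tT Ow Uu0 Uu1 s s01.
apply: (@C2_segment_lower_bound _ _ _ _ U) => //; first exact: (U_convex HP).
- exact: (A_C2 HP).
- exact: (B_C2 HP).
move=> v Uv; apply: le_trans (dotv_le _ _) _; rewrite -mulrA ler_wpM2l ?enorm_ge0//.
apply: le_trans (ler_enormD _ _) _; rewrite mulrDl lerD//; last exact: D2uB_le.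
apply: le_trans (le_spec_norm _ _) _; rewrite mulrAC ler_wpM2r ?enorm_ge0//.
exact: D2uA_le.
Qed.

End problem_bounds.

(** * Uniform limits and stability of linear equations *)

Section tube.
Context {R : realType}.

(** Compactness of [S] and [V] makes continuity in the middle variable uniform in the two others: a
    near-covering argument on the product yields one neighbourhood of [y0] for all [(x, z)]. *)
Lemma tube_lemma (X Y Z : topologicalType) (W : normedModType R) (S : set X) (O : set Y)
    (V : set Z) (G : X * Y * Z -> W) (y0 : Y) (e : R) :
  compact S -> compact V -> O y0 ->
  {within S `*` O `*` V, continuous G} -> 0 < e ->
  \forall y \near within O (nbhs y0), forall x z, S x -> V z ->
    `|G (x, y, z) - G (x, y0, z)| <= e.
Proof.
move=> cS cV Oy0 cG e0.
have cSV : compact (S `*` V) by exact: compact_setX.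
have /compact_near_coveringP cov := cSV.
pose Q y xz := (S `*` V) xz -> O y -> `|G (xz.1, y, xz.2) - G (xz.1, y0, xz.2)| <= e.
have H : \forall y \near within O (nbhs y0), S `*` V `<=` Q y.
  apply: (cov _ (within O (nbhs y0)) Q).
  move=> [x z] [/= Sx Vz].
  have Dx : (S `*` O `*` V) (x, y0, z) by [].
  have e20 : 0 < e / 2 by rewrite divr_gt0.
  have := cG (x, y0, z); move=> /cvgrPdist_lt/(_ (e / 2) e20) cGx.
  have : within (S `*` O `*` V) (nbhs (x, y0, z)) (fun w =>
    `|G (x, y0, z) - G w| < e / 2).
    by rewrite nbhs_subspace_in.
  move=> [[/= P12 P3] [/= [[/= P1 P2] /= [P1x P2y] P12s] P3z] Hs].
  exists (P1 `*` P3, [set y | O y -> P2 y]); first split => /=.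
  - by exists (P1, P3).
  - by apply: filterS P2y => y P2y Oy.
  move=> [[x' z'] y] /= [[P1x' P3z'] OP2] [Sx' Vz'] Oy.
  (* Since [y0] itself lies in [P2], both values of [G] can be compared with the value at the centre
     [(x, y0, z)], each at the price of [e / 2]. *)
  have P2y0 := nbhs_singleton P2y.
  have h1 := Hs (x', y, z') (conj (P12s (x', y) (conj P1x' (OP2 Oy))) P3z') (conj (conj
    Sx' Oy) Vz').
  have h2 := Hs (x', y0, z') (conj (P12s (x', y0) (conj P1x' P2y0)) P3z') (conj (conj
    Sx' Oy0) Vz').
  rewrite /= in h1 h2.
  have -> : G (x', y, z') - G (x', y0, z') = (G (x, y0, z) - G (x', y0, z')) - (G (x,
    y0, z) - G (x', y, z')).
    by rewrite opprB [RHS]addrC subrKA.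
  apply: le_trans (ler_normB _ _) _; rewrite (splitr e).
  by apply: ltW; exact: ltrD.
have WO : \forall y \near within O (nbhs y0), O y by exact: withinT.
by apply: filterS2 WO H => y Oy H x z Sx Vz; exact: (H (x, z)).
Qed.
End tube.

Section uniform_limits.
Context {R : realType} {I X : Type} (F : set_system I) {FF : Filter F} (D : set X).

(** The limit is required to be bounded, which makes uniform convergence stable under products. In
    the applications the filter is that of the neighbourhoods of a point of [Omega] within [Omega],
    and [D] is the time interval. *)
Definition ulim (g : I -> X -> R) (l : X -> R) : Prop :=
  (forall e, 0 < e -> \forall i \near F, forall x, D x -> `|g i x - l x| <= e) /\
  (exists K, forall x, D x -> `|l x| <= K).

Lemma ulim_bound g l : ulim g l -> exists2 K, 0 < K & forall x, D x -> `|l x| <= K.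
Proof.
move=> [_ [K HK]]; exists (`|K| + 1); first by rewrite ltr_wpDl.
move=> x /HK h; have := ler_norm K; lra.
Qed.

Lemma ulim_cst (l : X -> R) (K : R) : (forall x, D x -> `|l x| <= K) -> ulim (fun=> l) l.
Proof.
move=> HK; split; last by exists K.
by move=> e e0; apply: nearW => i x _; rewrite subrr normr0 ltW.
Qed.

Lemma ulim_ext g g' l l' : (forall i x, g i x = g' i x) -> (forall x, l x = l' x) ->
  ulim g l -> ulim g' l'.
Proof.
move=> gg ll; rewrite (_ : g' = g); last by apply/funext => i; apply/funext => x.
by rewrite (_ : l' = l)//; apply/funext.
Qed.

Lemma ulimD g l g' l' : ulim g l -> ulim g' l' ->
  ulim (fun i x => g i x + g' i x) (fun x => l x + l' x).
Proof.
move=> [h [K HK]] [h' [K' HK']]; split; last first.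
  exists (K + K') => x Dx; apply: le_trans (ler_normD _ _) _.
  by rewrite lerD ?HK ?HK'.
move=> e e0; have e20 : 0 < e / 2 by rewrite divr_gt0.
apply: filterS2 (h _ e20) (h' _ e20) => i H H' x Dx.
rewrite opprD addrACA (splitr e); apply: le_trans (ler_normD _ _) _.
by rewrite lerD ?H ?H'.
Qed.

Lemma ulimM g l g' l' : ulim g l -> ulim g' l' ->
  ulim (fun i x => g i x * g' i x) (fun x => l x * l' x).
Proof.
move=> ug ug'; have [K K0 HK] := ulim_bound ug; have [K' K'0 HK'] := ulim_bound ug'.
split; last first.
  by exists (K * K') => x Dx; rewrite normrM ler_pM ?HK ?HK'.
move=> e e0; pose M := K + K' + 1.
have M0 : 0 < M by rewrite /M; lra.
pose d := Num.min 1 (e / M).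
have d0 : 0 < d by rewrite lt_min ltr01 divr_gt0.
have dM : d * M <= e by rewrite -ler_pdivlMr// ge_min lexx orbT.
have d1 : d <= 1 by rewrite ge_min lexx.
apply: filterS2 (ug.1 _ d0) (ug'.1 _ d0) => i H H' x Dx.
have -> : g i x * g' i x - l x * l' x =
  (g i x - l x) * (g' i x - l' x) + (g i x - l x) * l' x + l x * (g' i x - l' x) by ring.
have := H x Dx; have := H' x Dx; have := HK x Dx; have := HK' x Dx.
set a := g i x - l x; set b := g' i x - l' x => h1 h2 h3 h4.
apply: le_trans (ler_normD _ _) _; apply: le_trans (lerD (ler_normD _ _) (lexx _)) _.
rewrite !normrM; apply: le_trans dM; rewrite /M.
have m1 : `|a| * `|b| <= d * 1 by rewrite ler_pM// (le_trans h3).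
have m2 : `|a| * `|l' x| <= d * K' by rewrite ler_pM.
have m3 : `|l x| * `|b| <= K * d by rewrite ler_pM.
lra.
Qed.

Lemma ulim_sum (J : finType) (g : J -> I -> X -> R) (l : J -> X -> R) :
  (forall j, ulim (g j) (l j)) -> ulim (fun i x => \sum_j g j i x) (fun x =>
    \sum_j l j x).
Proof.
move=> H; suff : forall s : seq J, ulim (fun i x => \sum_(j <- s) g j i x) (fun x =>
  \sum_(j <- s) l j x) by [].
elim=> [|j s IH].
  under eq_fun do under eq_fun do rewrite big_nil.
  under [X in ulim _ X]eq_fun do rewrite big_nil.
  by apply: (@ulim_cst _ 0) => x _; rewrite normr0.
under eq_fun do under eq_fun do rewrite big_cons.
under [X in ulim _ X]eq_fun do rewrite big_cons.
exact: ulimD.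
Qed.

(** Entrywise convergence reduces matrix algebra to [ulimD] and [ulimM]; [mxulim_enorm] and
    [enorm_mxulim] translate to and from the Euclidean norm, in which Gronwall's inequality is
    stated. *)
Definition mxulim m n (g : I -> X -> 'M[R]_(m, n)) (l : X -> 'M[R]_(m, n)) : Prop :=
  forall j k, ulim (fun i x => g i x j k) (fun x => l x j k).

Lemma mxulim_cst m n (l : X -> 'M[R]_(m, n)) (K : R) :
  (forall x j k, D x -> `|l x j k| <= K) -> mxulim (fun=> l) l.
Proof. by move=> H j k; apply: (@ulim_cst _ K) => x Dx; exact: H. Qed.

Lemma mxulim_const m n (l : 'M[R]_(m, n)) : mxulim (fun _ _ => l) (fun=> l).
Proof. by move=> j k; apply: (@ulim_cst _ `|l j k|). Qed.

Lemma mxulimD m n (g g' : I -> X -> 'M[R]_(m, n)) l l' : mxulim g l -> mxulim g' l' ->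
  mxulim (fun i x => g i x + g' i x) (fun x => l x + l' x).
Proof.
move=> h h' j k; under eq_fun do under eq_fun do rewrite mxE.
under [X in ulim _ X]eq_fun do rewrite mxE.
exact: ulimD.
Qed.

Lemma mxulimZ m n (g : I -> X -> 'M[R]_(m, n)) l (a : R) : mxulim g l ->
  mxulim (fun i x => a *: g i x) (fun x => a *: l x).
Proof.
move=> h j k; under eq_fun do under eq_fun do rewrite mxE.
under [X in ulim _ X]eq_fun do rewrite mxE.
by apply: ulimM => //; apply: (@ulim_cst _ `|a|).
Qed.

Lemma mxulimN m n (g : I -> X -> 'M[R]_(m, n)) l : mxulim g l ->
  mxulim (fun i x => - g i x) (fun x => - l x).
Proof.
move=> /(mxulimZ (-1)); under eq_fun do under eq_fun do rewrite scaleN1r.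
by under [X in mxulim _ X]eq_fun do rewrite scaleN1r.
Qed.

Lemma mxulimM m n p (g : I -> X -> 'M[R]_(m, n)) (g' : I -> X -> 'M[R]_(n, p)) l l' :
  mxulim g l -> mxulim g' l' ->
  mxulim (fun i x => g i x *m g' i x) (fun x => l x *m l' x).
Proof.
move=> h h' j k; under eq_fun do under eq_fun do rewrite mxE.
under [X in ulim _ X]eq_fun do rewrite mxE.
by apply: ulim_sum => i; exact: ulimM.
Qed.

Lemma mxulim_tr m n (g : I -> X -> 'M[R]_(m, n)) l :
  mxulim g l -> mxulim (fun i x => (g i x)^T) (fun x => (l x)^T).
Proof.
move=> h j k; under eq_fun do under eq_fun do rewrite mxE.
by under [X in ulim _ X]eq_fun do rewrite mxE.
Qed.

Lemma ulim_dotv n (g g' : I -> X -> 'cV[R]_n) l l' : mxulim g l -> mxulim g' l' ->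
  ulim (fun i x => dotv (g i x) (g' i x)) (fun x => dotv (l x) (l' x)).
Proof. by move=> h h'; apply: ulim_sum => j; exact: ulimM. Qed.

Lemma mxulim_enorm n (g : I -> X -> 'cV[R]_n) l : mxulim g l ->
  forall e, 0 < e -> \forall i \near F, forall x, D x -> enorm (g i x - l x) <= e.
Proof.
move=> h e e0.
(* Comparison constant between the maximum and Euclidean norms, with 1 added so that it is positive
   in dimension zero. *)
pose c : R := Num.sqrt n%:R + 1.
have c0 : 0 < c by rewrite ltr_wpDl ?sqrtr_ge0.
have e'0 : 0 < e / c by rewrite divr_gt0.
have H0 : \forall i \near F, forall j x, D x -> `|g i x j 0 - l x j 0| <= e / c.
  by apply: (@filter_forall _ _ (fun j i => forall x, D x ->
    `|g i x j 0 - l x j 0| <= e / c) F) => j; exact: (h j 0).1.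
apply: filterS H0 => i H x Dx; apply: le_trans (enorm_le _) _.
have h1 : `|g i x - l x| <= e / c.
  rewrite [leLHS]/Num.Def.normr/= mx_normrE; apply: bigmax_le => [|[j k] _ /=];
    first exact: ltW.
  by rewrite (ord1 k) !mxE; exact: H.
apply: (@le_trans _ _ (c * (e / c))); last by rewrite mulrC divfK// gt_eqF.
by rewrite ler_pM ?sqrtr_ge0// /c lerDl.
Qed.

Lemma enorm_mxulim n (g : I -> X -> 'cV[R]_n) l K :
  (forall x, D x -> enorm (l x) <= K) ->
  (forall e, 0 < e -> \forall i \near F, forall x, D x -> enorm (g i x - l x) <= e) ->
  mxulim g l.
Proof.
move=> lK H j k; rewrite (ord1 k); split.
  move=> e /H; apply: filterS => i h x /h; apply: le_trans.
  by have := coord_le_enorm (g i x - l x) j; rewrite !mxE.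
exists K => x /lK; apply: le_trans; exact: coord_le_enorm.
Qed.

Lemma normr_mxulim m n (g : I -> X -> 'M[R]_(m, n)) (l : X -> 'M[R]_(m, n)) K :
  (forall x j k, D x -> `|l x j k| <= K) ->
  (forall e, 0 < e -> \forall i \near F, forall x, D x -> `|g i x - l x| <= e) ->
  mxulim g l.
Proof.
have le (M : 'M[R]_(m, n)) j k : `|M j k| <= `|M|.
  by rewrite [leRHS]/Num.Def.normr/= mx_normrE;
    apply: (le_bigmax _ (fun ij : _ * _ => `|M ij.1 ij.2|) (j, k)).
move=> lK H j k; split; last by exists K => x; exact: lK.
move=> e /H; apply: filterS => i h x /h; apply: le_trans.
by have := le (g i x - l x) j k; rewrite !mxE.
Qed.

End uniform_limits.

Section ode_stability.
Context {R : realType}.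

Lemma small_incrementsD (a b : R) (D1 D2 : R -> R -> R) :
  small_increments a b D1 -> small_increments a b D2 ->
  small_increments a b (fun s r => D1 s r + D2 s r).
Proof.
move=> H1 H2 e e0; have e20 : 0 < e / 2 by rewrite divr_gt0.
have [d1 d10 h1] := H1 _ e20; have [d2 d20 h2] := H2 _ e20.
exists (Num.min d1 d2); first by rewrite lt_min d10.
move=> N s r sr tr; rewrite lt_min => /andP[l1 l2].
rewrite big_split/= (splitr e); apply: ltrD; [exact: h1|exact: h2].
Qed.

Lemma abs_continuousB n (a b : R) (y z : R -> 'cV[R]_n) :
  abs_continuous a b y -> abs_continuous a b z -> abs_continuous a b (fun t => y t - z t).
Proof.
move=> cy cz.
apply: (@small_increments_le _ a b 1 (fun s r => enorm (y r - z r - (y s - z s))) _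
  ltr01 _
  (@small_incrementsD a b (fun s r => enorm (y r - y s)) (fun s r =>
    enorm (z r - z s)) cy cz)) => s r _ sr _.
have -> : y r - z r - (y s - z s) = (y r - y s) + - (z r - z s) by rewrite !opprD
  !opprK addrACA.
rewrite mul1r; apply: le_trans (ler_enormD _ _) _; rewrite enormN.
by rewrite /= lerDl subr_ge0.
Qed.

(* The difference of two solutions solves a linear equation with small forcing. *)
Lemma linear_ode_stability n (I : Type) (F : set_system I) {FF : Filter F} (T a s0 : R)
    (M : I -> R -> 'M[R]_n) M0 b b0 (y : I -> R -> 'cV[R]_n) l :
  0 < T -> 0 <= a -> s0 = 0 \/ s0 = T ->
  (\forall i \near F, forall t : R, t \in `[0, T] -> spec_norm (M i t) <= a) ->
  (\forall i \near F, solves_ode T (fun t z => M i t *m z + b i t) (y i)) ->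
  solves_ode T (fun t z => M0 t *m z + b0 t) l ->
  mxulim F `[0, T]%classic M M0 -> mxulim F `[0, T]%classic b b0 ->
  (forall e, 0 < e -> \forall i \near F, enorm (y i s0 - l s0) <= e) ->
  mxulim F `[0, T]%classic y l.
Proof.
move=> T0 a0 s0E Ma yode [lac lode] MM0 bb0 yl0.
have [K K0 HK] := abs_continuous_bounded (ltW T0) lac.
have lK t : `[0, T]%classic t -> enorm (l t) <= K by rewrite /= in_itv/=; exact: HK.
apply: (enorm_mxulim lK) => e e0.
(* When the boundary error and the forcing are both at most [e / c], Gronwall's inequality over a
   time at most [T] returns [e]. *)
pose c := expR (a * T) * (1 + T).
have c0 : 0 < c by rewrite mulr_gt0 ?expR_gt0// addr_gt0.
have e'0 : 0 < e / c by rewrite divr_gt0.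
have lu : mxulim F `[0, T]%classic (fun=> l) l.
  apply: (@mxulim_cst _ _ _ _ _ _ _ _ _ K) => t j k Dt.
  by rewrite (ord1 k); apply: le_trans (coord_le_enorm _ _) (lK _ Dt).
have forcing : \forall i \near F, forall t, `[0, T]%classic t ->
    enorm (M i t *m l t + b i t - (M0 t *m l t + b0 t)) <= e / c.
  apply: (@mxulim_enorm _ _ _ _ _ _ _ (fun i t => M i t *m l t + b i t)) => //.
  by apply: mxulimD bb0; exact: mxulimM.
apply: filterS2 (filterI Ma yode) (filterI forcing (yl0 _ e'0)).
move=> i [/= Mi yi] [/= fi yi0] t; have [yac yode'] := yi;
  rewrite /= in_itv/= => /andP[t0 tT].
have zac := abs_continuousB yac lac.
have zode : {ae lebesgue_measure, forall t : R, t \in `]0, T[ ->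
    exists2 k, is_derive t 1 (fun t => y i t - l t) k & enorm k <=
      a * enorm (y i t - l t) + e / c}.
  apply: filterS2 yode' lode; first exact: (ae_filter_ringOfSetsType lebesgue_measure).
  move=> s H1 H2 sT; have d1 := H1 sT; have d2 := H2 sT.
  have sT' : s \in `[0, T] by exact: subset_itv_oo_cc.
  eexists; first exact: (is_deriveB d1 d2).
  have -> : M i s *m y i s + b i s - (M0 s *m l s + b0 s) =
      M i s *m (y i s - l s) + (M i s *m l s + b i s - (M0 s *m l s + b0 s)).
    by rewrite mulmxBr !addrA subrK.
  apply: le_trans (ler_enormD _ _) _; apply: lerD; last exact: fi.
  apply: le_trans (le_spec_norm _ _) _; rewrite ler_wpM2r ?enorm_ge0//; exact: Mi.
have key (r : R) : 0 <= r <= T -> forall v, enorm (y i s0 - l s0) <= e / c ->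
   v <= expR (a * r) * (enorm (y i s0 - l s0) + e / c * r) -> v <= e.
  move=> /andP[r0 rT] v h1 /le_trans; apply.
  have E : e = expR (a * T) * (e / c + e / c * T) by rewrite /c; field;
    rewrite !gt_eqF ?expR_gt0 ?addr_gt0.
  rewrite [leRHS]E; have h2 := ltW e'0; apply: ler_pM; first exact: expR_ge0.
  - by apply: addr_ge0; [exact: enorm_ge0|exact: mulr_ge0].
  - by rewrite ler_expR ler_wpM2l.
  - by rewrite lerD// ler_wpM2l.
have [s0E'|s0E'] := s0E.
  apply: (key t) => //; first by rewrite t0.
  have [+ _] := gronwall a0 (ltW e'0) zac zode (lexx 0) t0 tT.
  by rewrite s0E' subr0.
apply: (key (T - t)) => //; first by apply/andP; split; lra.
have [_ +] := gronwall a0 (ltW e'0) zac zode t0 tT (lexx T).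
by rewrite s0E'.
Qed.

End ode_stability.

(** * The completed Lebesgue measure *)

Section completed_lebesgue.
Context {R : realType}.
Local Notation leb := (@lebesgue_measure R).
Local Notation cleb := (@completed_lebesgue_measure R).
Local Notation CT := (caratheodory_type ((wlength (@idfun R))^*)%mu).

Lemma completed_measurable (D : set R) : measurable (D : set (measurableTypeR R)) ->
  measurable (D : set CT).
Proof. exact: sub_caratheodory. Qed.

Lemma completed_measurable_fun d (Y : sigmaRingType d) (D : set R) (f : R -> Y) :
  measurable (D : set (measurableTypeR R)) ->
  measurable_fun (D : set (measurableTypeR R)) f -> measurable_fun (D : set CT) f.
Proof. by move=> mD mf _ Z mZ; apply: completed_measurable; exact: mf. Qed.

Lemma completed_itv (a b : R) : a <= b -> cleb `[a, b]%classic = (b - a)%:E.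
Proof.
move=> ab; have := @lebesgue_measure_itv R `[a, b]; rewrite /= lte_fin => H.
transitivity (leb `[a, b]%classic) => //; rewrite H.
by move: ab; rewrite le_eqVlt => /orP[/eqP ->|->//]; rewrite ltxx subrr.
Qed.

Lemma ae_completed (Q : R -> Prop) :
  {ae leb, forall t : R, Q t} -> {ae cleb, forall t : R, Q t}.
Proof.
move=> [N [mN N0 HN]]; exists N; split => //.
exact: completed_measurable.
Qed.

(** The identity from the completed to the Borel sigma-algebra is measurable and pushes the
    completed measure forward to Lebesgue measure; the equality is the change of variables along
    it. *)
Lemma ge0_integral_completed (D : set R) (f : measurableTypeR R -> \bar R) :
  measurable (D : set (measurableTypeR R)) ->
  measurable_fun (D : set (measurableTypeR R)) f ->
  (forall t, D t -> 0 <= f t)%E ->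
  (\int[cleb]_(t in D) f t = \int[leb]_(t in D) f t)%E.
Proof.
move=> mD mf f0.
pose id' : CT -> measurableTypeR R := idfun.
have mid : measurable_fun setT id'.
  by move=> _ Y mY; rewrite setTI; exact: completed_measurable.
pose idmix := isMeasurableFun.Build _ _ _ _ _ mid.
pose phi : {mfun CT >-> measurableTypeR R} := HB.pack id' idmix.
have E := @ge0_integral_pushforward _ _ _ _ _ phi mid cleb D f mD mf.
transitivity (\int[cleb]_(x in phi @^-1` D) (f \o phi) x)%E => //.
rewrite -E; last by move=> t; rewrite inE; exact: f0.
exact: (@eq_measure_integral _ (measurableTypeR R) R D leb (pushforward cleb phi) f).
Qed.

End completed_lebesgue.

(** * Increments of Lipschitz functions from derivative bounds almost everywhere *)

Section lipschitz_increment.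
Context {R : realType}.
Local Notation leb := (@lebesgue_measure R).
Local Notation cleb := (@completed_lebesgue_measure R).
Local Notation CT := (caratheodory_type ((wlength (@idfun R))^*)%mu).

Lemma lipschitz_continuous (Z : R -> R) (L : R) : 0 <= L ->
  (forall s t, `|Z t - Z s| <= L * `|t - s|) -> continuous Z.
Proof.
move=> L0 H x; apply/cvgrPdist_lt => e e0.
have L1 : 0 < L + 1 by rewrite ltr_wpDl.
apply/nbhs_ballP; exists (e / (L + 1)) => /=; first exact: divr_gt0.
move=> t; rewrite /ball/= => h; apply: le_lt_trans (H _ _) _.
apply: (@le_lt_trans _ _ ((L + 1) * `|x - t|)); first by rewrite ler_wpM2r// lerDl.
by rewrite mulrC -ltr_pdivlMr.
Qed.

(** Integration starts at -1 so that the derivative is two-sided at 0. *)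
Lemma continuous_antiderivative (Z : R -> R) (b : R) : continuous Z ->
  exists W : R -> R, forall x, -1 < x -> x < b -> is_derive x 1 W (Z x).
Proof.
move=> cZ; exists (fun x => \int[leb]_(t in [set` `[-1, x]]) Z t)%R => x x1 xb.
have [|d1 d2] := @continuous_FTC1_closed R Z (-1) x b xb _ x1 (cZ x).
  apply: continuous_compact_integrable; first exact: segment_compact.
  exact: continuous_subspaceT.
by apply: DeriveDef; [exact: d1|rewrite -derive1E; exact: d2].
Qed.

(** The difference quotient of step [h] is the derivative of [F], the mean of [Z] over [[t, t + h]].
    Constancy of [Z] after [T] makes [F T] equal to [Z T], and the Lipschitz bound puts [F 0] within
    [L * h] of [Z 0]. *)
Lemma integral_difference_quotient (Z : R -> R) (T L h : R) : 0 < T -> 0 <= L -> 0 < h ->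
  (forall s t, `|Z t - Z s| <= L * `|t - s|) ->
  (forall t, T <= t -> Z t = Z T) ->
  (Z T - Z 0 - L * h <= \int[leb]_(t in `[0, T]) (h^-1 * (Z (t + h) - Z t)))%R.
Proof.
move=> T0 L0 h0 ZL ZT; have cZ := lipschitz_continuous L0 ZL.
have [W dW] := continuous_antiderivative (T + h + 1) cZ.
pose F t := h^-1 * (W (t + h) - W t).
pose q t := h^-1 * (Z (t + h) - Z t).
have cq : continuous q.
  move=> t; apply: cvgM; first exact: cvg_cst.
  apply: cvgB; last exact: cZ.
  apply: (@continuous_comp _ _ _ (fun t => t + h) Z); last exact: cZ.
  by apply: cvgD; [exact: cvg_id|exact: cvg_cst].
have dF (t : R) : 0 <= t <= T -> is_derive t 1 F (q t).
  move=> /andP[t0 tT].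
  have d1 : is_derive t 1 (fun t : R => t + h) 1.
    by apply: is_derive_eq; rewrite addr0.
  have d2 : is_derive (t + h) 1 W (Z (t + h)) by apply: dW; lra.
  have d3 : is_derive t 1 W (Z t) by apply: dW; lra.
  have d4 := @is_derive1_comp _ W (fun t : R => t + h) t _ _ d2 d1; rewrite mulr1 in d4.
  exact: (is_deriveZ h^-1 (is_deriveB d4 d3)).
have cF (t : R) : 0 <= t <= T -> {for t, continuous F}.
  by move=> /dF[d _]; apply: differentiable_continuous; exact/derivable1_diffP.
have E : (\int[leb]_(t in `[0, T]) q t)%R = F T - F 0.
  rewrite /Rintegral (@continuous_FTC2 R q F 0 T T0)//.
  - by apply: continuous_subspaceT.
  - split.
    + by move=> t; rewrite in_itv/= => /andP[/ltW t0 /ltW tT]; have [|] := dF t;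
      rewrite ?t0.
    + by apply: cvg_at_right_filter; apply: cF; rewrite lexx ltW.
    + by apply: cvg_at_left_filter; apply: cF; rewrite lexx ltW.
  - move=> t; rewrite in_itv/= => /andP[/ltW t0 /ltW tT]; rewrite derive1E.
    by have [|_ ->] := dF t; rewrite ?t0.
rewrite E /F.
have mvtW (a : R) : 0 <= a -> a <= T ->
    exists2 c, a <= c <= a + h & h^-1 * (W (a + h) - W a) = Z c.
  move=> a0 aT; have ah : a <= a + h by rewrite lerDl ltW.
  have [t|c] := @mvt_segment_sym _ W Z a (a + h).
    by rewrite (min_idPl ah) (max_idPr ah) => /andP[? ?]; apply: dW; lra.
  rewrite (min_idPl ah) (max_idPr ah) => hc ->; exists c => //.
  by rewrite (_ : a + h - a = h); [field; rewrite gt_eqF|ring].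
have [c1 /andP[c1T _] ->] := mvtW T (ltW T0) (lexx T).
have [c2 /andP[c20 c2h] ->] := mvtW 0 (lexx 0) (ltW T0).
rewrite (ZT c1 c1T).
have := ZL 0 c2; rewrite subr0 (ger0_norm c20) => /(le_trans (ler_norm _)).
have : L * c2 <= L * h by rewrite ler_wpM2l//; move: c2h; rewrite add0r.
lra.
Qed.

Lemma Rintegral_completed_continuous (q : R -> R) (T : R) : 0 <= T -> continuous q ->
  (\int[cleb]_(t in `[0, T]) q t = \int[leb]_(t in `[0, T]) q t)%R.
Proof.
move=> T0 cq; rewrite /Rintegral; congr fine.
have mq : measurable_fun (`[0, T]%classic : set (measurableTypeR R)) q.
  exact: measurable_funTS (continuous_measurable_fun cq).
rewrite [LHS]integralE [RHS]integralE; congr (_ - _)%E;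
  apply: ge0_integral_completed => //.
- exact/measurable_funepos/measurable_EFinP.
- exact/measurable_funeneg/measurable_EFinP.
Qed.

Lemma completed_integrable (T K : R) (f : R -> R) : 0 <= T ->
  measurable_fun (`[0, T]%classic : set CT) f -> (forall t, 0 <= t <= T -> `|f t| <= K) ->
  cleb.-integrable `[0, T] (EFin \o f).
Proof.
move=> T0 mf fK; apply: measurable_bounded_integrable => //.
- exact: completed_measurable.
- by rewrite [X in (X < _)%E](completed_itv T0) ltry.
- exists K; split; first exact: num_real.
  by move=> M KM t; rewrite /= in_itv/= => /fK h; exact: le_trans h (ltW KM).
Qed.

(** The difference quotients of step [1 / (k + 1)] are continuous and bounded by [L]. They exceed
    [S + eps] by at most a function [g k] that tends to 0 almost everywhere, so dominated
    convergence removes the excess. *)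
Lemma lipschitz_increment_le (T L K eps : R) (Y S : R -> R) : 0 < T -> 0 <= L ->
  0 <= eps ->
  (forall s t, 0 <= s <= T -> 0 <= t <= T -> `|Y t - Y s| <= L * `|t - s|) ->
  measurable_fun (`[0, T]%classic : set CT) S ->
  (forall t, 0 <= t <= T -> `|S t| <= K) ->
  {ae leb, forall t : R, t \in `]0, T[ -> exists2 l, is_derive t 1 Y l & l <=
    S t + eps} ->
  Y T - Y 0 <= \int[cleb]_(t in `[0, T]) S t + eps * T.
Proof.
move=> T0 L0 eps0 YL mS SK aeY.
have T0' := ltW T0.
(* Composition with the projection onto [[0, T]] extends [Y] by constants and keeps its Lipschitz
   constant, so difference quotients make sense up to and beyond [T]. *)
pose clamp (t : R) := Num.max 0 (Num.min t T).
have clamp_in t : 0 <= clamp t <= T.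
  by rewrite /clamp le_max lexx/= ge_max T0' ge_min lexx orbT.
have clamp_id t : 0 <= t <= T -> clamp t = t.
  by move=> /andP[t0 tT]; rewrite /clamp (min_idPl tT) (max_idPr t0).
have clampL s t : `|clamp t - clamp s| <= `|t - s|.
  have h1 := ler_norm (t - s); have h2 := ler_norm (s - t); rewrite distrC in h2.
  rewrite ler_norml /clamp; case: (leP s T) => ?; case: (leP t T) => ?;
  repeat match goal with |- context [Num.max 0 ?x] => case: (leP 0 x) => ? end;
  by apply/andP; split; lra.
pose Z t := Y (clamp t).
have ZL s t : `|Z t - Z s| <= L * `|t - s|.
  by apply: le_trans (YL _ _ _ _) _ => //; rewrite ler_wpM2l.
have ZT t : T <= t -> Z t = Z T.
  by move=> Tt; rewrite /Z /clamp (min_idPr Tt) (min_idPl (lexx T)).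
have -> : Y T - Y 0 = Z T - Z 0 by rewrite /Z !clamp_id// ?lexx ?T0'.
have cZ := lipschitz_continuous L0 ZL.
pose h (k : nat) : R := k.+1%:R^-1.
have h0 k : 0 < h k by rewrite invr_gt0.
pose q k t := (h k)^-1 * (Z (t + h k) - Z t).
have cq k : continuous (q k).
  move=> t; apply: cvgM; first exact: cvg_cst.
  apply: cvgB; last exact: cZ.
  apply: (@continuous_comp _ _ _ (fun t => t + h k) Z); last exact: cZ.
  by apply: cvgD; [exact: cvg_id|exact: cvg_cst].
have qL k t : `|q k t| <= L.
  rewrite /q normrM normfV (gtr0_norm (h0 k)) ler_pdivrMl// mulrC.
  by apply: le_trans (ZL _ _) _; rewrite addrAC subrr add0r (gtr0_norm (h0 k)).
have mq k : measurable_fun (`[0, T]%classic : set CT) (q k).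
  apply: completed_measurable_fun => //.
  exact: measurable_funTS (continuous_measurable_fun (cq k)).
pose g k t := Num.max (q k t - S t - eps) 0.
have mg k : measurable_fun (`[0, T]%classic : set CT) (g k).
  apply: measurable_maxr; last exact: measurable_cst.
  by apply: measurable_funB; [exact: (measurable_funB (mq k) mS)|exact: measurable_cst].
have gb k t : 0 <= t <= T -> `|g k t| <= L + K + eps.
  move=> tT; have := qL k t; have := SK t tT.
  rewrite !ler_norml /g => /andP[? ?] /andP[? ?].
  by case: (leP (q k t - S t - eps) 0) => ?; apply/andP; split; lra.
have ig k := completed_integrable T0' (mg k) (gb k).
have iS := completed_integrable T0' mS SK.
have iq k := completed_integrable T0' (mq k) (fun t _ => qL k t).
have mD : measurable (`[0, T]%classic : set CT) by exact: completed_measurable.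
have fD : (cleb `[0%R, T]%classic < +oo)%E by rewrite [X in (X < _)%E](completed_itv
  T0') ltry.
have icst (c : R) : cleb.-integrable `[0, T] (EFin \o cst c).
  by apply: (@completed_integrable _ `|c|).
(* The derivative bound covers the open interval, the integral the closed one. *)
have ae_neq (a : R) : {ae leb, forall t : R, t != a}.
  exists [set a]; split; [exact: measurable_set1|exact: lebesgue_measure_set1|].
  by move=> t /= /negP; rewrite negbK => /eqP.
have cvg_g : {ae cleb, forall t : R, `[0, T]%classic t ->
  ((g k t)%:E @[k --> \oo] --> (cst 0%E : R -> \bar R) t)}.
  have aeF := ae_filter_ringOfSetsType leb.
  apply: ae_completed.
  apply: (@filterS _ (almost_everywhere leb) aeF _ _ _ (@filterI _ _ aeF _ _ (@filterI
    _ _ aeF _ _ (ae_neq 0) (ae_neq T)) aeY)).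
  move=> t [[/= t0 tT] H] /=; rewrite in_itv/= => /andP[t0' tT'].
  have {t0 t0'}t0 : 0 < t by rewrite lt_neqAle eq_sym t0.
  have {tT tT'}tT : t < T by rewrite lt_neqAle tT.
  have [|l dl lS] := H; first by rewrite in_itv/= t0.
  apply: cvg_EFin; first exact: nearW.
  apply/cvgrPdist_le => e e0.
  have : (fun h => h^-1 *: ((Y \o shift t) (h *: 1) - Y t)) @ 0^' --> l.
    by have [] := dl => dt <-; exact: dt.
  move=> /cvgrPdist_le/(_ e e0)/nbhs_ballP[r /= r0 Hr].
  have Tt : 0 < T - t by rewrite subr_gt0.
  near=> k.
  have hr : h k < r by near: k; exact: near_infty_natSinv_lt (PosNum r0).
  have hT : h k < T - t.
    by near: k; exact: near_infty_natSinv_lt (PosNum Tt).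
  have := Hr (h k); rewrite /ball/= sub0r normrN (gtr0_norm (h0 k)) =>
    /(_ hr (lt0r_neq0 (h0 k))).
  rewrite [h k *: 1]mulr1 /GRing.scale/= (addrC (h k)).
  have -> : (h k)^-1 * (Y (t + h k) - Y t) = q k t.
    have := h0 k; move: t0 tT hT => ? ? ? ?.
    by rewrite /q /Z !clamp_id//; apply/andP; split; clear aeY dl Hr; lra.
  rewrite ler_norml => /andP[h1 h2].
  rewrite /cst sub0r normrN /g; case: (leP (q k t - S t - eps) 0) => h3.
    by rewrite normr0 ltW.
  by rewrite gtr0_norm//; lra.
have dom_g : {ae cleb, forall (t : R) k, `[0, T]%classic t ->
    (`|(EFin \o g k) t| <= (EFin \o cst (L + K + eps)%R) t)%E}.
  apply: (@aeW _ _ _ cleb) => t k; rewrite /= in_itv/= lee_fin; exact: gb.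
have [_ _ cvgI] := @dominated_convergence _ _ _ cleb _ mD (fun k => EFin \o g k) (cst 0%E)
  (EFin \o cst (L + K + eps))
  (fun k => measurable_int _ (ig k)) (measurable_cst _) cvg_g (icst _) dom_g.
have {}cvgI : (\int[cleb]_(t in `[0, T]) g k t)%R @[k --> \oo] --> (0 : R).
  apply: fine_cvg; move: cvgI; rewrite integral0; exact.
have main k : Z T - Z 0 - L * h k <= \int[cleb]_(t in `[0,
  T]) S t + eps * T + \int[cleb]_(t in `[0, T]) g k t.
  apply: le_trans (integral_difference_quotient T0 L0 (h0 k) ZL ZT) _.
  rewrite -(@Rintegral_completed_continuous (q k) T T0' (cq k)).
  have -> : eps * T = \int[cleb]_(t in `[0, T]) cst eps t.
    by rewrite Rintegral_cst// [X in fine X](completed_itv T0')/= subr0.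
  rewrite -RintegralD// -RintegralD//; last first.
    exact: integrableD (iS) (icst eps).
  apply: le_Rintegral => //.
    exact: integrableD (integrableD mD iS (icst eps)) (ig k).
  by move=> t _; rewrite /g /cst; case: (leP (q k t - S t - eps) 0) => ?; lra.
have hcvg : (Z T - Z 0 - L * h k) @[k --> \oo] --> Z T - Z 0 - L * 0.
  by apply: cvgB; [exact: cvg_cst|apply: cvgM; [exact: cvg_cst|exact: cvg_harmonic]].
have gcvg : (\int[cleb]_(t in `[0, T]) S t + eps * T + \int[cleb]_(t in `[0,
  T]) g k t) @[k --> \oo]
    --> \int[cleb]_(t in `[0, T]) S t + eps * T + 0.
  by apply: cvgD => //; exact: cvg_cst.
rewrite mulr0 subr0 in hcvg; rewrite addr0 in gcvg.
by apply: (ler_cvg_to hcvg gcvg); exact: nearW.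
Unshelve. all: by end_near.
Qed.

End lipschitz_increment.

(** * Finite quadrature on a compact set *)

Section borel_quadrature.
Context {R : realType} (V : normedModType R).
Local Notation BT := (g_sigma_algebraType (@open V)).

Lemma borel_open (D : set V) : open D -> measurable (D : set BT).
Proof. by move=> oD; apply: sub_sigma_algebra. Qed.

Lemma borel_compact (D : set V) : compact D -> measurable (D : set BT).
Proof.
move=> cD; rewrite -(setCK D); apply: measurableC; apply: borel_open.
by apply: closed_openC; apply: compact_closed => //; exact: norm_hausdorff.
Qed.

Lemma within_continuous_borel (D : set V) (f : V -> R) : measurable (D : set BT) ->
  {within D, continuous f} -> measurable_fun (D : set BT) f.
Proof.
move=> mD /continuousP cf; apply: (measurability _ (RGenOpens.measurableE R)).
move=> _ [_ [a [b ->] <-]].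
have := cf `]a, b[%classic (@interval_open _ (BRight a) (BLeft b) isT isT).
move=> /open_subspaceP[Q oQ QE].
rewrite setIC -QE setIC; apply: measurableI => //; exact: borel_open.
Qed.

Lemma within_continuous_integrable (D : set V) (mu : probability BT R) (f : V -> R) :
  compact D -> {within D, continuous f} -> mu.-integrable (D : set BT) (EFin \o f).
Proof.
move=> cD cf; have mD := borel_compact cD.
apply: measurable_bounded_integrable => //.
- by rewrite (le_lt_trans (probability_le1 _ _))// ltry.
- exact: within_continuous_borel.
- have /compact_bounded[M [Mr HM]] := continuous_compact cf cD.
  by exists M; split => // x /HM h y Dy; apply: h; exists y.
Qed.

(** A finite subcover by open sets on which [P (w k)] holds is made disjoint by removing the earlier
    sets from each one, which keeps the cells measurable. *)
Lemma compact_finite_partition (D : set V) (P : V -> V -> Prop) : compact D ->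
  (forall w0, D w0 -> \forall w \near within D (nbhs w0), P w0 w) ->
  exists N (w : nat -> V) (E : nat -> set V),
  [/\ forall k, (k < N)%N -> D (w k),
      forall k, measurable (E k : set BT),
      trivIset setT E,
      D = \big[setU/set0]_(k < N) E k &
      forall k v, (k < N)%N -> E k v -> P (w k) v].
Proof.
move=> cD HP; have mD := borel_compact cD.
have nb w0 : exists Q : set V, open Q /\ (D w0 -> Q w0 /\ forall v, Q v -> D v -> P w0 v).
  have [Dw|nD] := pselect (D w0); last by exists set0; split => //; exact: open0.
  have : nbhs w0 (fun v => D v -> P w0 v) := HP w0 Dw.
  rewrite nbhsE => -[Q [oQ Qw] QP]; exists Q; split => // _; split => //.
have [Q HQ] := choice nb.
move: (cD); rewrite compact_cover => /(_ V D Q)[].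
- by move=> i _; have [] := HQ i.
- by move=> v Dv; exists v => //; have [_ /(_ Dv)[]] := HQ v.
move=> D' D'D Dcov.
pose s := (finmap.enum_fset D' : seq V).
pose w k := nth 0 s k.
pose G k := D `&` Q (w k).
have mG k : measurable (G k : set BT).
  by apply: measurableI => //; apply: borel_open; have [] := HQ (w k).
have Dw k : (k < size s)%N -> D (w k).
  by move=> ks; apply/set_mem; apply: D'D; exact: mem_nth.
exists (size s), w, (seqDU G); split => //.
- exact: seqDU_measurable.
- rewrite -bigsetU_seqDU; apply/seteqP; split => v.
    move=> Dv; have [v0 /= v0D' Ov] := Dcov v Dv.
    rewrite -bigcup_mkord; exists (index v0 s); first by rewrite /= index_mem.
    by split => //; rewrite /w nth_index.
  by rewrite -(bigcup_mkord _ G) => -[k _ []].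
- move=> k v ks Ekv; have [Dv Qv] : G k v by exact: (@subset_seqDU _ G k v Ekv).
  by have [_ /(_ (Dw k ks))[_]] := HQ (w k); exact.
Qed.

(* A finite quadrature rule replaces Fubini's theorem: it approximates
   expectations uniformly over families equicontinuous in w. *)
Lemma finite_quadrature (D : set V) (mu : probability BT R) (P : V -> V -> Prop) :
  compact D -> mu D = 1%E ->
  (forall w0, D w0 -> \forall w \near within D (nbhs w0), P w0 w) ->
  exists N (w : 'I_N -> V) (c : 'I_N -> R),
  [/\ forall k, D (w k), forall k, 0 <= c k, \sum_k c k = 1 &
    forall (f : V -> R) e, {within D, continuous f} ->
      (forall w0 w1, D w0 -> D w1 -> P w0 w1 -> `|f w1 - f w0| <= e) ->
      `|\int[mu]_(v in D) f v - \sum_k c k * f (w k)| <= e].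
Proof.
move=> cD muD /(compact_finite_partition cD)[N [w [E [Dw mE tE DE EP]]]].
pose c (k : 'I_N) := fine (mu (E k)).
have muE k : mu (E k) = (fine (mu (E k)))%:E.
  by rewrite fineK// ge0_fin_numE// (le_lt_trans (probability_le1 _ _))// ltry.
have c0 k : 0 <= c k by rewrite fine_ge0.
have c1 : \sum_k c k = 1.
  apply: EFin_inj; rewrite -sumEFin -muD [in RHS]DE measure_semi_additive_ord//.
  - by apply: eq_bigr => k _; exact/esym/muE.
  - by move=> i j _ _ ij; apply/val_inj; exact: tE ij.
  - exact: bigsetU_measurable.
exists N, (fun k => w k), c; split => //; first by move=> k; exact: Dw.
move=> f e cf fP.
have fi := within_continuous_integrable mu cD cf.
have mD := borel_compact cD.
have ED (k : 'I_N) : E k `<=` D.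
  by rewrite [in X in _ `<=` X]DE -(bigcup_mkord N E) => v Ev; exists (k : nat) => //=.
have fiE (k : 'I_N) : mu.-integrable (E k : set BT) (EFin \o f).
  exact: integrableS mD (mE k) (ED k) fi.
have -> : \int[mu]_(v in D) f v = \sum_(k < N) \int[mu]_(v in E k) f v.
  rewrite /Rintegral [in LHS]DE -(big_mkord xpredT E) integral_bigsetU_EFin//.
  - rewrite big_mkord sum_fine// => k _; apply: integrable_fin_num => //; exact: fiE.
  - by rewrite iota_uniq.
  - exact: sub_trivIset tE.
  - by rewrite big_mkord -DE; case/integrableP : fi.
rewrite -sumrB; apply: le_trans (ler_norm_sum _ _ _) _.
rewrite -[e]mul1r -c1 mulr_suml; apply: ler_sum => k _.
have icst (r : R) : mu.-integrable (E k : set BT) (EFin \o cst r).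
  exact: finite_measure_integrable_cst.
have -> : c k * f (w k) = \int[mu]_(v in E k) cst (f (w k)) v.
  by rewrite Rintegral_cst// mulrC.
rewrite -RintegralB//.
apply: le_trans (le_normr_Rintegral _ _) _ => //.
  exact: (integrableB (mE k) (fiE k) (icst _)).
have -> : c k * e = \int[mu]_(v in E k) cst e v by rewrite Rintegral_cst// mulrC.
apply: le_Rintegral => //.
  exact: (integrable_norm (integrableB (mE k) (fiE k) (icst _))).
move=> v Ev; apply: fP; [exact: Dw|exact: ED Ev|exact: EP].
Qed.
End borel_quadrature.

(** * State and adjoint estimates *)

Section linear_ode.
Context {R : realType}.

Lemma solves_ode_ext n (T : R) (g g' : R -> 'cV[R]_n -> 'cV[R]_n) y :
  (forall t z, g t z = g' t z) -> solves_ode T g y -> solves_ode T g' y.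
Proof. by move=> E; rewrite (_ : g' = g)//; apply/funext => t; apply/funext => z. Qed.

Variables (n : nat) (T a c : R) (M : R -> 'M[R]_n) (b : R -> 'cV[R]_n) (y : R ->
  'cV[R]_n).
Hypotheses (a0 : 0 <= a) (c0 : 0 <= c)
  (Ma : forall t : R, t \in `[0, T] -> spec_norm (M t) <= a)
  (bc : forall t : R, t \in `[0, T] -> enorm (b t) <= c)
  (ode : solves_ode T (fun t z => M t *m z + b t) y).

(** With the initial value the bound has the shape of [M_X]; with the final value, which vanishes
    for the adjoint, that of [M_P]. *)
Lemma linear_ode_bound t : 0 <= t -> t <= T ->
  enorm (y t) <= (enorm (y 0) + T * c) * expR (T * a) /\
  enorm (y t) <= (enorm (y T) + T * c) * expR (T * a).
Proof.
move=> t0 tT; have [yac dy] := ode.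
have dy' : {ae lebesgue_measure, forall t : R, t \in `]0, T[ ->
    exists2 l, is_derive t 1 y l & enorm l <= a * enorm (y t) + c}.
  move: dy; apply: filterS; first exact: (ae_filter_ringOfSetsType lebesgue_measure).
  move=> s H sT; exists (M s *m y s + b s); first exact: H.
  have sT' : s \in `[0, T] by exact: subset_itv_oo_cc.
  apply: le_trans (ler_enormD _ _) _; apply: lerD; last exact: bc.
  apply: le_trans (le_spec_norm _ _) _; rewrite ler_wpM2r ?enorm_ge0//; exact: Ma.
have key s v : 0 <= s -> s <= T -> 
   expR (a * s) * (enorm v + c * s) <= (enorm (v : 'cV[R]_n) + T * c) * expR (T * a).
  move=> s0 sT; rewrite [leRHS]mulrC; apply: ler_pM; first exact: expR_ge0.
  - by apply: addr_ge0; [exact: enorm_ge0|exact: mulr_ge0].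
  - by rewrite ler_expR mulrC ler_wpM2r.
  - by rewrite lerD2l mulrC ler_wpM2r.
have [h1 _] := gronwall a0 c0 yac dy' (lexx 0) t0 tT.
have [_ h2] := gronwall a0 c0 yac dy' t0 tT (lexx T).
rewrite subr0 in h1; split; [apply: le_trans h1 _|apply: le_trans h2 _]; apply: key => //.
- by rewrite subr_ge0.
- by rewrite lerBlDr lerDl.
Qed.

(** Gronwall's inequality with growth rate 0, applied to [y r - y s], acts as the mean value
    inequality for absolutely continuous functions. *)
Lemma linear_ode_lipschitz K s t : (forall r : R, 0 <= r <= T -> enorm (y r) <= K) ->
  0 <= s <= T -> 0 <= t <= T -> enorm (y t - y s) <= (a * K + c) * `|t - s|.
Proof.
move=> yK; wlog st : s t / s <= t.
  move=> H hs ht; have /orP[st|ts] := le_total s t; first exact: H.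
  by rewrite -enormN opprB distrC; exact: H.
move=> /andP[s0 sT] /andP[t0 tT]; have [yac dy] := ode.
have K0 : 0 <= K by apply: le_trans (yK s _); rewrite ?enorm_ge0 ?s0.
have c'0 : 0 <= a * K + c by rewrite addr_ge0 ?mulr_ge0.
have yac' : abs_continuous 0 T (fun r => y r - y s).
  apply: (@small_increments_le _ 0 T 1 (fun s0 r =>
    enorm (y r - y s - (y s0 - y s))) (fun s r => enorm (y r - y s)) ltr01 _ yac) =>
    r r' _ rr _.
  by rewrite opprB addrA subrK mul1r lerDl subr_ge0.
have dy' : {ae lebesgue_measure, forall t : R, t \in `]0, T[ ->
    exists2 l, is_derive t 1 (fun r => y r - y s) l & enorm l <=
      0 * enorm (y t - y s) + (a * K + c)}.
  move: dy; apply: filterS; first exact: (ae_filter_ringOfSetsType lebesgue_measure).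
  move=> r H rT; exists (M r *m y r + b r - 0).
    exact: (is_deriveB (H rT) (is_derive_cst _ _ _)).
  have rT' : r \in `[0, T] by exact: subset_itv_oo_cc.
  rewrite subr0 mul0r add0r.
  apply: le_trans (ler_enormD _ _) _; apply: lerD; last exact: bc.
  apply: le_trans (le_spec_norm _ _) _; apply: ler_pM;
    rewrite ?enorm_ge0 ?spec_norm_ge0//; first exact: Ma.
  by apply: yK; move: rT'; rewrite in_itv.
have [+ _] := gronwall (lexx 0) c'0 yac' dy' s0 st tT.
by rewrite mul0r expR0 mul1r subrr enorm0 add0r (ger0_norm (_ : 0 <= t - s))// subr_ge0.
Qed.

End linear_ode.

Section problem_estimates.
Context {R : realType} {m n d d' : nat} (P : problem R m n d d') (HP :
  standing_assumptions P).
Local Notation T := (ps_T P).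
Local Notation A := (ps_A P).
Local Notation B := (ps_B P).
Local Notation U := (ps_U P).
Local Notation C := (ps_C P).
Local Notation FF := (ps_FF P).
Local Notation Om := (ps_Omega P).
Local Notation al := (ps_alpha P).
Local Notation be := (ps_beta P).

Let T0 : 0 < T. Proof. exact: (T_gt0 HP). Qed.
Let MA0 : 0 <= ps_M_A P. Proof. exact/ltW/(M_A_gt0 HP). Qed.
Let MB0 : 0 <= ps_M_B P. Proof. exact/ltW/(M_B_gt0 HP). Qed.

Lemma A_le t w u : t \in `[0, T] -> Om w -> U u -> spec_norm (A t w u) <= ps_M_A P.
Proof. by move=> tT /(Omega_sub HP) Ow Uu; apply: (M_A_bound HP (z := (t, w, u))). Qed.

Lemma B_le t w u : t \in `[0, T] -> Om w -> U u -> enorm (B t w u) <= ps_M_B P.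
Proof. by move=> tT /(Omega_sub HP) Ow Uu; apply: (M_B_bound HP (z := (t, w, u))). Qed.

Lemma FF_le w t : Om w -> enorm (FF w t) <= ps_M_Omega' P.
Proof.
move=> /(Omega_sub HP) Ow; apply: le_trans (supnorm_ub _ _) _.
exact: (M_Omega'_bound HP (FF_range HP Ow)).
Qed.

Lemma x0_continuous w : Om w -> {for w, continuous (ps_x0 P)}.
Proof.
by move=> /(Omega_sub HP) Ow; apply: differentiable_continuous; exact: (x0_C1 HP).1.
Qed.

Lemma FF_continuous w : Om w -> {for w, continuous FF}.
Proof.
by move=> /(Omega_sub HP) Ow; apply: differentiable_continuous; exact: (FF_C1 HP).1.
Qed.

Lemma x0_le w : Om w -> enorm (ps_x0 P w) <= sup [set enorm (ps_x0 P w) | w in Om].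
Proof.
move=> Ow; apply: ub_le_sup; last by exists w.
have cx : {within Om, continuous (ps_x0 P)}.
  apply: continuous_in_subspaceT => v; rewrite inE; exact: x0_continuous.
have /compact_bounded[K [Kr HK]] := continuous_compact cx (Omega_compact HP).
exists (Num.sqrt n%:R * (K + 1)) => _ [v Ov <-].
apply: le_trans (enorm_le _) _; rewrite ler_wpM2l ?sqrtr_ge0//.
by apply: (HK (K + 1)); [rewrite ltrDl|exists v].
Qed.

Lemma M_X_ge0 : 0 <= M_X P.
Proof.
have [w Ow] := Omega_neq0 HP; rewrite /M_X; apply: mulr_ge0; last exact: expR_ge0.
apply: addr_ge0; last by rewrite mulr_ge0// ltW.
exact: le_trans (enorm_ge0 _) (x0_le Ow).
Qed.

(** A bound for the source term of the adjoint equation; [M_P] is this constant times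
    [T * expR (T * M_A)]. *)
Definition adjoint_forcing : R := 2 * al * spec_norm C * (spec_norm C * M_X P +
  ps_M_Omega' P).

Lemma adjoint_forcing_ge0 : 0 <= adjoint_forcing.
Proof.
have al0 := ltW (alpha_gt0 HP); have mo := ltW (M_Omega'_gt0 HP).
have C0 := spec_norm_ge0 C; have X0 := M_X_ge0.
rewrite /adjoint_forcing; apply: mulr_ge0; first by rewrite !mulr_ge0.
by rewrite addr_ge0// mulr_ge0.
Qed.

Lemma M_P_ge0 : 0 <= M_P P.
Proof.
have := adjoint_forcing_ge0; rewrite /adjoint_forcing /M_P => h.
have -> : 2 * al * T * spec_norm C * (spec_norm C * M_X P + ps_M_Omega' P) * expR (T *
  ps_M_A P) =
  T * (2 * al * spec_norm C * (spec_norm C * M_X P + ps_M_Omega' P)) * expR (T * ps_M_A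
    P) by ring.
by apply: mulr_ge0; [apply: mulr_ge0; [exact: ltW|exact: h]|exact: expR_ge0].
Qed.

Section state.
Variables (u : R -> 'cV[R]_m) (x : R -> cpath T d -> 'cV[R]_n).
Hypotheses (uU : forall t : R, t \in `[0, T] -> U (u t)) (ux : is_state P u x).

Lemma state_le t w : Om w -> t \in `[0, T] -> enorm (x t w) <= M_X P.
Proof.
move=> Ow; rewrite in_itv/= => /andP[t0 tT]; have [ode xi] := ux Ow.
have [h _] := linear_ode_bound MA0 MB0 (fun s sT => A_le sT Ow (uU sT)) (fun s sT =>
  B_le sT Ow (uU sT)) ode t0 tT.
apply: le_trans h _; rewrite /M_X ler_wpM2r ?expR_ge0// lerD2r xi; exact: x0_le.
Qed.

Lemma state_lipschitz s t w : Om w -> 0 <= s <= T -> 0 <= t <= T ->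
  enorm (x t w - x s w) <= (ps_M_A P * M_X P + ps_M_B P) * `|t - s|.
Proof.
move=> Ow hs ht; have [ode xi] := ux Ow.
apply: (linear_ode_lipschitz (y := x^~ w) MA0 MB0 (fun s sT =>
  A_le sT Ow (uU sT)) (fun s sT => B_le sT Ow (uU sT)) ode) => // r hr.
by apply: state_le => //; rewrite in_itv.
Qed.

Variable p : R -> cpath T d -> 'cV[R]_n.
Hypothesis uxp : is_adjoint P u x p.

Lemma residual_le t w : Om w -> t \in `[0, T] ->
  enorm (C *m x t w - FF w t) <= spec_norm C * M_X P + ps_M_Omega' P.
Proof.
move=> Ow tT; apply: le_trans (ler_enormD _ _) _; rewrite enormN; apply: lerD;
  last exact: FF_le.
by apply: le_trans (le_spec_norm _ _) _; rewrite ler_wpM2l ?spec_norm_ge0 ?state_le.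
Qed.

Lemma adjoint_forcing_le t w : Om w -> t \in `[0, T] ->
  enorm ((2 * al) *: (C^T *m (C *m x t w - FF w t))) <= adjoint_forcing.
Proof.
move=> Ow tT; have al0 := ltW (alpha_gt0 HP).
rewrite enormZ ger0_norm ?mulr_ge0// /adjoint_forcing -mulrA ler_wpM2l ?mulr_ge0//.
apply: le_trans (le_spec_norm _ _) _; apply: ler_pM; rewrite ?spec_norm_ge0 ?enorm_ge0//.
  exact: spec_norm_tr.
exact: residual_le.
Qed.

Lemma adjoint_ode w : Om w ->
  solves_ode T (fun t q => (- (A t w (u t))^T) *m q + (2 * al) *: (C^T *m (C *m x t w -
    FF w t))) (p^~ w).
Proof.
by move=> Ow; have [ode _] := uxp Ow; apply: solves_ode_ext ode => t z; rewrite mulNmx.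
Qed.

Lemma adjoint_matrix_le t w : Om w -> t \in `[0, T] ->
  spec_norm (- (A t w (u t))^T) <= ps_M_A P.
Proof.
move=> Ow tT; rewrite -scaleN1r spec_normZ normrN1 mul1r.
by apply: le_trans (spec_norm_tr _) _; apply: A_le => //; exact: uU.
Qed.

Lemma adjoint_le t w : Om w -> t \in `[0, T] -> enorm (p t w) <= M_P P.
Proof.
move=> Ow; rewrite in_itv/= => /andP[t0 tT].
have [_ h] := linear_ode_bound (y := p^~ w) MA0 adjoint_forcing_ge0 (fun s sT =>
  adjoint_matrix_le Ow sT)
  (fun s sT => adjoint_forcing_le Ow sT) (adjoint_ode Ow) t0 tT.
have [_ pT] := uxp Ow.
apply: le_trans h _; rewrite pT enorm0 add0r /M_P /adjoint_forcing.
rewrite le_eqVlt; apply/orP; left; apply/eqP; ring.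
Qed.

Lemma adjoint_lipschitz s t w : Om w -> 0 <= s <= T -> 0 <= t <= T ->
  enorm (p t w - p s w) <= (ps_M_A P * M_P P + adjoint_forcing) * `|t - s|.
Proof.
move=> Ow hs ht.
apply: (linear_ode_lipschitz (y := p^~ w) MA0 adjoint_forcing_ge0 (fun s sT =>
  adjoint_matrix_le Ow sT)
  (fun s sT => adjoint_forcing_le Ow sT) (adjoint_ode Ow)) => // r hr.
by apply: adjoint_le => //; rewrite in_itv.
Qed.

End state.
End problem_estimates.

(** * Continuity in omega, uniform in time *)

Section problem_continuity.
Context {R : realType} {m n d d' : nat} (P : problem R m n d d') (HP :
  standing_assumptions P).
Local Notation T := (ps_T P).
Local Notation A := (ps_A P).
Local Notation B := (ps_B P).
Local Notation U := (ps_U P).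
Local Notation C := (ps_C P).
Local Notation FF := (ps_FF P).
Local Notation Om := (ps_Omega P).
Local Notation al := (ps_alpha P).
Local Notation be := (ps_beta P).
Local Notation near_Om w := (within Om (nbhs w)).
Local Notation D := (`[0, T]%classic : set R).

Let T0 : 0 < T. Proof. exact: (T_gt0 HP). Qed.
Let MA0 : 0 <= ps_M_A P. Proof. exact/ltW/(M_A_gt0 HP). Qed.

Lemma near_Om_Om (w0 : cpath T d) : \forall w \near near_Om w0, Om w.
Proof. exact: withinT. Qed.

(** The control may be discontinuous in time. [tube_lemma] gives an estimate uniform over all values
    in the compact set [U], which is then read at [u t]. *)
Lemma A_ulim u (w0 : cpath T d) : Om w0 -> (forall t, D t -> U (u t)) ->
  mxulim (near_Om w0) D (fun w t => A t w (u t)) (fun t => A t w0 (u t)).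
Proof.
move=> Ow0 uU; apply: (@normr_mxulim _ _ _ _ _ _ _ _ _ _ (ps_M_A P)).
  move=> t j k Dt; apply: le_trans (coord_le_spec_norm _ _ _) _.
  by apply: (A_le HP) => //; exact: uU.
move=> e e0.
have Ac : {within D `*` Om `*` U, continuous (fun z => A z.1.1 z.1.2 z.2)}.
  by apply: continuous_subspaceW (A_continuous HP) => -[[t w] v] /= [[Dt Ow] Uv];
    split => //; split => //; exact: (Omega_sub HP).
have H := tube_lemma (@segment_compact R 0 T) (U_compact HP) Ow0 Ac e0.
by apply: filterS H => w H t Dt; exact: H (uU t Dt).
Qed.

Lemma B_ulim u (w0 : cpath T d) : Om w0 -> (forall t, D t -> U (u t)) ->
  mxulim (near_Om w0) D (fun w t => B t w (u t)) (fun t => B t w0 (u t)).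
Proof.
move=> Ow0 uU; apply: (@normr_mxulim _ _ _ _ _ _ _ _ _ _ (ps_M_B P)).
  move=> t j k Dt; rewrite (ord1 k); apply: le_trans (coord_le_enorm _ _) _.
  by apply: (B_le HP) => //; exact: uU.
move=> e e0.
have Bc : {within D `*` Om `*` U, continuous (fun z => B z.1.1 z.1.2 z.2)}.
  by apply: continuous_subspaceW (B_continuous HP) => -[[t w] v] /= [[Dt Ow] Uv];
    split => //; split => //; exact: (Omega_sub HP).
have H := tube_lemma (@segment_compact R 0 T) (U_compact HP) Ow0 Bc e0.
by apply: filterS H => w H t Dt; exact: H (uU t Dt).
Qed.

Lemma FF_ulim (w0 : cpath T d) : Om w0 -> mxulim (near_Om w0) D (fun w t =>
  FF w t) (fun t => FF w0 t).
Proof.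
move=> Ow0; apply: (@enorm_mxulim _ _ _ _ _ _ _ _ _ (ps_M_Omega' P)).
  by move=> t _; exact: FF_le.
move=> e e0; have /cvgrPdist_le/(_ e e0) H := FF_continuous HP Ow0.
have H' : \forall w \near near_Om w0, `|FF w0 - FF w| <= e by apply: cvg_within H.
apply: filterS H' => w; rewrite distrC => h t _; apply: le_trans h.
by have := supnorm_ub (FF w - FF w0) t.
Qed.

Lemma x0_lim (w0 : cpath T d) (e : R) : Om w0 -> 0 < e ->
  \forall w \near near_Om w0, enorm (ps_x0 P w - ps_x0 P w0) <= e.
Proof.
move=> Ow0 e0; pose c : R := Num.sqrt n%:R + 1.
have c0 : 0 < c by rewrite ltr_wpDl ?sqrtr_ge0.
have e'0 : 0 < e / c by rewrite divr_gt0.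
have /cvgrPdist_le/(_ _ e'0) H := x0_continuous HP Ow0.
have H' : \forall w \near near_Om w0, `|ps_x0 P w0 - ps_x0 P w| <=
  e / c by apply: cvg_within H.
apply: filterS H' => w h; apply: le_trans (enorm_le _) _.
rewrite distrC in h; apply: (@le_trans _ _ (c * (e / c)));
  last by rewrite mulrC divfK// gt_eqF.
by rewrite ler_pM ?sqrtr_ge0// /c lerDl.
Qed.

Section solutions.
Variables (u : R -> 'cV[R]_m) (x p : R -> cpath T d -> 'cV[R]_n).
Hypotheses (uU : forall t : R, t \in `[0, T] -> U (u t)) (ux : is_state P u x) (uxp :
  is_adjoint P u x p).

Lemma state_ulim (w0 : cpath T d) : Om w0 -> mxulim (near_Om w0) D (fun w t =>
  x t w) (fun t => x t w0).
Proof.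
move=> Ow0; have [ode0 xi0] := ux Ow0.
apply: (@linear_ode_stability _ _ _ _ _ T (ps_M_A P) 0 (fun w t =>
  A t w (u t)) (fun t => A t w0 (u t))
  (fun w t => B t w (u t)) (fun t => B t w0 (u t)) (fun w t => x t w) (fun t =>
    x t w0)) => //.
- by left.
- by apply: filterS (near_Om_Om w0) => w Ow t tT; apply: (A_le HP) => //; exact: uU.
- by apply: filterS (near_Om_Om w0) => w Ow; have [] := ux Ow.
- exact: A_ulim.
- exact: B_ulim.
- move=> e e0; apply: filterS2 (near_Om_Om w0) (x0_lim Ow0 e0) => w Ow.
  by have [_ ->] := ux Ow; rewrite xi0.
Qed.

Lemma residual_ulim (w0 : cpath T d) : Om w0 ->
  mxulim (near_Om w0) D (fun w t => C *m x t w - FF w t) (fun t => C *m x t w0 - FF w0 t).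
Proof.
move=> Ow0; apply: mxulimD; last by apply: mxulimN; exact: FF_ulim.
by apply: mxulimM; [exact: mxulim_const|exact: state_ulim].
Qed.

Lemma adjoint_ulim (w0 : cpath T d) : Om w0 -> mxulim (near_Om w0) D (fun w t =>
  p t w) (fun t => p t w0).
Proof.
move=> Ow0; have [_ pT0] := uxp Ow0.
apply: (@linear_ode_stability _ _ _ _ _ T (ps_M_A P) T (fun w t =>
  - (A t w (u t))^T) (fun t => - (A t w0 (u t))^T)
  (fun w t => (2 * al) *: (C^T *m (C *m x t w - FF w t))) (fun t =>
    (2 * al) *: (C^T *m (C *m x t w0 - FF w0 t)))
  (fun w t => p t w) (fun t => p t w0)) => //.
- by right.
- by apply: filterS (near_Om_Om w0) => w Ow t tT; exact: (adjoint_matrix_le HP uU).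
- by apply: filterS (near_Om_Om w0) => w Ow; exact: adjoint_ode.
- exact: adjoint_ode.
- by apply: mxulimN; apply: mxulim_tr; exact: A_ulim.
- apply: mxulimZ; apply: mxulimM; first exact: mxulim_const.
  exact: residual_ulim.
- move=> e e0; apply: filterS (near_Om_Om w0) => w Ow.
  by have [_ ->] := uxp Ow; rewrite pT0 subrr enorm0 ltW.
Qed.

Lemma state_cost_ulim (w0 : cpath T d) : Om w0 ->
  ulim (near_Om w0) D (fun w t => al * enorm (C *m x t w - FF w t) ^+ 2)
    (fun t => al * enorm (C *m x t w0 - FF w0 t) ^+ 2).
Proof.
move=> Ow0; apply: ulimM; first by apply: (@ulim_cst _ _ _ _ _ _ _ `|al|).
apply: (@ulim_ext _ _ _ _ _ (fun w t => dotv (C *m x t w - FF w t) (C *m x t w - FF w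
  t)) _
  (fun t => dotv (C *m x t w0 - FF w0 t) (C *m x t w0 - FF w0 t))).
- by move=> w t; rewrite enorm_sqr.
- by move=> t; rewrite enorm_sqr.
- by apply: ulim_dotv; exact: residual_ulim.
Qed.

Lemma hamiltonian_ulim v (w0 : cpath T d) : Om w0 -> (forall t, D t -> U (v t)) ->
  ulim (near_Om w0) D (fun w t => dotv (p t w) (A t w (v t) *m x t w + B t w (v t)))
    (fun t => dotv (p t w0) (A t w0 (v t) *m x t w0 + B t w0 (v t))).
Proof.
move=> Ow0 vU; apply: ulim_dotv; first exact: adjoint_ulim.
apply: mxulimD; last exact: B_ulim.
by apply: mxulimM; [exact: A_ulim|exact: state_ulim].
Qed.

End solutions.

Lemma ulim_within_continuous (f : cpath T d -> R -> R) t : D t ->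
  (forall w0, Om w0 -> ulim (near_Om w0) D f (f w0)) -> {within Om, continuous (f ^~ t)}.
Proof.
move=> Dt H; apply/subspace_continuousP => w0 Ow0; apply/cvgrPdist_le => e e0.
by apply: filterS ((H w0 Ow0).1 e e0) => w /(_ t Dt); rewrite distrC.
Qed.

End problem_continuity.

(** * Duality and concavity of the Hamiltonian *)

Section duality.
Context {R : realType} {m n d d' : nat} (P : problem R m n d d') (HP :
  standing_assumptions P).
Local Notation T := (ps_T P).
Local Notation A := (ps_A P).
Local Notation B := (ps_B P).
Local Notation U := (ps_U P).
Local Notation C := (ps_C P).
Local Notation FF := (ps_FF P).
Local Notation Om := (ps_Omega P).
Local Notation al := (ps_alpha P).
Local Notation be := (ps_beta P).
Local Notation mu := (ps_mu P).
Local Notation near_Om w := (within Om (nbhs w)).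
Local Notation D := (`[0, T]%classic : set R).

Variables (us : R -> 'cV[R]_m) (xs ps : R -> cpath T d -> 'cV[R]_n).
Hypotheses (usU : forall t : R, t \in `[0, T] -> U (us t)) (usx : is_state P us xs)
  (usp : is_adjoint P us xs ps).

Lemma half_sqr_le (Halpha : 1 / (2 * lambda_min (C^T *m C)) < al) (v : 'cV[R]_n) :
  enorm v ^+ 2 / 2 <= al * enorm (C *m v) ^+ 2.
Proof.
have al0 := ltW (alpha_gt0 HP).
(* In dimension zero there are no eigenvalues and [lambda_min] is the infimum of the empty set, but
   then [v] has norm 0. *)
have [n0|n0] := posnP n.
  have -> : enorm v = 0.
    rewrite /enorm /dotv big1 ?sqrtr0// => i _.
    by have := ltn_ord i; rewrite [X in (_ < X)%N]n0.
  by rewrite expr0n mul0r mulr_ge0// sqr_ge0.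
have [l0 Hl] := lambda_min_gram (C_full_column_rank HP) n0.
set l := lambda_min _ in l0 Hl Halpha.
rewrite ltr_pdivrMr ?mulr_gt0// in Halpha.
have h1 := Hl v; have h2 := sqr_ge0 (enorm v).
apply: (@le_trans _ _ (al * (l * enorm v ^+ 2))); last exact: ler_wpM2l.
rewrite mulrA mulrC ler_wpM2r// ; lra.
Qed.

Section competitor.
Variables (v : R -> 'cV[R]_m) (z : R -> cpath T d -> 'cV[R]_n).
Hypotheses (vU : forall t : R, t \in `[0, T] -> U (v t)) (vz : is_state P v z).

Lemma duality_ae (Halpha : 1 / (2 * lambda_min (C^T *m C)) < al) w : Om w ->
  {ae lebesgue_measure, forall t : R, t \in `]0, T[ ->
    exists2 l, is_derive t 1 (fun t => dotv (ps t w) (z t w - xs t w)) l &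
      l <= al * enorm (C *m z t w - FF w t) ^+ 2 - al * enorm (C *m xs t w - FF w t) ^+ 2
        - (dotv (ps t w) (A t w (us t) *m xs t w + B t w (us t))
            - dotv (ps t w) (A t w (v t) *m xs t w + B t w (v t)))
        + M_P P ^+ 2 * G_A P ^+ 2 / 2 * enorm (v t - us t) ^+ 2}.
Proof.
move=> Ow; have [[_ xode] _] := usx Ow; have [[_ pode] _] := usp Ow;
  have [[_ zode] _] := vz Ow.
have aeF := ae_filter_ringOfSetsType (@lebesgue_measure R).
apply: (@filterS3 _ (almost_everywhere lebesgue_measure) aeF _ _ _ _ _ xode pode zode).
move=> t Hx Hp Hz tT; have tD : t \in `[0, T] by exact: subset_itv_oo_cc.
have := is_derive_dotv (Hp tT) (is_deriveB (Hz tT) (Hx tT)).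
set p := ps t w; set x := xs t w; set zz := z t w; set F := FF w t.
set As := A t w (us t); set Av := A t w (v t); set Bs := B t w (us t);
  set Bv := B t w (v t).
move=> dy; eexists; first exact: dy.
pose dx := zz - x; pose r := C *m x - F.
have CE : C *m zz - F = C *m dx + r by rewrite /dx /r mulmxBr addrA subrK.
have E1 : enorm (C *m zz - F) ^+ 2 = enorm (C *m dx) ^+ 2 + 2 * dotv r (C *m dx) +
  enorm r ^+ 2.
  by rewrite CE enorm_sqrD.
(* The source of the adjoint equation reproduces the cross term of [E1] exactly, so that of the cost
   difference only the square of [C *m dx] is left over; the term in [As *m dx] cancels against the
   one in [E3]. *)
have E2 : dotv (- (As^T *m p) + (2 * al) *: (C^T *m r)) dx =
  - dotv p (As *m dx) + 2 * al * dotv r (C *m dx).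
  by rewrite dotvDl -scaleN1r !dotvZl mulN1r -!dotv_mulmx.
have E3 : dotv p (Av *m zz + Bv - (As *m x + Bs)) =
   dotv p ((Av - As) *m dx) + dotv p (As *m dx) + dotv p (Av *m x + Bv) - dotv p (As *m
     x + Bs).
  rewrite dotvBr; congr (_ - _); rewrite -!dotvDr; congr dotv.
  by rewrite -mulmxDl subrK addrA -mulmxDr subrK.
rewrite -/dx -/r E1 E2 E3.
have hC := half_sqr_le Halpha dx.
have hA := A_lipschitz HP p dx tD (Omega_sub HP Ow) (usU tD) (vU tD).
have hp := adjoint_le HP usU usx usp Ow tD.
have G0 := G_A_ge0 HP.
have M0 := M_P_ge0 HP.
have h1 : dotv p ((Av - As) *m dx) <= M_P P * (G_A P * enorm (v t - us t)) * enorm dx.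
  apply: le_trans (ler_norm _) _; apply: le_trans hA _.
  by rewrite ler_wpM2r ?enorm_ge0// ler_wpM2r// mulr_ge0 ?enorm_ge0.
(* Young's inequality; the half square of [dx] is the quantity that [half_sqr_le] controls. *)
have h2 : M_P P * (G_A P * enorm (v t - us t)) * enorm dx <=
   (M_P P * (G_A P * enorm (v t - us t))) ^+ 2 / 2 + enorm dx ^+ 2 / 2.
  have := sqr_ge0 (M_P P * (G_A P * enorm (v t - us t)) - enorm dx); nra.
have h3 : (M_P P * (G_A P * enorm (v t - us t))) ^+ 2 / 2 =
   M_P P ^+ 2 * G_A P ^+ 2 / 2 * enorm (v t - us t) ^+ 2 by ring.
move: hC h1 h2; rewrite h3; clear; lra.
Qed.

End competitor.

Section concavity.

Lemma hamiltonian_integrable t (w' : 'cV[R]_m) : D t -> U w' ->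
  mu.-integrable Om (EFin \o (fun w => dotv (ps t w) (A t w w' *m xs t w + B t w w')
     - al * enorm (C *m xs t w - FF w t) ^+ 2 - be * enorm w' ^+ 2)).
Proof.
move=> Dt Uw'; apply: within_continuous_integrable; first exact: (Omega_compact HP).
apply: (@ulim_within_continuous _ _ _ _ _ P (fun w t =>
  dotv (ps t w) (A t w w' *m xs t w + B t w w')
     - al * enorm (C *m xs t w - FF w t) ^+ 2 - be * enorm w' ^+ 2)) => // w0 Ow0.
have h1 := hamiltonian_ulim HP usU usx usp (v := fun=> w') Ow0 (fun _ _ => Uw').
have h2 := state_cost_ulim HP usU usx Ow0.
have cN : ulim (near_Om w0) D (fun _ _ => -1 : R) (fun=> -1).
  by apply: (@ulim_cst _ _ _ _ _ _ _ `|-1|).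
have cb : ulim (near_Om w0) D (fun _ _ => - (be * enorm w' ^+ 2)) (fun=> - (be * enorm
  w' ^+ 2)).
  by apply: (@ulim_cst _ _ _ _ _ _ _ `|- (be * enorm w' ^+ 2)|).
apply: ulim_ext (ulimD (ulimD h1 (ulimM cN h2)) cb) => [w s|s]; by rewrite mulN1r.
Qed.

(** For each [w], [hamiltonian_segment] loses half the second-derivative bound times [s * (1 - s)],
    while the parallelogram identity [enorm_sqr_segment] turns [- beta |u|^2] into a gain of [beta].
    Integration keeps the constants because [mu] has mass 1 on [Omega]. *)
Lemma hamiltonian_concave t (u0 u1 : 'cV[R]_m) s : D t -> U u0 -> U u1 -> 0 <= s <= 1 ->
  (1 - s) * hamiltonian P (xs t) (ps t) u0 t + s * hamiltonian P (xs t) (ps t) u1 t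
    + (be - M_P P * (H_A P * M_X P + H_B P) / 2) * (s * (1 - s)) * enorm (u1 - u0) ^+ 2
  <= hamiltonian P (xs t) (ps t) (u0 + s *: (u1 - u0)) t.
Proof.
move=> Dt Uu0 Uu1 s01; have Uus := convex_segment (U_convex HP) Uu0 Uu1 s01.
have i0 := hamiltonian_integrable Dt Uu0.
have i1 := hamiltonian_integrable Dt Uu1.
have is_ := hamiltonian_integrable Dt Uus.
have mO := borel_compact (Omega_compact HP).
set c := (_ - _) * _ * _.
have icst (r : R) : mu.-integrable Om (EFin \o cst r) by exact:
  finite_measure_integrable_cst.
have iZ (r : R) f : mu.-integrable Om (EFin \o f) ->
  mu.-integrable Om (EFin \o (fun w => r * f w)).
  by move=> fi; exact: (integrableZl mO r fi).
rewrite /hamiltonian -!RintegralZl//.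
have -> : c = \int[mu]_(w in Om) cst c w.
  by rewrite Rintegral_cst// [X in fine X](mu_Omega HP)/= mulr1.
rewrite -RintegralD//; [|exact: iZ|exact: iZ].
rewrite -RintegralD//; last exact: (integrableD mO (iZ _ _ i0) (iZ _ _ i1)).
apply: le_Rintegral => //.
  by apply: (integrableD mO (integrableD mO (iZ _ _ i0) (iZ _ _ i1)) (icst c)).
move=> w Ow; rewrite /cst.
have h := hamiltonian_segment HP (ps t w) (xs t w) Dt (Omega_sub HP Ow) Uu0 Uu1 s01.
have hA := D2uA_le HP (u1 - u0) Dt (Omega_sub HP Ow) Uu0.
have hB := D2uB_le HP (u1 - u0) Dt (Omega_sub HP Ow) Uu0.
have hp := adjoint_le HP usU usx usp Ow Dt.
have hx := state_le HP usU usx Ow Dt.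
(* The sign is established for the product with the squared length, where it can be read off the
   bound on [D2u]. *)
have HA0 : 0 <= H_A P * enorm (u1 - u0) ^+ 2 by exact: le_trans (spec_norm_ge0 _) hA.
have HB0 : 0 <= H_B P * enorm (u1 - u0) ^+ 2 by exact: le_trans (enorm_ge0 _) hB.
have hK : enorm (ps t w) * (H_A P * enorm (xs t w) + H_B P) * enorm (u1 - u0) ^+ 2 <=
    M_P P * (H_A P * M_X P + H_B P) * enorm (u1 - u0) ^+ 2.
  have -> : enorm (ps t w) * (H_A P * enorm (xs t w) + H_B P) * enorm (u1 - u0) ^+ 2 =
    enorm (ps t w) * (H_A P * enorm (u1 - u0) ^+ 2 * enorm (xs t w) + H_B P * enorm (u1
      - u0) ^+ 2) by ring.
  have -> : M_P P * (H_A P * M_X P + H_B P) * enorm (u1 - u0) ^+ 2 =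
    M_P P * (H_A P * enorm (u1 - u0) ^+ 2 * M_X P + H_B P * enorm (u1 - u0) ^+ 2) by ring.
  apply: ler_pM => //; first exact: enorm_ge0.
    by rewrite addr_ge0// mulr_ge0// enorm_ge0.
  by rewrite lerD2r ler_wpM2l.
have nE : enorm (u0 + s *: (u1 - u0)) ^+ 2 =
   (1 - s) * enorm u0 ^+ 2 + s * enorm u1 ^+ 2 - s * (1 - s) * enorm (u1 - u0) ^+ 2.
  by rewrite enorm_sqr_segment [u0 + (u1 - u0)]addrC subrK.
have ss0 : 0 <= s * (1 - s) by move: s01 => /andP[? ?]; rewrite mulr_ge0// subr_ge0.
have hK' := ler_wpM2r ss0 hK.
rewrite nE /c; move: h hK'.
set a0 := dotv _ (A t w u0 *m _ + _); set a1 := dotv _ (A t w u1 *m _ + _);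
  set as' := dotv _ _.
set e2 := enorm (u1 - u0) ^+ 2; set F := al * _; clear; lra.
Qed.

(** Maximality at [us t] is tested at the point of parameter [s] on the segment towards [w'].
    Concavity gives [s * (1 - s) * Y <= s * X]; divide by [s] and let [s] tend to 0. *)
Lemma maximum_gap t (w' : 'cV[R]_m) : D t -> maximizes_hamiltonian P xs ps us t -> U w' ->
  (be - M_P P * (H_A P * M_X P + H_B P) / 2) * enorm (w' - us t) ^+ 2 <=
  hamiltonian P (xs t) (ps t) (us t) t - hamiltonian P (xs t) (ps t) w' t.
Proof.
move=> Dt [Uus Hmax] Uw'.
set K := be - _; set Y := K * _; set X := _ - _.
have H s : 0 < s -> s <= 1 -> (1 - s) * Y <= X.
  move=> s0 s1; have s01 : 0 <= s <= 1 by rewrite ltW.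
  have h1 := hamiltonian_concave Dt Uus Uw' s01.
  have h2 := Hmax _ (convex_segment (U_convex HP) Uus Uw' s01).
  have h3 := le_trans h1 h2.
  rewrite -(ler_pM2l s0) /X /Y; move: h3; rewrite -/K; clear; lra.
apply/ler_addgt0Pr => e e0.
have Ye : 0 < `|Y| + e by rewrite ltr_wpDl.
(* This parameter lies in []0, 1]] and makes [s * Y] at most [e]. *)
have := H (e / (`|Y| + e)); rewrite divr_gt0// => /(_ isT).
rewrite ler_pdivrMr// mul1r lerDr normr_ge0 => /(_ isT).
have h : e / (`|Y| + e) * Y <= e.
  apply: (@le_trans _ _ (e / (`|Y| + e) * (`|Y| + e))); last by rewrite divfK// gt_eqF.
  apply: ler_wpM2l; first by rewrite divr_ge0// ltW.
  by have := ler_norm Y; lra.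
rewrite mulrBl mul1r; lra.
Qed.

End concavity.
End duality.

(** * The cost *)

Section cost.
Context {R : realType} {m n d d' : nat} (P : problem R m n d d') (HP :
  standing_assumptions P).
Local Notation T := (ps_T P).
Local Notation U := (ps_U P).
Local Notation C := (ps_C P).
Local Notation FF := (ps_FF P).
Local Notation Om := (ps_Omega P).
Local Notation al := (ps_alpha P).
Local Notation be := (ps_beta P).
Local Notation mu := (ps_mu P).
Local Notation near_Om w := (within Om (nbhs w)).
Local Notation D := (`[0, T]%classic : set R).
Local Notation cleb := (@completed_lebesgue_measure R).
Local Notation CT := (caratheodory_type ((wlength (@idfun R))^*)%mu).

Lemma within_continuous_completed (f : R -> R) :
  {within D, continuous f} -> measurable_fun (D : set CT) f.
Proof.
move=> cf; apply: completed_measurable_fun => //.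
exact: subspace_continuous_measurable_fun.
Qed.

Lemma lipschitz_within_continuous (f : R -> R) (L : R) : 0 <= L ->
  (forall s t, D s -> D t -> `|f t - f s| <= L * `|t - s|) -> {within D, continuous f}.
Proof.
move=> L0 fL; apply/subspace_continuousP => t Dt; apply/cvgrPdist_le => e e0.
have L1 : 0 < L + 1 by rewrite ltr_wpDl.
have : \forall s \near t, `|t - s| < e / (L + 1).
  by apply/nbhs_ballP; exists (e / (L + 1)) => //=; exact: divr_gt0.
rewrite near_withinE; apply: filterS => s h Ds.
apply: le_trans (fL _ _ Ds Dt) _.
apply: (@le_trans _ _ ((L + 1) * `|t - s|)); first by rewrite ler_wpM2r// lerDl.
by rewrite mulrC -ler_pdivlMr// ltW.
Qed.

Lemma U_bounded : exists2 K : R, 0 <= K & forall v, U v -> enorm v <= K.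
Proof.
have /compact_bounded[K [Kr HK]] := U_compact HP.
have [v0 Uv0] := U_neq0 HP.
have H v : U v -> enorm v <= Num.sqrt m%:R * (K + 1).
  move=> Uv; apply: le_trans (enorm_le _) _; rewrite ler_wpM2l ?sqrtr_ge0//.
  by apply: (HK (K + 1)) => //; rewrite ltrDl.
by exists (Num.sqrt m%:R * (K + 1)) => //; apply: le_trans (enorm_ge0 v0) (H _ Uv0).
Qed.

Variables (u : R -> 'cV[R]_m) (x : R -> cpath T d -> 'cV[R]_n).
Hypotheses (uc : is_control P u) (ux : is_state P u x).

Let uU : forall t : R, t \in `[0, T] -> U (u t). Proof. exact: uc.1. Qed.
Let T0 : 0 < T. Proof. exact: (T_gt0 HP). Qed.

Definition expected_cost t : R :=
  \int[mu]_(w in Om) (al * enorm (C *m x t w - FF w t) ^+ 2 + be * enorm (u t) ^+ 2).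

Lemma state_cost_integrable t : D t ->
  mu.-integrable Om (EFin \o (fun w => al * enorm (C *m x t w - FF w t) ^+ 2)).
Proof.
move=> Dt; apply: within_continuous_integrable; first exact: (Omega_compact HP).
apply: (@ulim_within_continuous _ _ _ _ _ P (fun w t =>
  al * enorm (C *m x t w - FF w t) ^+ 2)) => // w0 Ow0.
exact: (state_cost_ulim HP uU ux Ow0).
Qed.

Let mO : measurable (Om : set (g_sigma_algebraType (@open (cpath T d)))).
Proof. exact: borel_compact (Omega_compact HP). Qed.

Lemma running_cost_integrable t : D t ->
  mu.-integrable Om (EFin \o (fun w => al * enorm (C *m x t w - FF w t) ^+ 2 + be *
    enorm (u t) ^+ 2)).
Proof.
move=> Dt; have icst (r : R) : mu.-integrable Om (EFin \o cst r) by exact: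
  finite_measure_integrable_cst.
exact: (integrableD mO (state_cost_integrable Dt) (icst (be * enorm (u t) ^+ 2))).
Qed.

Lemma expected_costE t : D t -> expected_cost t =
  \int[mu]_(w in Om) (al * enorm (C *m x t w - FF w t) ^+ 2) + be * enorm (u t) ^+ 2.
Proof.
move=> Dt; rewrite /expected_cost RintegralD//; last 2 first.
- exact: state_cost_integrable.
- exact: finite_measure_integrable_cst.
by congr (_ + _); rewrite Rintegral_cst// [X in fine X](mu_Omega HP)/= mulr1.
Qed.

Lemma expected_cost_ge0 t : 0 <= expected_cost t.
Proof.
have al0 := ltW (alpha_gt0 HP); have be0 := ltW (beta_gt0 HP).
by apply: Rintegral_ge0 => w _; rewrite addr_ge0// mulr_ge0// sqr_ge0.
Qed.

Lemma expected_cost_bounded : exists K : R, forall t, 0 <= t <= T ->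
  `|expected_cost t| <= K.
Proof.
have al0 := ltW (alpha_gt0 HP); have be0 := ltW (beta_gt0 HP).
have [KU KU0 HKU] := U_bounded.
pose K := al * (spec_norm C * M_X P + ps_M_Omega' P) ^+ 2 + be * KU ^+ 2.
exists K => t t0T; have Dt : D t by rewrite /= in_itv.
rewrite ger0_norm ?expected_cost_ge0//.
have icst (r : R) : mu.-integrable Om (EFin \o cst r) by exact:
  finite_measure_integrable_cst.
have -> : K = \int[mu]_(w in Om) cst K w by rewrite Rintegral_cst// [X in fine
  X](mu_Omega HP)/= mulr1.
apply: le_Rintegral => //; first exact: running_cost_integrable.
move=> w Ow; rewrite /cst /K; apply: lerD; apply: ler_wpM2l => //.
  have h := residual_le HP uU ux Ow Dt.
  by rewrite ler_pXn2r// nnegrE ?enorm_ge0// (le_trans (enorm_ge0 _) h).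
by rewrite ler_pXn2r// ?nnegrE ?enorm_ge0//; apply: HKU; exact: uU.
Qed.

Lemma state_cost_measurable w : Om w ->
  measurable_fun (D : set CT) (fun t => al * enorm (C *m x t w - FF w t) ^+ 2).
Proof.
move=> Ow; apply: within_continuous_completed.
have cx j : {within D, continuous (fun t => x t w j 0)}.
  pose L := ps_M_A P * M_X P + ps_M_B P.
  apply: (@lipschitz_within_continuous _ L).
    rewrite /L addr_ge0 ?(ltW (M_B_gt0 HP))// mulr_ge0 ?(M_X_ge0 HP)//.
    exact: (ltW (M_A_gt0 HP)).
  move=> s t; rewrite /= !in_itv/= => Ds Dt.
  apply: le_trans (state_lipschitz HP uU ux Ow Ds Dt).
  by have := coord_le_enorm (x t w - x s w) j; rewrite !mxE.
have cF j : {within D, continuous (fun t => FF w t j 0)}.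
  have cFF : {within D, continuous (FF w)} by case: (FF w) => f /= /set_mem[].
  move=> t; apply: (@continuous_comp (subspace D) _ _ (FF w) (fun M : 'cV[R]_d' =>
    M j 0)).
    exact: cFF.
  exact: coord_continuous.
have sumc (I : finType) (F : I -> R -> R) : (forall i, {within D, continuous (F i)}) ->
    {within D, continuous (fun t => \sum_i F i t)}.
  by move=> cf; exact: (@continuous_bigsum R (subspace D) I F cf).
have cr j : {within D, continuous (fun t => (C *m x t w - FF w t) j 0)}.
  have -> : (fun t => (C *m x t w - FF w t) j 0) = (fun t =>
    (\sum_k C j k * x t w k 0) - FF w t j 0).
    by apply/funext => t; rewrite !mxE.
  move=> t; apply: cvgB; last exact: cF.
  apply: (sumc _ (fun k t => C j k * x t w k 0)) => k s.
  by apply: cvgM; [exact: cvg_cst|exact: cx].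
have -> : (fun t => al * enorm (C *m x t w - FF w t) ^+ 2) =
    (fun t => al * \sum_j (C *m x t w - FF w t) j 0 * (C *m x t w - FF w t) j 0).
  by apply/funext => s; rewrite enorm_sqr.
move=> t; apply: cvgM; first exact: cvg_cst.
apply: (sumc _ (fun j t => (C *m x t w - FF w t) j 0 * (C *m x t w - FF w t) j 0)) => j s.
by apply: cvgM; exact: cr.
Qed.

(** The expected state cost is the uniform limit of quadrature sums, each a finite combination of
    state costs at fixed points of [Omega], which are continuous in time. The remaining term
    inherits the Lebesgue measurability of the control. *)
Lemma expected_cost_measurable : measurable_fun (D : set CT) expected_cost.
Proof.
apply: (@eq_measurable_fun _ _ CT _ D (fun t =>
   \int[mu]_(w in Om) (al * enorm (C *m x t w - FF w t) ^+ 2) + be * enorm (u t) ^+ 2)).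
  by move=> t /set_mem Dt; rewrite expected_costE.
apply: measurable_funD; last first.
  apply: measurable_funM; first exact: measurable_cst.
  rewrite (_ : (fun t => enorm (u t) ^+ 2) = (fun t => \sum_i u t i 0 * u t i 0));
    last first.
    by apply/funext => t; rewrite enorm_sqr.
  by apply: measurable_sum => i; apply: measurable_funM; exact: uc.2.
pose f w t := al * enorm (C *m x t w - FF w t) ^+ 2.
have approx k : exists Q : R -> R, measurable_fun (D : set CT) Q /\
    forall t, D t -> `|\int[mu]_(w in Om) f w t - Q t| <= k.+1%:R^-1.
  have k0 : 0 < k.+1%:R^-1 :> R by rewrite invr_gt0.
  have [N [w [c [Ow _ _ H]]]] := finite_quadrature (P := fun w0 w => forall t, D t ->
    `|f w t - f w0 t| <= k.+1%:R^-1)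
    (Omega_compact HP) (mu_Omega HP) (fun w0 Ow0 =>
      (state_cost_ulim HP uU ux Ow0).1 _ k0).
  exists (fun t => \sum_j c j * f (w j) t); split.
    by apply: measurable_sum => j; apply: measurable_funM;
      [exact: measurable_cst|exact: state_cost_measurable].
  move=> t Dt; apply: (H (f ^~ t)) => [|w0 w1 _ _]; last exact.
  apply: (@ulim_within_continuous _ _ _ _ _ P f) => // w0 Ow0.
  exact: (state_cost_ulim HP uU ux Ow0).
have [Q HQ] := choice approx.
apply: (@measurable_fun_cvg _ CT R D Q) => [k|t Dt]; first exact: (HQ k).1.
apply/cvgrPdist_le => e e0; near=> k.
apply: le_trans ((HQ k).2 t Dt) _; apply: ltW.
by near: k; exact: near_infty_natSinv_lt (PosNum e0).
Unshelve. all: by end_near. Qed.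

Lemma expected_cost_integrable : cleb.-integrable D (EFin \o expected_cost).
Proof.
have [K HK] := expected_cost_bounded.
exact: (completed_integrable (ltW T0) expected_cost_measurable HK).
Qed.

(** Boundedness makes both integrals finite, so that the costs of two pairs can be subtracted. *)
Lemma costE : cost P u x = (\int[cleb]_(t in D) expected_cost t)%:E.
Proof.
rewrite /Rintegral fineK; last first.
  by apply: integrable_fin_num expected_cost_integrable; exact: completed_measurable.
apply: eq_integral => t /set_mem Dt; rewrite /expected_cost /Rintegral fineK//.
exact: (integrable_fin_num mO (running_cost_integrable Dt)).
Qed.

End cost.
Arguments expected_cost {R m n d d'} P u x t.

(** * Optimality *)

Section optimality.
Context {R : realType} {m n d d' : nat} (P : problem R m n d d') (HP :
  standing_assumptions P).
Local Notation T := (ps_T P).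
Local Notation A := (ps_A P).
Local Notation B := (ps_B P).
Local Notation U := (ps_U P).
Local Notation C := (ps_C P).
Local Notation FF := (ps_FF P).
Local Notation Om := (ps_Omega P).
Local Notation al := (ps_alpha P).
Local Notation be := (ps_beta P).
Local Notation mu := (ps_mu P).
Local Notation near_Om w := (within Om (nbhs w)).
Local Notation D := (`[0, T]%classic : set R).
Local Notation cleb := (@completed_lebesgue_measure R).

(** The product rule for bounded Lipschitz functions. The constant does not depend on [w], so convex
    combinations of pairings share it. *)
Lemma pairing_lipschitz (us v : R -> 'cV[R]_m) (xs ps z : R -> cpath T d -> 'cV[R]_n) w :
  is_control P us -> is_state P us xs -> is_adjoint P us xs ps ->
  is_control P v -> is_state P v z -> Om w ->
  let Lx := ps_M_A P * M_X P + ps_M_B P in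
  let Lp := ps_M_A P * M_P P + adjoint_forcing P in
  forall s t, 0 <= s <= T -> 0 <= t <= T ->
  `|dotv (ps t w) (z t w - xs t w) - dotv (ps s w) (z s w - xs s w)| <=
  (M_P P * (Lx + Lx) + Lp * (M_X P + M_X P)) * `|t - s|.
Proof.
move=> [usU _] usx usp [vU _] vz Ow Lx Lp s t hs ht.
have Ds : s \in `[0, T] by rewrite in_itv.
have Dt : t \in `[0, T] by rewrite in_itv.
have -> : dotv (ps t w) (z t w - xs t w) - dotv (ps s w) (z s w - xs s w) =
   dotv (ps t w) ((z t w - z s w) + - (xs t w - xs s w)) + dotv (ps t w - ps s w) (z s
     w + - xs s w).
  have -> : (z t w - z s w) + - (xs t w - xs s w) = (z t w - xs t w) - (z s w - xs s w).
    by apply/matrixP => i j; rewrite !mxE; ring.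
  by rewrite [in RHS]dotvBr [dotv (ps t w - _) _]dotvBl addrA subrK.
apply: le_trans (ler_normD _ _) _; rewrite mulrDl; apply: lerD.
  apply: le_trans (dotv_norm_le _ _) _; rewrite -mulrA; apply: ler_pM;
    rewrite ?enorm_ge0//.
    exact: (adjoint_le HP usU usx usp).
  apply: le_trans (ler_enormD _ _) _; rewrite mulrDl enormN; apply: lerD.
    exact: (state_lipschitz HP vU vz).
  exact: (state_lipschitz HP usU usx).
apply: le_trans (dotv_norm_le _ _) _; rewrite mulrAC; apply: ler_pM; rewrite ?enorm_ge0//.
  exact: (adjoint_lipschitz HP usU usx usp).
apply: le_trans (ler_enormD _ _) _; rewrite enormN; apply: lerD.
  exact: (state_le HP vU vz).
exact: (state_le HP usU usx).
Qed.

Lemma maximum_principle_sufficient (us : R -> 'cV[R]_m) (xs ps : R -> cpath T d ->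
  'cV[R]_n) :
  1 / (2 * lambda_min (C^T *m C)) < al ->
  M_P P * (H_A P * M_X P + H_B P) / 2 + M_P P ^+ 2 * G_A P ^+ 2 / 2 <= be ->
  admissible P us xs -> is_adjoint P us xs ps ->
  {ae lebesgue_measure, forall t : R, t \in `[0, T] ->
    maximizes_hamiltonian P xs ps us t} ->
  optimal P us xs.
Proof.
move=> Halpha Hbeta [usc usx] usp Hmax; split; first exact: (conj usc usx).
move=> v z [vc vz].
have usU := usc.1; have vU := vc.1; have T0 := T_gt0 HP.
have mO := borel_compact (Omega_compact HP).
rewrite (costE HP usc usx) (costE HP vc vz) lee_fin.
pose S t := expected_cost P v z t - expected_cost P us xs t.
have mD : measurable (D : set (caratheodory_type ((wlength (@idfun R))^*)%mu)).
  exact: completed_measurable.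
have iv := expected_cost_integrable HP vc vz.
have ius := expected_cost_integrable HP usc usx.
rewrite -subr_ge0 -RintegralB//.
have [Kv HKv] := expected_cost_bounded HP vc vz.
have [Ks HKs] := expected_cost_bounded HP usc usx.
have mS : measurable_fun (D : set (caratheodory_type ((wlength (@idfun R))^*)%mu)) S.
  apply: measurable_funB; [exact: (expected_cost_measurable HP vc vz)|exact:
    (expected_cost_measurable HP usc usx)].
have SK t : 0 <= t <= T -> `|S t| <= Kv + Ks.
  by move=> ht; apply: le_trans (ler_normB _ _) _; apply: lerD; [exact: HKv|exact: HKs].
rewrite -[X in 0 <= X]/(\int[cleb]_(t in D) S t).
apply/ler_addgt0Pr => e e0.
(* The quadrature error is made at each time and integrates to [eps * T = e]. *)
pose eps := e / T; have eps0 : 0 < eps by rewrite divr_gt0.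
have -> : e = eps * T by rewrite /eps divfK// gt_eqF.
pose hint w' t w := dotv (ps t w) (A t w (w' t) *m xs t w + B t w (w' t)).
(* The bound of [duality_ae] without its quadratic term; this is the family to which the quadrature
   is applied. *)
pose f w t := al * enorm (C *m z t w - FF w t) ^+ 2 - al * enorm (C *m xs t w - FF w t)
  ^+ 2
   - (hint us t w - hint v t w).
have fu w0 : Om w0 -> ulim (near_Om w0) D f (f w0).
  move=> Ow0.
  have cN : ulim (near_Om w0) D (fun _ _ => -1 : R) (fun=> -1).
    by apply: (@ulim_cst _ _ _ _ _ _ _ `|-1|).
  have u1 := state_cost_ulim HP vU vz Ow0.
  have u2 := state_cost_ulim HP usU usx Ow0.
  have u3 := hamiltonian_ulim HP usU usx usp Ow0 usU.
  have u4 := hamiltonian_ulim HP usU usx usp Ow0 vU.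
  apply: ulim_ext (ulimD (ulimD u1 (ulimM cN u2)) (ulimM cN (ulimD u3 (ulimM cN u4))))
    => [w t|t];
    by rewrite /f /hint !mulN1r.
have [N [w [c [Ow c0 c1 quad]]]] := finite_quadrature
  (P := fun w0 w => forall t, D t -> `|f w t - f w0 t| <= eps)
  (Omega_compact HP) (mu_Omega HP) (fun w0 Ow0 => (fu w0 Ow0).1 _ eps0).
pose y k t := dotv (ps t (w k)) (z t (w k) - xs t (w k)).
pose Y t := \sum_k c k * y k t.
pose L := M_P P * ((ps_M_A P * M_X P + ps_M_B P) + (ps_M_A P * M_X P + ps_M_B P)) +
   (ps_M_A P * M_P P + adjoint_forcing P) * (M_X P + M_X P).
have L0 : 0 <= L.
  have [MA0 MB0] := (ltW (M_A_gt0 HP), ltW (M_B_gt0 HP)).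
  have MX0 := M_X_ge0 HP; have MP0 := M_P_ge0 HP; have af0 := adjoint_forcing_ge0 HP.
  have Lx0 : 0 <= ps_M_A P * M_X P + ps_M_B P by apply: addr_ge0 => //; exact: mulr_ge0.
  have Lp0 : 0 <= ps_M_A P * M_P P + adjoint_forcing P by apply: addr_ge0 => //;
    exact: mulr_ge0.
  by apply: addr_ge0; apply: mulr_ge0 => //; exact: addr_ge0.
have YL s t : 0 <= s <= T -> 0 <= t <= T -> `|Y t - Y s| <= L * `|t - s|.
  move=> hs ht; rewrite /Y -sumrB; apply: le_trans (ler_norm_sum _ _ _) _.
  rewrite -[leRHS]mul1r -c1 mulr_suml; apply: ler_sum => k _.
  rewrite -mulrBr normrM ger0_norm//; apply: ler_wpM2l => //.
  exact: (pairing_lipschitz usc usx usp vc vz (Ow k)).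
have Y0 : Y 0 = 0.
  rewrite /Y big1// => k _; have [_ E1] := vz _ (Ow k); have [_ E2] := usx _ (Ow k).
  by rewrite /y E1 E2 subrr /dotv big1 ?mulr0// => i _; rewrite !mxE mulr0.
have YT : Y T = 0.
  rewrite /Y big1// => k _; have [_ E] := usp _ (Ow k).
  by rewrite /y E /dotv big1 ?mulr0// => i _; rewrite !mxE mul0r.
(* The state costs inside the two Hamiltonians cancel, being taken along the same [xs], and the
   terms in [beta] cancel between [S] and the Hamiltonians. *)
have fE t : D t -> \int[mu]_(w in Om) f w t = S t -
    (hamiltonian P (xs t) (ps t) (us t) t - hamiltonian P (xs t) (ps t) (v t) t).
  move=> Dt.
  have i1 := running_cost_integrable HP vc vz Dt.
  have i2 := running_cost_integrable HP usc usx Dt.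
  have i3 := hamiltonian_integrable HP usU usx usp Dt (usU t Dt).
  have i4 := hamiltonian_integrable HP usU usx usp Dt (vU t Dt).
  rewrite /S /expected_cost /hamiltonian -RintegralB// -RintegralB//.
  rewrite -RintegralB//; last 2 first.
  - exact: (integrableB mO i1 i2).
  - exact: (integrableB mO i3 i4).
  by apply: eq_Rintegral => w' _; rewrite /f /hint; ring.
have dY : {ae lebesgue_measure, forall t : R, t \in `]0, T[ ->
  exists2 l, is_derive t 1 Y l & l <= S t + eps}.
  have aeF := ae_filter_ringOfSetsType (@lebesgue_measure R).
  have Hk : {ae lebesgue_measure, forall t : R, forall k, t \in `]0, T[ ->
      exists2 l, is_derive t 1 (y k) l & l <= f (w k) t + M_P P ^+ 2 * G_A P ^+ 2 / 2 *
        enorm (v t - us t) ^+ 2}.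
    apply: (@filter_forall _ _ (fun k t => t \in `]0, T[ ->
      exists2 l, is_derive t 1 (y k) l & l <= f (w k) t + M_P P ^+ 2 * G_A P ^+ 2 / 2 *
        enorm (v t - us t) ^+ 2)
      (almost_everywhere lebesgue_measure) aeF) => k.
    exact: (duality_ae HP usU usx usp vU vz Halpha (Ow k)).
  apply: (@filterS2 _ (almost_everywhere lebesgue_measure) aeF _ _ _ _ Hk Hmax).
  move=> t Ht Hm tT; have Dt : t \in `[0, T] by exact: subset_itv_oo_cc.
  have /choice[l Hl] : forall k, exists l, is_derive t 1 (y k) l /\
      l <= f (w k) t + M_P P ^+ 2 * G_A P ^+ 2 / 2 * enorm (v t - us t) ^+ 2.
    by move=> k; have [l ? ?] := Ht k tT; exists l.
  exists (\sum_k c k * l k).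
    have -> : Y = \sum_k (c k *: y k) by apply/funext => s; rewrite /Y fct_sumE.
    by apply: is_derive_sum => k; apply: is_deriveZ; exact: (Hl k).1.
  (* The weighted derivative is at most the quadrature of [f] plus the Young loss; the quadrature is
     at most [S t + eps] minus the Hamiltonian gap; and the gap exceeds the loss by the bound on
     [beta]. *)
  have gap := maximum_gap HP usU usx usp Dt (Hm Dt) (vU t Dt).
  have q : `|\int[mu]_(w in Om) f w t - \sum_k c k * f (w k) t| <= eps.
    apply: (quad (f ^~ t)) => [|w0 w1 _ _]; last exact.
    exact: (@ulim_within_continuous _ _ _ _ _ P f _ Dt).
  rewrite fE// ler_norml in q; move: q => /andP[q _].
  have h1 : \sum_k c k * l k <= \sum_k c k * f (w k) t + M_P P ^+ 2 * G_A P ^+ 2 / 2 *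
    enorm (v t - us t) ^+ 2.
    move: (_ * enorm _ ^+ 2) (fun k => (Hl k).2) => r lr.
    rewrite -[r]mul1r -c1 mulr_suml -big_split/=; apply: ler_sum => k _.
    by rewrite -mulrDr; apply: ler_wpM2l.
  have h2 : M_P P ^+ 2 * G_A P ^+ 2 / 2 * enorm (v t - us t) ^+ 2 <=
      (be - M_P P * (H_A P * M_X P + H_B P) / 2) * enorm (v t - us t) ^+ 2.
    by rewrite ler_wpM2r ?sqr_ge0//; lra.
  move: gap q h1 h2; clear; lra.
have := lipschitz_increment_le T0 L0 (ltW eps0) YL mS SK dY.
by rewrite Y0 YT subrr.
Qed.

End optimality.

Theorem corollary5p1 (R : realType) (m n d d' : nat) (P : problem R m n d d')
  (HP : standing_assumptions P)
  (Halpha : 1 / (2 * lambda_min ((ps_C P)^T *m ps_C P)) < ps_alpha P)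
  (Hbeta : 1 / 2 * M_P P * (H_A P * M_X P + H_B P)
             + Num.max (C_E P) (1 / 2 * M_P P ^+ 2 * G_A P ^+ 2) < ps_beta P)
  (u : nat -> R -> 'cV[R]_m) (x p : nat -> R -> cpath (ps_T P) d -> 'cV[R]_n)
  (Happrox : successive_approximations P u x p)
  (us : R -> 'cV[R]_m) (xs ps : R -> cpath (ps_T P) d -> 'cV[R]_n)
  (Hadm : admissible P us xs)
  (Hadj : is_adjoint P us xs ps)
  (phi : nat -> nat) (Hphi : {homo phi : i j / (i < j)%N})
  (Hu : {uniform `[0, ps_T P], (fun j => u (phi j)) @ \oo --> us})
  (Hx : {uniform `[0, ps_T P] `*` ps_Omega P,
          (fun j z => x (phi j) z.1 z.2) @ \oo --> (fun z : R * cpath (ps_T P) d => xs z.1 z.2)})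
  (Hp : {uniform `[0, ps_T P] `*` ps_Omega P,
          (fun j z => p (phi j) z.1 z.2) @ \oo --> (fun z : R * cpath (ps_T P) d => ps z.1 z.2)})
  (Hmax : {ae lebesgue_measure, forall t : R, t \in `[0, ps_T P] ->
            maximizes_hamiltonian P xs ps us t}) :
  optimal P us xs.
Proof.
apply: (maximum_principle_sufficient HP Halpha _ Hadm Hadj Hmax).
apply/ltW/(le_lt_trans _ Hbeta).
have : 1 / 2 * M_P P ^+ 2 * G_A P ^+ 2 <= Num.max (C_E P) (1 / 2 * M_P P ^+ 2 * G_A P ^+ 2).
  by rewrite le_max lexx orbT.
move: (Num.max _ _) => c; lra.
Qed.
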